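(* Let $c>3$. For instances of Popular Matching with Weighted Voters in which every vertex of $A$ has weight $c$ and every vertex of $B$ has weight $1$, there is an algorithm running in $O(n\cdot m)$ time (with $n$ the number of vertices and $m$ the number of edges) that either outputs a popular matching or correctly decides that no popular matching exists.
   Context: Popular Matching with Weighted Voters: the input is a bipartite graph $G=(A\cup B,E)$, for each vertex $v$ a strict preference order $\succ_v$ over its neighbours, and vertex weights $w:V\to\mathbb{Q}_{\ge0}$ ($V=A\cup B$); the question is whether a popular matching exists. Every vertex prefers being matched to any neighbour over being unmatched. For matchings $M,M'$, let $V^+(M,M')$ be the set of vertices preferring their partner in $M$ to their partner (or unmatched status) in $M'$, and $\Delta_w(M,M')=\sum_{v\in V^+(M,M')}w(v)-\sum_{v\in V^+(M',M)}w(v)$. A matching $M$ is popular if $\Delta_w(M,M')\ge0$ for every matching $M'$. *)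

(* Defs.v *)
From mathcomp Require Import all_boot all_order all_algebra.

Set Implicit Arguments.
Unset Strict Implicit.
Unset Printing Implicit Defensive.

Import Order.TTheory GRing.Theory Num.Theory.
Local Open Scope ring_scope.

(* The vertices are numbered 0, ..., nvert - 1, as in the input of a program.
   [sideA] is the side A of the bipartition; its complement is B.
   [pref v x y] reads "v prefers x to y"; its values on non-neighbours of v
   are never used. *)
Record instance := Instance {
  nvert : nat;
  sideA : {set 'I_nvert};
  adj : rel 'I_nvert;
  pref : 'I_nvert -> rel 'I_nvert;
  weight : 'I_nvert -> rat;
  adj_sym : symmetric adj;
  adj_bip : forall x y, adj x y -> (x \in sideA) != (y \in sideA);
  pref_irr : forall v x, adj v x -> ~~ pref v x x;
  pref_trans : forall v x y z, adj v x -> adj v y -> adj v z ->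
    pref v x y -> pref v y z -> pref v x z;
  pref_total : forall v x y, adj v x -> adj v y -> x != y ->
    pref v x y || pref v y x;
  weight_ge0 : forall v, 0 <= weight v
}.

Section Popularity.
Variable G : instance.
Local Notation V := 'I_(nvert G).

Definition edges : {set {set V}} :=
  [set e : {set V} | [exists x, exists y, adj x y && (e == [set x; y])]].

Definition matching (M : {set {set V}}) : bool :=
  (M \subset edges) && trivIset M.

Definition partner (M : {set {set V}}) (v : V) : option V :=
  [pick u | (u != v) && ([set v; u] \in M)].

Definition prefers (v : V) (p q : option V) : bool :=
  match p, q with
  | Some x, Some y => pref v x y
  | Some _, None => true
  | None, _ => false
  end.

Definition Vplus (M M' : {set {set V}}) : {set V} :=
  [set v | prefers v (partner M v) (partner M' v)].

Definition Delta (M M' : {set {set V}}) : rat :=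
  \sum_(v in Vplus M M') weight v - \sum_(v in Vplus M' M) weight v.

Definition popular (M : {set {set V}}) : Prop :=
  matching M /\ (forall M', matching M' -> 0 <= Delta M M').

End Popularity.

Local Open Scope nat_scope.

(* A random access machine with registers and an addressable memory, all
   holding natural numbers.  The only arithmetic is addition and truncated
   subtraction, and each elementary operation or test costs one step.  The
   arguments r, a, b of an instruction are register numbers; k is a literal. *)
Inductive cmd :=
| Const (r k : nat)          (* r := k *)
| Add (r a b : nat)          (* r := a + b *)
| Sub (r a b : nat)          (* r := a - b *)
| Fetch (r a : nat)          (* r := ram[a] *)
| Store (a b : nat)          (* ram[a] := b *)
| Seq (p q : cmd)
| IfLt (a b : nat) (p q : cmd)
| WhileLt (a b : nat) (p : cmd).

Record state := State { reg : nat -> nat; ram : nat -> nat }.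

Definition upd (f : nat -> nat) (i x : nat) : nat -> nat :=
  fun j => if j == i then x else f j.

(* [exec W p s t s']: started in s, p halts in s' after exactly t steps.
   W is the largest integer fitting in a machine word: a program whose
   addition overflows has no execution, so that a program cannot gain time by
   packing data into huge integers. *)
Inductive exec (W : nat) : cmd -> state -> nat -> state -> Prop :=
| exec_const r k s :
    exec W (Const r k) s 1 (State (upd (reg s) r k) (ram s))
| exec_add r a b s : reg s a + reg s b <= W ->
    exec W (Add r a b) s 1 (State (upd (reg s) r (reg s a + reg s b)) (ram s))
| exec_sub r a b s :
    exec W (Sub r a b) s 1 (State (upd (reg s) r (reg s a - reg s b)) (ram s))
| exec_fetch r a s :
    exec W (Fetch r a) s 1 (State (upd (reg s) r (ram s (reg s a))) (ram s))
| exec_store a b s :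
    exec W (Store a b) s 1 (State (reg s) (upd (ram s) (reg s a) (reg s b)))
| exec_seq p q s1 t1 s2 t2 s3 :
    exec W p s1 t1 s2 -> exec W q s2 t2 s3 -> exec W (Seq p q) s1 (t1 + t2) s3
| exec_if_true a b p q s t s' : reg s a < reg s b ->
    exec W p s t s' -> exec W (IfLt a b p q) s t.+1 s'
| exec_if_false a b p q s t s' : reg s b <= reg s a ->
    exec W q s t s' -> exec W (IfLt a b p q) s t.+1 s'
| exec_while_true a b p s1 t1 s2 t2 s3 : reg s1 a < reg s1 b ->
    exec W p s1 t1 s2 -> exec W (WhileLt a b p) s2 t2 s3 ->
    exec W (WhileLt a b p) s1 (t1 + t2).+1 s3
| exec_while_false a b p s : reg s b <= reg s a ->
    exec W (WhileLt a b p) s 1 s.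

Section InputOutput.
Variable G : instance.
Local Notation V := 'I_(nvert G).

(* The neighbours of v, most preferred first. *)
Definition pref_list (v : V) : seq V :=
  sort (fun x y => (x == y) || pref v x y) (enum (adj v)).

(* n, m, then four blocks of n cells (side, numerator and denominator of the
   weight, degree of each vertex), then the preference lists of all vertices
   one after the other. *)
Definition encoding : seq nat :=
  [:: nvert G; #|edges G|]
  ++ [seq nat_of_bool (v \in sideA G) | v <- enum V]
  ++ [seq `|numq (weight v)|%N | v <- enum V]
  ++ [seq `|denq (weight v)|%N | v <- enum V]
  ++ [seq size (pref_list v) | v <- enum V]
  ++ flatten [seq [seq nat_of_ord u | u <- pref_list v] | v <- enum V].

Definition initial : state := State (fun _ => 0) (nth 0 encoding).

(* M is written as an array of n cells whose address is in register 1; cell v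
   is 0 if v is unmatched, and one plus the number of its partner otherwise. *)
Definition writes (s : state) (M : {set {set V}}) : Prop :=
  forall v : V, ram s (reg s 1 + v) =
    (if partner M v is Some u then (nat_of_ord u).+1 else 0).

(* Register 0 tells whether a popular matching has been found. *)
Definition correct_answer (s : state) : Prop :=
  (reg s 0 = 1 /\ exists M, popular M /\ writes s M) \/
  (reg s 0 = 0 /\ ~ exists M, @popular G M).

End InputOutput.

(* Main.v *)
(* Vertex prices certify popularity by linear programming duality.  For c > 3 they
   force every vertex of A to get its top choice or its best neighbour that is
   nobody's top choice (or to stay single).  A post q then runs through the
   vertices for which it is such a choice, first at one price and then at a
   higher one, so that the matching and its prices are encoded by a position for
   each post and a flag that shifts a price by one.  Local conditions on these
   data ("solution") imply popularity; conversely a popular matching yields a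
   solution, the prices being read off the alternating walks that would improve
   the matching.  The conditions are monotone: when one fails, some position or
   flag must increase in every solution above the current data.  Starting from
   zero, the iteration thus stops at a solution or proves that there is none.  A
   round takes time O(n + m), and every round but the last increases the sum of
   positions and flags, which is O(min(n, m)). *)
Require Import Defs.
From mathcomp Require Import all_boot all_order all_algebra.
From mathcomp Require Import zify ring lra.

Set Implicit Arguments.
Unset Strict Implicit.
Unset Printing Implicit Defensive.

Import Order.TTheory GRing.Theory Num.Theory.
Local Open Scope ring_scope.

(** * Matchings as involutions, and duality *)

(** The bound 3 comes from one exchange. Let [a] leave its partner for a post [b] that it prefers,
    and let the vertex thrown out of [b], if [b] is not its top choice, take its top choice [b2].
    Two vertices of A gain, at most one loses (the former partner of [b2]), and at most three posts
    lose (the former partner of [a], [b] and [b2]): the balance [2 * c - c - 3] is positive. So in a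
    popular matching an envied post is held by a vertex whose top choice it is, and every vertex of
    A has at most two candidates.

    Prices come in two groups of three because the alternating walks that matter start with a credit
    of 0 (after a blocking pair), -1 (at an unmatched vertex) or, by default, -2; a price is a
    negated walk value.

    The obstacle is coverage: a vertex of A without a place violates nothing monotone. Comparing the
    current data with a hypothetical larger solution along a chain of displaced vertices shows that
    this vertex sits there at the middle price, which singles out one flag to raise.

    The rank table has n^2 cells; the time bound survives because it is never cleared. *)

Section Preferences.
Variable G : instance.
Local Notation V := 'I_(nvert G).
Implicit Types u v x y : V.

Lemma mem_pref_list v u : (u \in pref_list v) = adj v u.
Proof. by rewrite mem_sort mem_enum. Qed.

Lemma pref_list_uniq v : uniq (pref_list v).
Proof. by rewrite sort_uniq enum_uniq. Qed.

Definition rank v u : nat := index u (pref_list v).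

Lemma rank_lt v u : adj v u -> (rank v u < size (pref_list v))%N.
Proof. by rewrite index_mem mem_pref_list. Qed.

Lemma rank_inj v x y : adj v x -> adj v y -> rank v x = rank v y -> x = y.
Proof.
rewrite -!mem_pref_list => hx hy e.
by rewrite -(nth_index x hx) -(nth_index x hy) -/(rank v x) e.
Qed.

Lemma pref_asym v x y : adj v x -> adj v y -> pref v x y -> ~~ pref v y x.
Proof.
move=> hx hy xy; apply/negP => yx.
by have := pref_irr hx; rewrite (pref_trans hx hy hx xy yx).
Qed.

(** [pref v] is an order on the neighbours of [v] only, hence the sorting lemmas relative to a
    predicate. They give the reflexive order used by the sort; asymmetry recovers the strict one. *)
Lemma pref_rank v x y : adj v x -> adj v y -> pref v x y = (rank v x < rank v y)%N.
Proof.
move=> hx hy; pose r a b := (a == b) || pref v a b.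
have rt : {in pref_list v & &, transitive r}.
  move=> a b d; rewrite !mem_pref_list => ha hb hd /orP[/eqP-> //|ba] /orP[/eqP<-|ad].
    by rewrite /r ba orbT.
  by rewrite /r (pref_trans hb ha hd ba ad) orbT.
have rtot : {in adj v &, total r}.
  move=> a b ha hb; rewrite /r; have [->|ab] := eqVneq a b; first by [].
  by rewrite /=; have := pref_total ha hb ab.
have hl : all (adj v) (enum (adj v)) by apply/allP => a; rewrite mem_enum.
have st : sorted r (pref_list v) by apply: (sort_sorted_in rtot).
have rr : {in pref_list v, reflexive r} by move=> a _; rewrite /r eqxx.
have key : forall a b, adj v a -> adj v b -> (rank v a <= rank v b)%N -> r a b.
  move=> a b ha hb; apply: (sorted_leq_index_in rt rr st); by rewrite mem_pref_list.
have [le|lt] := leqP (rank v y) (rank v x).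
  apply/negbTE; have [->|ne] := eqVneq x y; first exact: pref_irr.
  have := key _ _ hy hx le; rewrite /r eq_sym (negbTE ne) /=.
  exact: pref_asym.
have := key _ _ hx hy (ltnW lt); rewrite /r.
by case: eqP lt => [->|_]; rewrite ?ltnn.
Qed.

Lemma adj_side x y : adj x y -> (y \in sideA G) = (x \notin sideA G).
Proof. by move=> /adj_bip; case: (x \in _); case: (y \in _). Qed.

Lemma adj_neq x y : adj x y -> x != y.
Proof. by move=> h; apply/eqP => e; move: (adj_bip h); rewrite e eqxx. Qed.

End Preferences.

Section Mates.
Variable G : instance.
Local Notation V := 'I_(nvert G).
Implicit Types (u v x y : V) (M : {set {set V}}) (g h : V -> V).

(* A matching seen as an involution of the vertices, whose fixed points are the
   unmatched vertices. *)
Definition mating h := involutive h /\ forall v, h v != v -> adj v (h v).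

Definition mate_opt h v : option V := if h v == v then None else Some (h v).

Definition mate_set h : {set {set V}} :=
  [set [set v; h v] | v in [pred v | h v != v]].

Lemma set2_inj x y z : [set x; y] = [set x; z] -> y = z.
Proof.
move=> e; have: y \in [set x; z] by rewrite -e !inE eqxx orbT.
rewrite !inE => /orP[/eqP yx|/eqP //].
have: z \in [set x; y] by rewrite e !inE eqxx orbT.
by rewrite !inE yx orbb => /eqP.
Qed.

Lemma mem_mate_set h v u : mating h -> u != v ->
  ([set v; u] \in mate_set h) = (h v == u).
Proof.
move=> [hi ha] uv; apply/imsetP/eqP => [[w hw e]|e]; last by exists v; rewrite ?inE e.
have : v \in [set w; h w] by rewrite -e !inE eqxx.
rewrite !inE => /orP[/eqP ev|/eqP ev].
  by move: e; rewrite ev => /set2_inj ->.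
move: e; rewrite ev hi setUC [in RHS]setUC => e.
by apply: (@set2_inj (h w)); rewrite -e setUC.
Qed.

Lemma mate_set_matching h : mating h -> matching (mate_set h).
Proof.
move=> hm; have [hi ha] := hm; apply/andP; split.
  apply/subsetP => _ /imsetP[v hv ->]; rewrite inE.
  by apply/existsP; exists v; apply/existsP; exists (h v); rewrite ha //= eqxx.
apply/trivIsetP => _ _ /imsetP[v hv ->] /imsetP[w hw ->] ne.
apply/pred0Pn => -[z /=]; rewrite !inE.
case/andP => /orP[]/eqP-> /orP[]/eqP e; case/negP: ne.
- by rewrite e.
- by rewrite e hi setUC.
- by rewrite -e hi setUC.
- by rewrite (inv_inj hi e).
Qed.

Lemma partner_mate_set h v : mating h -> partner (mate_set h) v = mate_opt h v.
Proof.
move=> hm; rewrite /partner /mate_opt; case: pickP => [u /andP[uv]|no].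
  by rewrite mem_mate_set // => /eqP->; rewrite (negbTE uv).
case: eqP => // /eqP ne; have := no (h v).
by rewrite ne mem_mate_set // eqxx.
Qed.

Definition mate M v : V := odflt v (partner M v).

Lemma matching_adj M x y : matching M -> x != y -> [set x; y] \in M -> adj x y.
Proof.
move=> /andP[/subsetP sM _] ne /sM; rewrite inE.
case/existsP => a /existsP[b /andP[ab /eqP e]].
have: x \in [set a; b] by rewrite -e !inE eqxx.
rewrite !inE => /orP[]/eqP ex; move: e; rewrite ex.
  by move/set2_inj ->.
by rewrite [RHS]setUC => /set2_inj ->; rewrite adj_sym.
Qed.

Lemma partner_mem M u v : partner M v = Some u -> (u != v) && ([set v; u] \in M).
Proof. by rewrite /partner; case: pickP => // w hw [<-]. Qed.

Lemma matching_uniq M v x y : matching M -> [set v; x] \in M -> [set v; y] \in M -> x = y.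
Proof.
move=> /andP[_ /trivIsetP tM] hx hy; have [/set2_inj//|ne] := eqVneq [set v; x] [set v; y].
have /pred0P/(_ v) := tM _ _ hx hy ne.
by rewrite /= !inE !eqxx.
Qed.

Lemma partner_sym M u v : matching M -> partner M v = Some u -> partner M u = Some v.
Proof.
move=> mM /partner_mem/andP[ne hM]; rewrite {1}/partner; case: pickP => [w /andP[wu hw]|].
  by rewrite (matching_uniq mM hw (_ : [set u; v] \in M)) // setUC.
by move/(_ v); rewrite eq_sym ne setUC hM.
Qed.

Lemma mate_mating M : matching M -> mating (mate M).
Proof.
move=> mM; split=> v; rewrite /mate; case e: (partner M v) => [u|] /=; rewrite ?e ?eqxx //=.
  by rewrite (partner_sym mM e).
move=> _; have /andP[ne hM] := partner_mem e.
by apply: (matching_adj mM) => //; rewrite eq_sym.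
Qed.

Lemma mate_optK M v : mate_opt (mate M) v = partner M v.
Proof.
rewrite /mate_opt /mate; case e: (partner M v) => [u|] /=; last by rewrite eqxx.
by have /andP[/negbTE-> _] := partner_mem e.
Qed.

Definition vote v (p q : option V) : rat :=
  (prefers v p q)%:R - (prefers v q p)%:R.

Definition score h g : rat :=
  \sum_v weight v * vote v (mate_opt h v) (mate_opt g v).

Lemma DeltaE M M' : Delta M' M = score (mate M') (mate M).
Proof.
rewrite /Delta /score.
have half : forall N N' : {set {set V}}, \sum_(v in Vplus N N') weight v =
    \sum_v weight v * (prefers v (partner N v) (partner N' v))%:R.
  move=> N N'; rewrite big_mkcond /=; apply: eq_bigr => v _.
  by rewrite inE; case: ifP; rewrite ?mulr1 ?mulr0.
rewrite !half -sumrB; apply: eq_bigr => v _.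
by rewrite !mate_optK /vote mulrBr.
Qed.

Lemma popularP M : popular M <->
  matching M /\ forall h, mating h -> score h (mate M) <= 0.
Proof.
have anti : forall N N' : {set {set V}}, Delta N N' = - Delta N' N by move=> *; rewrite /Delta opprB.
split=> -[mM H]; split=> //.
  move=> h hm; have := H _ (mate_set_matching hm).
  rewrite anti DeltaE oppr_ge0; congr (_ <= _).
  apply: eq_bigr => v _; congr (_ * _); congr (vote _ _ _).
  by rewrite mate_optK partner_mate_set.
by move=> M' mM'; rewrite anti DeltaE oppr_ge0; apply: H; apply: mate_mating.
Qed.

Lemma score_refl h : score h h = 0.
Proof. by rewrite /score big1 // => v _; rewrite /vote subrr mulr0. Qed.

Lemma vote_NS v x : vote v None (Some x) = -1.
Proof. by rewrite /vote sub0r. Qed.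
Lemma vote_SN v x : vote v (Some x) None = 1.
Proof. by rewrite /vote subr0. Qed.
Lemma vote_SS v x y : adj v x -> adj v y ->
  vote v (Some x) (Some y) =
  if x == y then 0 else if (rank v x < rank v y)%N then 1 else -1.
Proof.
move=> hx hy; rewrite /vote /= !pref_rank //.
have [->|ne] := eqVneq; first by rewrite subrr.
have [lt|gt|e] := ltngtP; rewrite ?subr0 ?sub0r //.
by case/eqP: ne; apply: rank_inj e.
Qed.
Lemma vote_bounds v p q : -1 <= vote v p q <= 1.
Proof. by rewrite /vote; case: prefers; case: prefers => /=; lra. Qed.

(* Weak linear programming duality; y is a dual solution of value 0. *)
Lemma dual_popular h (y : V -> rat) : mating h ->
  (forall v, y v + y (h v) = 0) ->
  (forall v, weight v * vote v None (mate_opt h v) <= y v) ->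
  (forall a b, a \in sideA G -> adj a b ->
     weight a * vote a (Some b) (mate_opt h a) +
     weight b * vote b (Some a) (mate_opt h b) <= y a + y b) ->
  popular (mate_set h).
Proof.
move=> hm y0 yN yE; have [hi ha] := hm; apply/popularP; split; first exact: mate_set_matching.
move=> g gm; have [gi ga] := gm.
have -> : score g (mate (mate_set h)) = score g h.
  by apply: eq_bigr => v _; rewrite mate_optK partner_mate_set.
pose t v := y v - weight v * vote v (mate_opt g v) (mate_opt h v).
(* Reindexing by an involution pairs each vertex with its image: with [h] the prices cancel, with
   [g] both ends of a challenging edge come together, which is what the edge inequality bounds. *)
have double : forall (f : V -> rat) k, involutive k -> \sum_v f v *+ 2 = \sum_v (f v + f (k v)).
  move=> f k ki; rewrite !big_split /=; congr (_ + _).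
  by rewrite (reindex_inj (inv_inj ki)).
have sy : \sum_v y v = 0.
  have /eqP : \sum_v y v *+ 2 = 0 by rewrite (double _ _ hi) big1.
  by rewrite sumrMnl mulrn_eq0 => /eqP.
have t2 : 0 <= \sum_v t v *+ 2.
  rewrite (double _ _ gi); apply: sumr_ge0 => v _; rewrite /t.
  have [e|ne] := eqVneq (g v) v.
    have gN : mate_opt g v = None by rewrite /mate_opt e eqxx.
    by have := yN v; rewrite e gN; lra.
  have av := ga v ne.
  have ne' : g (g v) != g v by rewrite gi eq_sym.
  rewrite /mate_opt (negbTE ne) (negbTE ne') gi -/(mate_opt h v) -/(mate_opt h (g v)).
  have [vA|vB] := boolP (v \in sideA G); first by have := yE _ _ vA av; lra.
  have := yE (g v) v; rewrite (adj_side av) vB adj_sym => /(_ isT av); lra.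
rewrite sumrMnl pmulrn_lge0 // /t sumrB sy in t2.
by rewrite /score; lra.
Qed.

End Mates.

Local Open Scope nat_scope.

(** * Solutions: positions and flags *)

Section Posts.
Variable G : instance.
Local Notation V := 'I_(nvert G).
Local Notation A := (sideA G).
Implicit Types a b p q : V.

(* For c > 3, a popular matching gives a vertex of A nothing but its top choice
   or its second choice: the best neighbour that is nobody's top choice. *)
Definition top a b := ohead (pref_list a) == Some b.
Definition fpost b := [exists a, (a \in A) && top a b].
Definition second a := ohead [seq b <- pref_list a | ~~ fpost b].
Definition sec a p := second a == Some p.
(** If every neighbour is somebody's top choice, [find] returns the length and the prefix is the
    whole list: all neighbours are then better than the only alternative, staying single. *)
Definition better a := take (find (fun b => ~~ fpost b) (pref_list a)) (pref_list a).
Definition valid q a := (a \in A) && (top a q || sec a q).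
Definition nvalid q := count (valid q) (pref_list q).
(** Meaningful for any neighbour [a], valid or not, so that a holder can be compared with every
    neighbour of [q]. Counting valid vertices only keeps all ranges together linear in the number of
    vertices. *)
Definition vrank q a := count (valid q) (take (rank q a) (pref_list q)).

Lemma topP a b : top a b -> adj a b /\ rank a b = 0.
Proof.
rewrite /top -mem_pref_list /rank; case: (pref_list a) => //= x s.
by case/eqP=> ->; rewrite inE eqxx.
Qed.

Lemma top_uniq a b b' : top a b -> top a b' -> b = b'.
Proof. by rewrite /top => /eqP -> /eqP[]. Qed.

Lemma sec_uniq a b b' : sec a b -> sec a b' -> b = b'.
Proof. by rewrite /sec => /eqP -> /eqP[]. Qed.

Lemma top_exists a x : adj a x -> exists b, top a b.
Proof.
by rewrite -mem_pref_list /top; case: (pref_list a) => //= y s _; exists y.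
Qed.

Lemma top_fpost a b : a \in A -> top a b -> fpost b.
Proof. by move=> aA h; apply/existsP; exists a; rewrite aA. Qed.

Lemma secP a p : sec a p -> adj a p /\ ~~ fpost p.
Proof.
rewrite /sec /second => /eqP e.
have: p \in [seq b <- pref_list a | ~~ fpost b].
  by case: [seq b <- _ | _] e => //= y s [->]; rewrite inE eqxx.
by rewrite mem_filter mem_pref_list => /andP[].
Qed.

Lemma sec_none a p : second a = None -> adj a p -> fpost p.
Proof.
move=> e hp; apply: contraT => np.
have: p \in [seq b <- pref_list a | ~~ fpost b] by rewrite mem_filter np mem_pref_list.
by move: e; rewrite /second; case: [seq b <- _ | _].
Qed.

Lemma mem_better a b :
  (b \in better a) = adj a b && (rank a b < find (fun b => ~~ fpost b) (pref_list a)).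
Proof.
rewrite /better /rank -mem_pref_list; case hb: (b \in pref_list a).
  by rewrite in_take.
by apply/negbTE; apply: contraFN hb; apply: mem_take.
Qed.

Lemma better_adj a b : b \in better a -> adj a b.
Proof. by rewrite mem_better => /andP[]. Qed.

Lemma better_fpost a b : b \in better a -> fpost b.
Proof.
rewrite mem_better => /andP[ab lt]; have := before_find b lt.
by rewrite nth_index ?mem_pref_list // => /negbFE.
Qed.

Lemma find_sec a p : sec a p -> find (fun b => ~~ fpost b) (pref_list a) = rank a p.
Proof.
rewrite /sec /second /rank; elim: (pref_list a) => //= y s IH.
case: ifP => [ny|/negbFE fy]; first by case/eqP=> ->; rewrite eqxx.
move=> h; rewrite IH //; case: eqP => // e.
have: p \in [seq b <- s | ~~ fpost b].
  by case: [seq b <- _ | _] h => //= z t /eqP[->]; rewrite inE eqxx.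
by rewrite mem_filter -e fy.
Qed.

Lemma better_sec a p b : sec a p -> (b \in better a) = adj a b && (rank a b < rank a p).
Proof. by move=> h; rewrite mem_better (find_sec h). Qed.

Lemma better_none a b : second a = None -> (b \in better a) = adj a b.
Proof.
move=> h; rewrite mem_better hasNfind.
  by have [/rank_lt->|] := boolP (adj a b).
apply/hasPn => x; rewrite mem_pref_list => /(sec_none h); by rewrite negbK.
Qed.

Lemma sec_best a p q : sec a p -> adj a q -> ~~ fpost q -> rank a p <= rank a q.
Proof.
move=> h aq nq; rewrite leqNgt; apply/negP => lt.
have: q \in better a by rewrite (better_sec _ h) aq.
by move/better_fpost; rewrite (negbTE nq).
Qed.

Lemma top_better a b : a \in A -> top a b -> b \in better a.
Proof.
move=> aA t; have [ab r0] := topP t; rewrite mem_better ab r0 lt0n.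
have := top_fpost aA t; move: t; rewrite /top.
by case: (pref_list a) => //= x s /eqP[->] ->.
Qed.

Lemma validP q a : valid q a -> [/\ a \in A, adj a q & adj q a].
Proof.
case/andP => aA /orP[/topP[h _]|/secP[h _]]; split=> //; by rewrite adj_sym.
Qed.

Lemma valid_top q a : valid q a -> fpost q -> top a q.
Proof.
by case/andP => aA /orP[//|/secP[_ /negbTE->]].
Qed.

Lemma valid_sec q a : valid q a -> ~~ fpost q -> sec a q.
Proof.
by case/andP => aA /orP[/(top_fpost aA)->|//].
Qed.

Lemma top_valid q a : a \in A -> top a q -> valid q a.
Proof. by rewrite /valid => -> ->. Qed.

Lemma sec_valid q a : a \in A -> sec a q -> valid q a.
Proof. by rewrite /valid => -> ->; rewrite orbT. Qed.

Lemma vrank_le q a a' : rank q a <= rank q a' -> vrank q a <= vrank q a'.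
Proof.
move=> le; rewrite /vrank -(subnKC le) takeD count_cat leq_addr //.
Qed.

Lemma vrank_lt q a a' : valid q a -> rank q a < rank q a' -> vrank q a < vrank q a'.
Proof.
move=> va lt; have [_ _ qa] := validP va.
apply: leq_trans (_ : count (valid q) (take (rank q a).+1 (pref_list q)) <= _).
  rewrite (take_nth a) ?rank_lt // -cats1 count_cat /= /rank nth_index ?mem_pref_list //.
  by rewrite va addn1.
by rewrite /vrank -(subnKC lt) [in leqRHS]takeD count_cat leq_addr.
Qed.

Lemma vrank_le_nvalid q a : vrank q a <= nvalid q.
Proof. by rewrite /nvalid -(cat_take_drop (rank q a) (pref_list q)) count_cat leq_addr. Qed.

Lemma vrank_lt_nvalid q a : valid q a -> vrank q a < nvalid q.
Proof.
move=> va; have [_ _ qa] := validP va.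
rewrite /nvalid /vrank -{2}(cat_take_drop (rank q a) (pref_list q)) count_cat.
rewrite (drop_nth a) ?rank_lt //= /rank nth_index ?mem_pref_list // va.
lia.
Qed.

Lemma vrank_ltW q a a' : valid q a -> vrank q a < vrank q a' -> rank q a < rank q a'.
Proof. by move=> va; rewrite !ltnNge; apply: contra; apply: vrank_le. Qed.

Lemma vrank_inj q a a' : valid q a -> valid q a' -> vrank q a = vrank q a' -> a = a'.
Proof.
move=> va va' e; have [_ _ qa] := validP va; have [_ _ qa'] := validP va'.
apply: (rank_inj qa qa').
have [lt|lt|//] := ltngtP (rank q a) (rank q a').
  by have := vrank_lt va lt; rewrite e ltnn.
by have := vrank_lt va' lt; rewrite e ltnn.
Qed.

Lemma count_filter_index (T : eqType) (P : pred T) (s : seq T) i x0 :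
  i < count P s ->
  let x := nth x0 [seq x <- s | P x] i in
  [/\ P x, x \in s & (uniq s -> count P (take (index x s) s) = i)].
Proof.
elim: s i => //= y s IH i; case: ifP => [py|npy] /=.
  case: i => [|i]; first by rewrite py inE eqxx.
  rewrite ltnS => /IH /= [h1 h2 h3]; rewrite h1 inE h2 orbT; split=> // /andP[ny us].
  by case: eqP => [e|_] /=; [rewrite -e in h2; rewrite h2 in ny | rewrite h3 // py].
rewrite add0n => /IH [/= h1 h2 h3]; rewrite h1 inE h2 orbT; split=> // /andP[ny us].
by case: eqP => [e|_] /=; [rewrite -e in h2; rewrite h2 in ny | rewrite h3 // npy].
Qed.

(** Thus every position inside a pass designates exactly one valid vertex, so a position alone
    determines the holder. *)
Lemma vrank_surj q i : i < nvalid q -> exists2 a, valid q a & vrank q a = i.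
Proof.
case: (pref_list q =P [::]) => [e|]; first by rewrite /nvalid e.
case e: (pref_list q) => [//|x0 s] _ lt.
have [] := count_filter_index x0 lt => h1 h2 h3.
by eexists; [exact: h1 | apply: h3; exact: pref_list_uniq].
Qed.

Lemma top_rank0 a b : top a b -> rank a b = 0. Proof. by case/topP. Qed.

End Posts.

Section Solutions.
Variable G : instance.
Local Notation V := 'I_(nvert G).
Local Notation A := (sideA G).
Implicit Types (a b p q : V) (x : V -> nat) (o : V -> bool).

(** Each condition encodes the dual edge inequality for one price of [a]. Against a post [b] that
    [a] prefers, of price c, c - 1 or c - 2, the two prices must reach c plus the vote of [b]. If
    [a] has price -1, only c with an opposing vote will do (not [bad2]); at price 0 also c - 1 with
    an opposing vote ([mild]); at price 1 either c or an opposing vote (not [bad0]). [badT] serves a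
    vertex at its top post with price - c, against the posts that are nobody's top choice. *)
Definition bad2 x a := has (fun b => vrank b a <= x b) (better a).
Definition bad0 x a := has (fun b => (nvalid b <= x b) && (vrank b a == 0)) (better a).
Definition badT x a :=
  has (fun p => ~~ fpost p && (nvalid p + vrank p a <= x p)) (pref_list a).
Definition mild x o a :=
  all (fun b => (x b < vrank b a) || o b && (0 < vrank b a)) (better a).

(* The position x q runs twice through the valid neighbours of q, from best to
   worst: in the first pass the one reached holds q at the lowest price, in the
   second pass at a higher one.  The flag o q lowers the latter price by one. *)
Definition hi x q a := valid q a && (x q == vrank q a).
Definition lo x q a := valid q a && (x q == nvalid q + vrank q a).
Definition held x q a := hi x q a || lo x q a.

(** A post that is somebody's top choice stops at [nvalid], so its second pass consists of its
    favourite valid vertex alone. For another post, position [nvalid + nvalid] means staying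
    single. *)
Record stable x o : Prop := Stable {
  sol_fpost : forall b, fpost b -> x b <= nvalid b;
  sol_post : forall p, x p <= nvalid p + nvalid p;
  sol_top_hi : forall a b, fpost b -> hi x b a -> ~~ badT x a /\ ~~ o b;
  sol_sec_hi : forall a p, ~~ fpost p -> hi x p a -> ~~ bad2 x a /\ ~~ o p;
  sol_sec_lo : forall a p, ~~ fpost p -> lo x p a -> ~~ o p -> ~~ bad0 x a;
  sol_sec_odd : forall a p, ~~ fpost p -> lo x p a -> o p ->
    mild x o a /\ forall b, top a b -> 0 < vrank b a;
  sol_none_odd : forall a b, a \in A -> adj a b -> second a = None -> o a -> mild x o a;
  sol_top_odd : forall a b p, fpost b -> lo x b a -> o b -> adj a p -> ~~ fpost p ->
    (x p < nvalid p + vrank p a) || o p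
}.

(** A vertex of A may stay single only if all its neighbours are top choices. Its price is then 0,
    and its own flag replaces the negation of [bad2] by the weaker [mild], which in turn forces
    flags on posts. *)
Record solution x o : Prop := Solution {
  sol_stable :> stable x o;
  sol_cover : forall a b, a \in A -> adj a b ->
    (exists q, held x q a) \/ (second a = None /\ (o a || ~~ bad2 x a))
}.

Lemma held_valid x q a : held x q a -> valid q a.
Proof. by case/orP => /andP[]. Qed.

Lemma held_uniq x q a a' : held x q a -> held x q a' -> a = a'.
Proof.
move=> h h'; have va := held_valid h; have va' := held_valid h'.
apply: (vrank_inj va va').
move: (vrank_lt_nvalid va) (vrank_lt_nvalid va').
case/orP: h => /andP[_ /eqP]; case/orP: h' => /andP[_ /eqP]; lia.
Qed.

Lemma lo_top_vrank0 x o a b : stable x o -> fpost b -> lo x b a -> vrank b a = 0.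
Proof.
move=> S fb /andP[va /eqP e]; have := sol_fpost S fb; lia.
Qed.

(* The conditions of a solution are strict, so that a vertex claimed by its top
   post violates the condition for being claimed by its second post. *)
Lemma held_post_uniq x o a q q' : stable x o -> held x q a -> held x q' a -> q = q'.
Proof.
move=> S; wlog: q q' / fpost q && ~~ fpost q'.
  move=> wl h h'; have va := held_valid h; have va' := held_valid h'.
  have [fq|nq] := boolP (fpost q); have [fq'|nq'] := boolP (fpost q').
  - exact: top_uniq (valid_top va fq) (valid_top va' fq').
  - by apply: wl; rewrite ?fq.
  - by apply/esym/wl; rewrite ?fq'.
  - exact: sec_uniq (valid_sec va nq) (valid_sec va' nq').
case/andP => fq nq h h'; exfalso.
have vq := held_valid h; have vq' := held_valid h'; have [aA aq' _] := validP vq'.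
have tq := valid_top vq fq; have bq := top_better aA tq.
case/orP: h' => h'.
  have [/hasPn/(_ _ bq)] := sol_sec_hi S nq h'.
  by case/orP: h => /andP[_ /eqP->]; lia.
case/orP: h => h.
  have [/hasPn/(_ q')] := sol_top_hi S fq h.
  rewrite mem_pref_list aq' nq => /(_ isT).
  by case/andP: h' => _ /eqP->; rewrite leqnn.
have r0 := lo_top_vrank0 S fq h.
have [oq'|oq'] := boolP (o q').
  by have [_ /(_ _ tq)] := sol_sec_odd S nq h' oq'; rewrite r0.
have /hasPn/(_ _ bq) := sol_sec_lo S nq h' oq'.
by case/andP: h => _ /eqP->; rewrite r0 addn0 leqnn.
Qed.

(** Position [nvalid] still lies in the second pass: such a post has a valid neighbour, hence one of
    [vrank] 0. *)
Lemma fpost_held x o b : stable x o -> fpost b -> exists a, held x b a.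
Proof.
move=> S fb; have le := sol_fpost S fb.
have [lt|ge] := ltnP (x b) (nvalid b).
  by have [a va e] := vrank_surj lt; exists a; apply/orP; left; rewrite /hi va e eqxx.
have [a0 /andP[a0A t0]] := existsP fb.
have v0 := vrank_lt_nvalid (top_valid a0A t0).
have [a va e] : exists2 a, valid b a & vrank b a = 0 by apply: vrank_surj; lia.
exists a; apply/orP; right; rewrite /lo va e; lia.
Qed.

(** [sol_top_hi] forbids a flag during the first pass, and the second pass has a single position. *)
Lemma odd_fpost x o b : stable x o -> fpost b -> o b -> x b = nvalid b.
Proof.
move=> S fb ob; have [a] := fpost_held S fb.
case/orP => h; first by have [_] := sol_top_hi S fb h; rewrite ob.
by have := lo_top_vrank0 S fb h; case/andP: h => _ /eqP->; lia.
Qed.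

Lemma hi_exists x q : x q < nvalid q -> exists a, hi x q a.
Proof.
by case/vrank_surj => a va e; exists a; rewrite /hi va e eqxx.
Qed.

Lemma lo_exists x q : nvalid q <= x q < nvalid q + nvalid q -> exists a, lo x q a.
Proof.
case/andP => h1 h2; have [|a va e] := @vrank_surj _ q (x q - nvalid q); first by lia.
by exists a; rewrite /lo va e subnKC // eqxx.
Qed.

End Solutions.

Local Open Scope ring_scope.

(** * A solution gives a popular matching *)

Section SolutionPopular.
Variable G : instance.
Local Notation V := 'I_(nvert G).
Local Notation A := (sideA G).
Implicit Types (a b p q : V).
Variables (x : V -> nat) (o : V -> bool).

Definition sol_mate v : V :=
  if v \in A then odflt v [pick q | held x q v] else odflt v [pick a | held x v a].

Hypothesis S : solution x o.

Lemma held_sides q a : held x q a -> (a \in A) * (q \in A = false) * adj a q * adj q a.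
Proof.
move=> h; have [aA aq qa] := validP (held_valid h).
by rewrite aA aq qa (adj_side aq) aA.
Qed.

Lemma sol_mateA q a : held x q a -> sol_mate a = q.
Proof.
move=> h; rewrite /sol_mate (held_sides h); case: pickP => [q' h'|/(_ q)]; last by rewrite h.
exact: (held_post_uniq S h' h).
Qed.

Lemma sol_mateB q a : held x q a -> sol_mate q = a.
Proof.
move=> h; rewrite /sol_mate (held_sides h); case: pickP => [a' h'|/(_ a)]; last by rewrite h.
exact: (held_uniq h' h).
Qed.

Lemma sol_mate_spec v :
  [\/ exists2 q, held x q v & sol_mate v = q,
      exists2 a, held x v a & sol_mate v = a
    | sol_mate v = v].
Proof.
rewrite /sol_mate; case: ifP => _; case: pickP => [u h|_] /=.
- by constructor 1; exists u.
- by constructor 3.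
- by constructor 2; exists u.
- by constructor 3.
Qed.

Lemma sol_mate_mating : mating sol_mate.
Proof.
split=> v; case: (sol_mate_spec v) => [[q h e]|[a h e]|e]; rewrite ?e ?eqxx //.
- exact: sol_mateB h.
- exact: sol_mateA h.
- by move=> _; rewrite (held_sides h).
- by move=> _; rewrite (held_sides h).
Qed.

Lemma sol_optA q a : held x q a -> mate_opt sol_mate a = Some q.
Proof.
move=> h; rewrite /mate_opt (sol_mateA h) eq_sym.
by rewrite (negbTE (adj_neq (held_sides h).1.2)).
Qed.

Lemma sol_optB q a : held x q a -> mate_opt sol_mate q = Some a.
Proof.
move=> h; rewrite /mate_opt (sol_mateB h).
by rewrite (negbTE (adj_neq (held_sides h).1.2)).
Qed.

Lemma sol_opt_spec v :
  [\/ exists q, held x q v, exists a, held x v a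
    | [/\ forall q, ~~ held x q v, forall a, ~~ held x v a & mate_opt sol_mate v = None]].
Proof.
case: (pickP (fun q => held x q v)) => [q h|n1]; first by constructor 1; exists q.
case: (pickP (fun a => held x v a)) => [a h|n2]; first by constructor 2; exists a.
constructor 3; split=> [q|a|]; rewrite ?n1 ?n2 // /mate_opt.
case: (sol_mate_spec v) => [[q h e]|[a h e]|e]; first by rewrite n1 in h.
  by rewrite n2 in h.
by rewrite e eqxx.
Qed.

Variable c : rat.
Hypothesis c_gt3 : 3 < c.
Hypothesis wA : forall v, v \in A -> weight v = c.
Hypothesis wB : forall v, v \notin A -> weight v = 1.

(* The price of the vertex of A claimed by post q; q receives its opposite. *)
Definition label q a : rat :=
  if fpost q then (if hi x q a then - c else if o q then 1 - c else 2 - c)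
  else (if hi x q a then -1 else if o q then 0 else 1).

Definition price v : rat :=
  if v \in A then oapp (fun q => label q v) 0 [pick q | held x q v]
  else oapp (fun a => - label v a) 0 [pick a | held x v a].

Lemma priceA q a : held x q a -> price a = label q a.
Proof.
move=> h; rewrite /price (held_sides h).1.1.1; case: pickP => [q' h'|/(_ q)]; last by rewrite h.
by rewrite (held_post_uniq S h' h).
Qed.

Lemma priceB q a : held x q a -> price q = - label q a.
Proof.
move=> h; rewrite /price (held_sides h).1.1.2; case: pickP => [a' h'|/(_ a)]; last by rewrite h.
by rewrite (held_uniq h' h).
Qed.

Lemma price0 v : (forall q, ~~ held x q v) -> (forall a, ~~ held x v a) -> price v = 0.
Proof.
move=> n1 n2; rewrite /price; case: ifP => _; case: pickP => // u h.
  by rewrite (negbTE (n1 u)) in h.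
by rewrite (negbTE (n2 u)) in h.
Qed.

Lemma label_bounds q a :
  - c <= label q a <= 1 /\ (fpost q -> label q a <= 2 - c) /\ (~~ fpost q -> -1 <= label q a).
Proof.
rewrite /label; case: (fpost q); case: (hi x q a); case: (o q); split.
all: try (apply/andP; split).
all: try (split; move=> //).
all: move: c_gt3; lra.
Qed.

Lemma price_geB b : b \notin A -> -1 <= price b.
Proof.
move=> bB; case: (sol_opt_spec b) => [[q h]|[a h]|[n1 n2 _]].
- by rewrite (held_sides h) in bB.
- by rewrite (priceB h); have [] := label_bounds b a; lra.
- by rewrite price0.
Qed.

Lemma price_fpost b : fpost b -> c - 2 <= price b.
Proof.
move=> fb; have [a h] := fpost_held S fb.
by rewrite (priceB h); have [_ [/(_ fb)]] := label_bounds b a; lra.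
Qed.

(** This turns positions into votes. In the second alternative the holder belongs to the second
    pass, and the offset [nvalid] cancels on both sides. *)
Lemma held_lt_rank q t a : held x q t -> adj q a ->
  (x q < vrank q a)%N \/ (x q < nvalid q + vrank q a)%N /\ ~~ hi x q t -> (rank q t < rank q a)%N.
Proof.
move=> h qa; have vt := held_valid h; have vle := vrank_le_nvalid q a.
have vlt := vrank_lt_nvalid vt.
case/orP: (h) => /andP[_ /eqP ex] [lt|[lt nh]].
- by apply: (vrank_ltW vt); lia.
- by case/negP: nh; rewrite /hi vt ex eqxx.
- by exfalso; lia.
- by apply: (vrank_ltW vt); lia.
Qed.

Lemma solution_popular : popular (mate_set sol_mate).
Proof.
have gt3 := c_gt3; apply: (@dual_popular _ _ price sol_mate_mating).
- move=> v; case: (sol_opt_spec v) => [[q h]|[a h]|[n1 n2 e]].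
  + by rewrite (sol_mateA h) (priceA h) (priceB h) subrr.
  + by rewrite (sol_mateB h) (priceA h) (priceB h) addNr.
  + by move: e; rewrite /mate_opt; case: eqP => // -> _; rewrite price0 ?addr0.
- move=> v; case: (sol_opt_spec v) => [[q h]|[a h]|[n1 n2 e]].
  + rewrite (sol_optA h) (priceA h) vote_NS wA ?(held_sides h) //.
    by have [/andP[]] := label_bounds q v; lra.
  + rewrite (sol_optB h) (priceB h) vote_NS wB ?(held_sides h) //.
    by have [/andP[]] := label_bounds v a; lra.
  + by rewrite e price0 // /vote subrr mulr0.
move=> a b aA ab; have bB : b \notin A by rewrite (adj_side ab) aA.
have ba : adj b a by rewrite adj_sym.
rewrite wA // wB // mul1r.
set wb := vote b _ _; have wb1 : wb <= 1 by have /andP[] := vote_bounds b (Some a) (mate_opt sol_mate b).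
have wbm t : held x b t -> (rank b t < rank b a)%N -> wb = -1.
  move=> h lt; rewrite /wb (sol_optB h) vote_SS ?(held_sides h) //.
  by case: eqP lt => [->|_ lt]; [rewrite ltnn | rewrite ltnNge (ltnW lt)].
(* The edges along which [a] improves: either [a] is at its second post, or it is single. *)
have prefb : b \in better a ->
  (exists p, [/\ held x p a, ~~ fpost p & (rank a b < rank a p)%N]) \/
  (forall q, ~~ held x q a) -> c + wb <= price a + price b.
  move=> bb case_a; have fb := better_fpost bb.
  have [t h] := fpost_held S fb.
  (* The first pass of [b] has not reached [a], so [b] holds a vertex that it prefers, at the
     extreme price c. *)
  have strong : (x b < vrank b a)%N -> price b = c /\ wb = -1.
    move=> lt; have ht : hi x b t.
      case/orP: h => // /andP[_ /eqP ex]; move: (vrank_le_nvalid b a) lt; rewrite ex; clear; lia.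
    rewrite (priceB h) /label fb ht opprK; split=> //.
    by apply: (wbm t h); apply: held_lt_rank => //; left.
  have milds : mild x o a -> c - 1 <= price b /\ wb = -1.
    move=> /allP/(_ _ bb)/orP[/strong[-> ->]|/andP[ob r0]]; first by split=> //; lra.
    have xb := odd_fpost S fb ob.
    have nht : ~~ hi x b t by apply/negP => /(sol_top_hi S fb) []; rewrite ob.
    rewrite (priceB h) /label fb (negbTE nht) ob; split; first by lra.
    by apply: (wbm t h); apply: held_lt_rank => //; right; split=> //; rewrite xb -[ltnLHS]addn0 ltn_add2l.
  case: case_a => [[p [hp np lt]]|no].
    rewrite (priceA hp) /label (negbTE np).
    have [hip|nhip] := boolP (hi x p a).
      have [/hasPn/(_ _ bb)] := sol_sec_hi S np hip.
      by rewrite -ltnNge => /strong[-> ->] _; lra.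
    have lop : lo x p a by case/orP: hp nhip => // ->.
    have [op|nop] := boolP (o p).
      by have [/milds[? ->]] := sol_sec_odd S np lop op; lra.
    have /hasPn/(_ _ bb) := sol_sec_lo S np lop nop.
    rewrite negb_and -ltnNge => nb.
    have [ht|nht] := boolP (hi x b t).
      by rewrite (priceB h) /label fb ht opprK; lra.
    have lot : lo x b t by case/orP: h nht => // ->.
    have r0 : (0 < vrank b a)%N.
      case/orP: nb; last by rewrite lt0n.
      by case/andP: lot => _ /eqP->; rewrite ltnNge leq_addr.
    have := price_fpost fb; rewrite (wbm t h); first by lra.
    apply: held_lt_rank => //; right; split=> //.
    by apply: leq_ltn_trans (sol_fpost S fb) _; rewrite -[ltnLHS]addn0 ltn_add2l.
  have -> : price a = 0.
    apply: price0 => [q|q]; first exact: no.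
    by apply/negP => /held_sides; rewrite aA => -[[[]]].
  have [[q]|[nos]] := sol_cover S aA ab; first by rewrite (negbTE (no q)).
  case/orP => [oa|/hasPn/(_ _ bb)].
    by have [? ->] := milds (sol_none_odd S aA ab nos oa); lra.
  by rewrite -ltnNge => /strong[-> ->]; lra.
case: (sol_opt_spec a) => [[q h]|[a' h]|[n1 n2 ea]]; first last.
- rewrite ea vote_SN mulr1; apply: prefb; last by right.
  have [[q]|[nos _]] := sol_cover S aA ab; first by rewrite (negbTE (n1 q)).
  by rewrite better_none.
- by have := held_sides h; rewrite aA => -[[[]]].
rewrite (sol_optA h) vote_SS ?(held_sides h) //.
have [eq|ne] := eqVneq b q.
  rewrite mulr0 add0r eq (priceA h) (priceB h) subrr.
  by rewrite /wb eq (sol_optB h) vote_SS ?(held_sides h) // eqxx.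
case: ifP => [lt|/negbT]; rewrite ?mulr1 ?mulrN1.
  have vq := held_valid h.
  have nq : ~~ fpost q.
    apply/negP => fq; by move: lt; rewrite (top_rank0 (valid_top vq fq)).
  apply: prefb; last by left; exists q.
  by rewrite (better_sec _ (valid_sec vq nq)) ab.
(* The edge is now worse for [a], with left side [wb - c]. At a second post the price of [a] is at
   least -1 and c > 3 absorbs the rest; the work is for a vertex at its top post. *)
rewrite -leqNgt => _; rewrite (priceA h).
have pb := price_geB bB; rewrite /label.
have [fq|nq] := boolP (fpost q); last by case: ifP => _; [|case: ifP => _]; lra.
have [hq|nhq] := boolP (hi x q a).
  have [fb|nb] := boolP (fpost b); first by have := price_fpost fb; lra.
  have [/hasPn/(_ b)] := sol_top_hi S fq hq.
  rewrite mem_pref_list ab nb -ltnNge => /(_ isT) lt _.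
  (* A single [b] would have price 0 and vote for [a], which is too cheap; the bound on its position
     excludes this. *)
  have [t ht] : exists t, held x b t.
    have [l1|l1] := ltnP (x b) (nvalid b).
      by have [t vt e] := vrank_surj l1; exists t; rewrite /held /hi vt e eqxx.
    have l2 : (x b - nvalid b < nvalid b)%N by move: (vrank_le_nvalid b a) lt l1; clear; lia.
    have [t vt e] := vrank_surj l2; exists t; rewrite /held /lo vt e /=.
    by rewrite subnKC // eqxx orbT.
  rewrite (priceB ht) /label (negbTE nb).
  have [hit|nhit] := boolP (hi x b t); first by lra.
  rewrite (wbm t ht); first by case: ifP => _; lra.
  by apply: held_lt_rank => //; right.
have lq : lo x q a by case/orP: h nhq => // ->.
(* At price [2 - c] the general bound -1 on the price of [b] suffices. *)
case: ifP => [oq|_]; last by lra.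
have [fb|nb] := boolP (fpost b); first by have := price_fpost fb; lra.
case: (sol_opt_spec b) => [[q' h']|[t ht]|[n1 n2 _]].
- by rewrite (held_sides h') in bB.
- rewrite (priceB ht) /label (negbTE nb).
  have [hit|nhit] := boolP (hi x b t); first by lra.
  case: ifP => [ob|nob]; first by lra.
  have := sol_top_odd S fq lq oq ab nb; rewrite nob orbF => lt.
  rewrite (wbm t ht); first by lra.
  by apply: held_lt_rank => //; right.
- by rewrite price0 //; lra.
Qed.

End SolutionPopular.

(** * A popular matching gives a solution *)

Section PopularSolution.
Variable G : instance.
Local Notation V := 'I_(nvert G).
Local Notation A := (sideA G).
Implicit Types (a b q s t u v x y z : V) (h : V -> V) (Z : seq V).
Variable c : rat.
Hypothesis c_gt3 : 3 < c.
Hypothesis wA : forall v, v \in A -> weight v = c.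
Hypothesis wB : forall v, v \notin A -> weight v = 1.
Variable h0 : V -> V.
Hypothesis h0m : mating h0.
Hypothesis h0pop : forall h, mating h -> score h h0 <= 0.

Let h0K : involutive h0. Proof. by case: h0m. Qed.
Let h0adj v : h0 v != v -> adj v (h0 v). Proof. by case: h0m => _; apply. Qed.

Definition gain h v := weight v * vote v (mate_opt h v) (mate_opt h0 v).

Lemma score_change h h' (D : seq V) : uniq D -> (forall v, v \notin D -> h' v = h v) ->
  score h' h0 = score h h0 + \sum_(v <- D) (gain h' v - gain h v).
Proof.
move=> uD e; apply/eqP; rewrite -subr_eq0 opprD addrA /score -sumrB subr_eq0; apply/eqP.
symmetry; rewrite (big_uniq _ uD) big_mkcond /=; apply: eq_bigr => v _; rewrite -/(gain h v) -/(gain h' v).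
by case: ifP => // /negbT /e ev; rewrite /gain /mate_opt ev subrr.
Qed.

Lemma gain_same h v : h v = h0 v -> gain h v = 0.
Proof. by move=> e; rewrite /gain /mate_opt e /vote subrr mulr0. Qed.

Definition assign h x b v :=
  if v == x then b else if v == b then x
  else if (v == h x) || (v == h b) then v else h v.

Lemma assign_mating h x b : mating h -> adj x b -> mating (assign h x b).
Proof.
move=> [hK ha] xb; have nxb := adj_neq xb; split=> v; rewrite /assign.
  have [->|nx] := eqVneq v x; first by rewrite eq_sym (negbTE nxb) eqxx.
  have [->|nb] := eqVneq v b; first by rewrite eqxx.
  have [e|ny] := eqVneq v (h x); last have [e|nz] /= := eqVneq v (h b).
  - by rewrite /= (negbTE nx) (negbTE nb) e eqxx.
  - by rewrite /= (negbTE nx) (negbTE nb) e eqxx orbT.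
  have n1 : h v != x by apply: contra ny => /eqP<-; rewrite hK.
  have n2 : h v != b by apply: contra nz => /eqP<-; rewrite hK.
  rewrite (negbTE n1) (negbTE n2) hK.
  by rewrite !(inj_eq (inv_inj hK)) (negbTE nx) (negbTE nb).
have [->|nx] := eqVneq v x; first by [].
have [->|nb] := eqVneq v b; first by rewrite adj_sym.
by case: ifP => [_|_]; [rewrite eqxx | apply: ha].
Qed.

Definition release h t v := if (v == t) || (v == h t) then v else h v.

Lemma release_mating h t : mating h -> mating (release h t).
Proof.
move=> [hK ha]; split=> v; rewrite /release.
  have [->|nx] /= := eqVneq v t; first by rewrite eqxx.
  have [->|nb] /= := eqVneq v (h t); first by rewrite eqxx orbT.
  rewrite (inj_eq (inv_inj hK)) (negbTE nx) orbF.
  have n1 : h v != t by apply: contra nb => /eqP<-; rewrite hK.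
  by rewrite (negbTE n1) hK.
by case: ifP => [_|_]; [rewrite eqxx | apply: ha].
Qed.

(* A mating in which x is unmatched and the vertices of A outside Z still have
   their original partners; k bounds its score without the loss of x. *)
Definition walk h Z x (k : rat) :=
  [/\ mating h, h x = x, x \in A & x \in Z] /\
  (forall v, v \in A -> v \notin Z -> h v = h0 v) /\ k <= score h h0 - gain h x.

Lemma gain_alone h x : h x = x -> x \in A -> - c <= gain h x.
Proof.
move=> e xA; rewrite /gain wA //; have /andP[] := vote_bounds x (mate_opt h x) (mate_opt h0 x).
by have := c_gt3; nra.
Qed.

(** Popularity makes the full score nonpositive, and the term left out of it, that of the single
    [x], is at least - c. *)
Lemma walk_end h Z x k : walk h Z x k -> k <= c.
Proof.
case=> -[hm hx xA _] [_ le]; have := gain_alone hx xA; have := h0pop hm; lra.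
Qed.

Lemma walk_start_unmatched s : s \in A -> h0 s = s -> walk h0 [:: s] s 0.
Proof.
move=> sA e; split; first by split=> //; rewrite inE.
by split=> //; rewrite score_refl gain_same // subrr.
Qed.

(** The value -1 is the vote of the abandoned partner; that this partner is now free lets a cycle be
    closed at it in [no_blocking_cycle]. *)
Lemma walk_start_matched s : s \in A -> h0 s != s ->
  walk (release h0 s) [:: s] s (-1) /\ release h0 s (h0 s) = h0 s.
Proof.
move=> sA ne; have ss := h0adj ne.
have es : release h0 s s = s by rewrite /release eqxx.
have eb : release h0 s (h0 s) = h0 s by rewrite /release eqxx orbT.
split=> //; split; first by split; rewrite ?inE //; exact: release_mating.
split=> [v vA|].
  rewrite inE /release => /negbTE-> /=; case: eqP vA => // ->.
  by rewrite (adj_side ss) sA.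
rewrite (@score_change h0 _ [:: s; h0 s]) /=; first last.
- by move=> v; rewrite !inE /release => /negbTE->.
- by rewrite inE eq_sym ne.
rewrite score_refl !big_cons big_nil (gain_same (erefl (h0 s))) (gain_same (erefl (h0 (h0 s)))).
rewrite /gain (wB (_ : h0 s \notin A)) ?(adj_side ss) ?sA // /mate_opt eb !eqxx es h0K eqxx.
rewrite [s == h0 s]eq_sym (negbTE ne) !vote_NS; lra.
Qed.

Lemma walk_start s : s \in A -> exists h k, walk h [:: s] s k /\ -1 <= k.
Proof.
move=> sA; have [e|ne] := eqVneq (h0 s) s.
  by exists h0, 0; split; [exact: walk_start_unmatched | lra].
by have [w _] := walk_start_matched sA ne; exists (release h0 s), (-1).
Qed.

(** [x] takes the original partner of [y], still with [y] because [y] is outside [Z]. The loss of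
    [x] was not part of [k], so its new vote is simply added and nothing has to be undone. *)
Lemma walk_step h Z x k y : walk h Z x k -> y \in A -> y \notin Z -> h0 y != y ->
  adj x (h0 y) ->
  exists h', walk h' (y :: Z) y (k + c * vote x (Some (h0 y)) (mate_opt h0 x)
                 + vote (h0 y) (Some x) (Some y)) /\
    h' x = h0 y /\ (forall v, v \notin A -> v != h0 y -> h' v = h v).
Proof.
case=> -[hm hx xA xZ] [unt le] yA yZ ne xb; have [hK ha] := hm.
have bB : h0 y \notin A by rewrite (adj_side xb) xA.
have hy : h y = h0 y by apply: unt.
have hb : h (h0 y) = y by rewrite -hy hK.
have xy : x != y by apply: contraNneq yZ => <-.
have xnb := adj_neq xb.
set b := h0 y in bB hy hb ne xb xnb *.
have h'x : assign h x b x = b by rewrite /assign eqxx.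
have h'b : assign h x b b = x by rewrite /assign eq_sym (negbTE xnb) eqxx.
have h'y : assign h x b y = y.
  by rewrite /assign eq_sym (negbTE xy) eq_sym (negbTE ne) hb eqxx orbT.
have other v : v != x -> v != y -> v != b -> assign h x b v = h v.
  by move=> /negbTE vx /negbTE vy /negbTE vb; rewrite /assign vx vb hx hb vx vy.
exists (assign h x b); split; last first.
  split=> // v vB vb; apply: other => //; apply: contraNneq vB => -> //.
split; first by split; rewrite ?inE ?eqxx //; exact: assign_mating.
split=> [v vA|].
  rewrite inE negb_or => /andP[vy vZ]; rewrite other ?unt //.
    by apply: contraNneq vZ => ->.
  by apply: contraTneq vA => ->.
have D : uniq [:: x; b; y] by rewrite /= !inE negb_or xnb xy ne.
rewrite (score_change D (h := h)); last first.
  by move=> v; rewrite !inE !negb_or => /and3P[? ? ?]; apply: other.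
rewrite !big_cons big_nil (gain_same hy) (@gain_same h b); last by rewrite hb /b h0K.
have -> : gain (assign h x b) x = c * vote x (Some b) (mate_opt h0 x).
  by rewrite /gain wA // {1}/mate_opt h'x [b == x]eq_sym (negbTE xnb).
have -> : gain (assign h x b) b = vote b (Some x) (Some y).
  rewrite /gain wB // mul1r /mate_opt h'b (negbTE xnb) /b h0K.
  by rewrite eq_sym -/b (negbTE ne).
by move: le; lra.
Qed.

(** A free post closes the walk without a new unmatched vertex, so the whole score is available to
    contradict popularity. The vote of the single [b] is already counted in [k] and is
    subtracted. *)
Lemma walk_take h Z x k b : walk h Z x k -> h b = b -> adj x b ->
  k + c * vote x (Some b) (mate_opt h0 x)
    + (vote b (Some x) (mate_opt h0 b) - vote b None (mate_opt h0 b)) <= 0.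
Proof.
case=> -[hm hx xA xZ] [unt le] hb xb.
have bB : b \notin A by rewrite (adj_side xb) xA.
have xnb := adj_neq xb.
have h'x : assign h x b x = b by rewrite /assign eqxx.
have h'b : assign h x b b = x by rewrite /assign eq_sym (negbTE xnb) eqxx.
have other v : v != x -> v != b -> assign h x b v = h v.
  by move=> /negbTE vx /negbTE vb; rewrite /assign vx vb hx hb vx vb.
have := h0pop (assign_mating hm xb).
have D : uniq [:: x; b] by rewrite /= !inE xnb.
rewrite (score_change D (h := h)); last first.
  by move=> v; rewrite !inE !negb_or => /andP[? ?]; apply: other.
rewrite !big_cons big_nil.
have -> : gain (assign h x b) x = c * vote x (Some b) (mate_opt h0 x).
  by rewrite /gain wA // /mate_opt h'x [b == x]eq_sym (negbTE xnb).
have -> : gain (assign h x b) b = vote b (Some x) (mate_opt h0 b).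
  by rewrite /gain wB // mul1r {1}/mate_opt h'b (negbTE xnb).
have -> : gain h b = vote b None (mate_opt h0 b).
  by rewrite /gain wB // mul1r {1}/mate_opt hb eqxx.
lra.
Qed.

(** * Envy, and the posts that a popular matching can use *)

Definition envies a b := adj a b && ((h0 a == a) || (rank a b < rank a (h0 a))%N).

Lemma envies_vote a b : envies a b -> vote a (Some b) (mate_opt h0 a) = 1.
Proof.
case/andP => ab; rewrite /mate_opt; case: eqP => [_ _|/eqP ne /= lt]; first exact: vote_SN.
by rewrite vote_SS ?h0adj // lt; case: eqP lt => // ->; rewrite ltnn.
Qed.

Lemma envies_neq a b : envies a b -> h0 a != b.
Proof.
case/andP => ab /orP[/eqP->|lt]; first exact: adj_neq.
by apply/eqP => e; rewrite e ltnn in lt.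
Qed.

Lemma vote_free b p (q : option V) : 0 <= vote b (Some p) q - vote b None q.
Proof.
case: q => [q|]; first by rewrite vote_NS; have /andP[] := vote_bounds b (Some p) (Some q); lra.
by rewrite vote_SN /vote /=; lra.
Qed.

Lemma envied_top a b : a \in A -> envies a b -> h0 b != b /\ top (h0 b) b.
Proof.
move=> aA ab; have [h [k [w k1]]] := walk_start aA; have aab : adj a b by case/andP: ab.
have gt3 := c_gt3.
have bB : b \notin A by rewrite (adj_side aab) aA.
have nb : h0 b != b.
  apply/eqP => e; have hb : h b = b.
    have [[[hK had] ha _ _] [unt _]] := w.
    apply: contraTeq isT => nhb.
    have yA : h b \in A by rewrite (adj_side (had _ nhb)).
    have yz : h b \notin [:: a].
      by rewrite inE; apply/eqP => e'; move: (hK b); rewrite e' ha => eba; rewrite -eba aA in bB.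
    have := unt _ yA yz; rewrite hK => e2; move: (h0K (h b)); rewrite -e2 e => e3.
    by rewrite -e3 eqxx in nhb.
  have := walk_take w hb aab; rewrite (envies_vote ab) {1 2}/mate_opt e eqxx vote_SN.
  by rewrite /vote subrr; lra.
split=> //; apply/negPn/negP => nt.
have ba := h0adj nb; set a1 := h0 b in nt ba *.
have a1A : a1 \in A by rewrite (adj_side ba).
have ha1 : h0 a1 = b by rewrite /a1 h0K.
have aa1 : a1 \notin [:: a].
  by rewrite inE; apply: contraTneq ab => e; apply/negP => /envies_neq; rewrite -e ha1 eqxx.
have a1b : adj a1 b by rewrite adj_sym.
have [b2 t2] := top_exists a1b; have [a1b2 r2] := topP t2.
have nbb2 : b2 != b by apply: contra nt => /eqP<-.
have e2 : envies a1 b2.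
  rewrite /envies a1b2 ha1 r2 lt0n; apply/orP; right; apply: contra nbb2 => /eqP e.
  by apply/eqP; apply: (rank_inj a1b2 a1b); rewrite r2 e.
have := walk_step w a1A aa1; rewrite ha1 eq_sym (adj_neq a1b) => /(_ isT aab) [h1 [w1 [h1a _]]].
rewrite (envies_vote ab) in w1.
have /andP[v1 _] := vote_bounds b (Some a) (Some a1).
(* Freeness is tested after the exchange: [b2] may be the post that [a] abandoned. *)
have [hb2|nhb2] := eqVneq (h1 b2) b2.
  have := walk_take w1 hb2 a1b2; rewrite (envies_vote e2).
  by have := vote_free b2 a1 (mate_opt h0 b2); lra.
have [[h1m h1a1 _ _] [unt _]] := w1; have [h1K h1adj] := h1m.
have b2a2 := h1adj _ nhb2; set a2 := h1 b2 in b2a2 *.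
have b2B : b2 \notin A by rewrite (adj_side a1b2) a1A.
have a2A : a2 \in A by rewrite (adj_side b2a2).
have ha2 : h1 a2 = b2 by rewrite /a2 h1K.
have a2a1 : a2 != a1 by apply: contraNneq b2B => e; rewrite -ha2 e h1a1.
have a2a : a2 != a by apply: contraNneq nbb2 => e; rewrite -ha2 e h1a.
have a2Z : a2 \notin [:: a1; a] by rewrite !inE negb_or a2a1.
have h0a2 : h0 a2 = b2 by rewrite -(unt _ a2A a2Z).
have := walk_step w1 a2A a2Z; rewrite h0a2 (adj_neq b2a2) => /(_ isT a1b2) [h2 [w2 _]].
(* Two gains of c against the unmatched [a2], with at most one unit lost by the partner of [a], by
   [b] and by [b2]: the bound reads [2 * c - 3 <= c], impossible for c > 3. *)
have := walk_end w2; rewrite (envies_vote e2).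
have /andP[v2 _] := vote_bounds b2 (Some a1) (Some a2).
lra.
Qed.

Lemma top_envies a b : top a b -> h0 a != b -> envies a b.
Proof.
move=> ta ne; have [ab r0] := topP ta; rewrite /envies ab r0 lt0n.
have [//|na] := eqVneq (h0 a) a; apply/orP; right.
by apply: contra ne => /eqP e; apply/eqP/(rank_inj (h0adj na) ab); rewrite r0.
Qed.

Lemma fpost_matched b : fpost b -> h0 b != b /\ top (h0 b) b.
Proof.
case/existsP => a /andP[aA ta]; have [ab r0] := topP ta.
have [e|ne] := eqVneq (h0 a) b.
  by rewrite -e h0K e ta; split=> //; exact: adj_neq.
exact: (envied_top aA (top_envies ta ne)).
Qed.

Lemma envied_fpost a b : a \in A -> envies a b -> fpost b.
Proof.
move=> aA ab; have [nb tb] := envied_top aA ab; have aab : adj a b by case/andP: ab.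
by apply: top_fpost tb; rewrite (adj_side (h0adj nb)) (adj_side aab) aA.
Qed.

(** By [envied_fpost], no vertex envies a post that is nobody's top choice. So a vertex matched to
    such a post has the best one, and a matched top-choice post goes to a vertex ranking it
    first. *)
Lemma matched_valid a : a \in A -> h0 a != a -> valid (h0 a) a.
Proof.
move=> aA na; have aq := h0adj na.
have [fq|nq] := boolP (fpost (h0 a)).
  by have [_] := fpost_matched fq; rewrite h0K; apply: top_valid.
case e: (second a) => [p|]; last by rewrite (sec_none e aq) in nq.
have sp : sec a p by rewrite /sec e.
have [<-|ne] := eqVneq p (h0 a); first exact: sec_valid.
have [ap np] := secP sp; case/negP: np; apply: (envied_fpost aA).
rewrite /envies ap ltn_neqAle (sec_best sp aq nq) andbT; apply/orP; right.
by apply: contra ne => /eqP/(rank_inj ap aq)->.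
Qed.

Lemma unmatched_second a : a \in A -> h0 a = a -> second a = None.
Proof.
move=> aA ea; case e: (second a) => [p|//].
have sp : sec a p by rewrite /sec e.
have [ap /negP[]] := secP sp.
by apply: (envied_fpost aA); rewrite /envies ap ea eqxx.
Qed.

(** * Alternating walks and their credits *)

Definition content a := (a \in A) && top a (h0 a).
Definition unhappy a := (a \in A) && ~~ top a (h0 a).
Definition blocks s t := envies s (h0 t) && (rank (h0 t) s < rank (h0 t) t)%N.

Lemma content_neq t : content t -> h0 t != t.
Proof. by case/andP => _ /topP[h _]; rewrite eq_sym; apply: adj_neq. Qed.

(* Arcs of the alternating walks that can be extended to an improvement. *)
Definition arc x y :=
  (unhappy x && content y && envies x (h0 y)) ||
  [&& content x, unhappy y, h0 y != y, adj x (h0 y) & (rank (h0 y) x < rank (h0 y) y)%N].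

Lemma path_side x (p : seq V) : path arc x p -> all (mem A) p.
Proof.
elim: p x => //= y p IH x /andP[xy /IH->]; rewrite andbT.
by case/orP: xy => [/andP[/andP[_ /andP[]]]|/and5P[_ /andP[]]].
Qed.

Lemma content_unhappy x : content x -> unhappy x = false.
Proof. by rewrite /content /unhappy => /andP[-> ->]. Qed.

(** The credit [K] is invariant. From an unhappy to a content vertex the walk gains c and loses at
    most the vote of the post, from 1 to c; from a content to an unhappy one it loses at most c and
    gains that vote, from c to 1. *)
Lemma arc_walk h Z x k y K : walk h Z x k -> arc x y -> y \notin Z ->
  K + (if content x then c else 1) <= k ->
  exists h' k', [/\ walk h' (y :: Z) y k', K + (if content y then c else 1) <= k'
   & forall v, v \notin A -> v != h0 y -> h' v = h v].
Proof.
move=> w; case/orP => [/andP[/andP[ux cy] exy]|/and5P[cx uy ny xb lt]] yZ.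
  have [yA ny] : y \in A /\ h0 y != y by split; [case/andP: cy | exact: content_neq].
  have xb : adj x (h0 y) by case/andP: exy.
  have [h' [w' [_ un]]] := walk_step w yA yZ ny xb.
  rewrite cy; case: ifP => [cx|_]; first by rewrite content_unhappy in ux.
  move=> le; exists h'; eexists; split; [exact: w' | | exact: un].
  rewrite (envies_vote exy).
  by have /andP[] := vote_bounds (h0 y) (Some x) (Some y); lra.
have yA : y \in A by case/andP: uy.
have [h' [w' [_ un]]] := walk_step w yA yZ ny xb.
rewrite cx; case: ifP => [cy|_]; first by rewrite content_unhappy in uy.
move=> le; exists h'; eexists; split; [exact: w' | | exact: un].
have bx : adj (h0 y) x by rewrite adj_sym.
have byy : adj (h0 y) y by rewrite adj_sym h0adj.
rewrite (vote_SS bx byy) lt; case: eqP lt => [->|_ _]; first by rewrite ltnn.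
by have /andP[] := vote_bounds x (Some (h0 y)) (mate_opt h0 x); have := c_gt3; nra.
Qed.

Lemma path_walk h Z x k K (p : seq V) : walk h Z x k -> path arc x p -> uniq (x :: p) ->
  {in p, forall y, y \notin Z} -> K + (if content x then c else 1) <= k ->
  exists h' Z' k', [/\ walk h' Z' (last x p) k',
     K + (if content (last x p) then c else 1) <= k',
     forall v, v \in Z' -> v \in p ++ Z
   & forall v, v \notin A -> {in p, forall y, h0 y != v} -> h' v = h v].
Proof.
elim: p h Z x k => [|y p IH] h Z x k w /=.
  by move=> _ _ _ le; exists h, Z, k; split.
case/andP => xy pp /andP[xp /andP[yp up]] dis le.
have [h1 [k1 [w1 le1 un1]]] := arc_walk w xy (dis y (mem_head _ _)) le.
have [|z zp|h' [Z' [k' [w' le' sub un]]]] := IH _ _ _ _ w1 pp _ _ le1.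
- by rewrite /= yp.
- rewrite inE negb_or dis ?inE ?zp ?orbT // andbT.
  by apply: contraNneq yp => <-.
exists h', Z', k'; split=> // v.
  by move/sub; rewrite -cat_cons !mem_cat !inE => /or3P[] ->; rewrite ?orbT.
move=> vB hv; rewrite un // ?un1 //.
  by rewrite eq_sym hv // inE eqxx.
by move=> z zp; rewrite hv // inE zp orbT.
Qed.

Lemma blocks_content s t : blocks s t -> s \in A -> t \in A -> content t.
Proof.
case/andP => e _ sA tA; have [_] := envied_top sA e.
by rewrite h0K /content tA.
Qed.

Lemma blocks_vote s t b : blocks s t -> h0 t = b -> t \in A -> s \in A ->
  vote b (Some s) (Some t) = 1.
Proof.
case/andP => /andP[ab _] lt <- tA sA; rewrite vote_SS.
- by rewrite lt; case: eqP lt => // ->; rewrite ltnn.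
- by rewrite adj_sym.
rewrite adj_sym h0adj //; apply: contraTneq ab => e.
by apply/negP => /adj_side; rewrite e sA tA.
Qed.

(** Release [t] (value -1), follow the path to [s] (value at least - c), and give [s] the freed
    post: [s] adds c and the vote of the post rises from -1 to 1, a positive total. *)
Lemma no_blocking_cycle s t : unhappy s -> content t -> connect arc t s -> ~~ blocks s t.
Proof.
move=> us ct /connectP[p0 pp0 e0]; case/shortenP: pp0 e0 => p pp up _ e; apply/negP => bl.
have [sA tA] : s \in A /\ t \in A by case/andP: us; case/andP: ct.
have ne := content_neq ct; have tb := h0adj ne.
have [w eb] := walk_start_matched tA ne.
have dis : {in p, forall y, y \notin [:: t]}.
  by move=> y yp; rewrite inE; apply: contraTneq yp => ->; case/andP: up.
have le0 : (-1 - c) + (if content t then c else 1) <= -1 by rewrite ct; lra.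
have [h' [Z' [k' [w' le' sub un]]]] := path_walk w pp up dis le0.
have ncs : content s = false by apply/negP => /content_unhappy; rewrite us.
rewrite -e ncs in le' w'.
have esb : envies s (h0 t) by case/andP: bl.
have asb : adj s (h0 t) by case/andP: esb.
have tB : h0 t \notin A by rewrite (adj_side tb) tA.
have hb : h' (h0 t) = h0 t.
  rewrite un // => y yp; apply/eqP => /(inv_inj h0K) ey.
  by move: up; rewrite /= -ey yp.
have := walk_take w' hb asb; rewrite (envies_vote esb) {1 2}/mate_opt h0K eq_sym (negbTE ne).
rewrite (blocks_vote bl) // vote_NS; have := c_gt3; lra.
Qed.

(** The credit with which walks reach [v]. Releasing [s] costs 1 and the blocking step to [t] earns
    c + 1, which leaves c at the content [t]: credit 0. A walk from an unmatched [s] has value 0 at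
    an unhappy vertex: credit -1, for [weak]. *)
Definition strong v :=
  [exists s, exists t, [&& unhappy s, h0 s != s, content t, blocks s t & connect arc t v]].
Definition weak v := [exists s, [&& unhappy s, h0 s == s & connect arc s v]].

Lemma strong_arc v w : strong v -> arc v w -> strong w.
Proof.
case/existsP => s /existsP[t /and5P[h1 h2 h3 h4 h5]] vw.
apply/existsP; exists s; apply/existsP; exists t; rewrite h1 h2 h3 h4.
exact: connect_trans h5 (connect1 vw).
Qed.

Lemma weak_arc v w : weak v -> arc v w -> weak w.
Proof.
case/existsP => s /and3P[h1 h2 h3] vw.
apply/existsP; exists s; rewrite h1 h2.
exact: connect_trans h3 (connect1 vw).
Qed.

(** The path can be taken simple, and it avoids [s] by [no_blocking_cycle], so the step from [s] to
    [t] can be put in front. The last clause keeps posts that were single in [h0] available at the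
    end. *)
Lemma strong_path v : strong v -> exists s t (p : seq V),
  [/\ unhappy s, content t, blocks s t, v = last t p & path arc t p /\ uniq (t :: p)] /\
  s \notin t :: p /\ exists h Z (k : rat), [/\ walk h Z v k, (if content v then c else 1) <= k,
     forall y, y \in Z -> y \in s :: t :: p
   & forall b, b \notin A -> h0 b = b -> h b = b].
Proof.
case/existsP => s /existsP[t /and5P[us ns ct bl /connectP[p0 pp0 e0]]].
case/shortenP: pp0 e0 => p pp up _ e; exists s, t, p.
have [sA tA] : s \in A /\ t \in A by case/andP: us; case/andP: ct.
have sp : s \notin t :: p.
  by apply/negP => /(path_connect pp)/(no_blocking_cycle us ct); rewrite bl.
split; first by split.
split=> //.
have [w0 _] := walk_start_matched sA ns.
have ts : t \notin [:: s] by move: sp; rewrite !inE negb_or eq_sym => /andP[].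
have nt := content_neq ct; have esb : envies s (h0 t) by case/andP: bl.
have asb : adj s (h0 t) by case/andP: esb.
have [h1 [w1 [_ un1]]] := walk_step w0 tA ts nt asb.
rewrite (envies_vote esb) (blocks_vote bl) // in w1.
have dis : {in p, forall y, y \notin [:: t; s]}.
  move=> y yp; rewrite !inE negb_or; apply/andP; split.
    by apply: contraTneq yp => ->; case/andP: up.
  by apply: contraTneq yp => ->; move: sp; rewrite inE negb_or => /andP[].
have le0 : 0 + (if content t then c else 1) <= -1 + c * 1 + 1 by rewrite ct; lra.
have [h' [Z' [k' [w' le' sub un]]]] := path_walk w1 pp up dis le0.
exists h', Z', k'; rewrite e; split=> //; first by move: le'; rewrite add0r.
  move=> y /sub; rewrite mem_cat !inE.
  by case/orP => [->|/orP[->|->]]; rewrite ?orbT.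
move=> b bB hb; have nb y : y \in A -> h0 y != b.
  by move=> yA; apply: contraTneq yA => ey; move: (h0K y); rewrite ey hb => <-.
have pA : {in p, forall y, y \in A} by apply/allP; exact: path_side pp.
rewrite un // ?un1 // ?[b == _]eq_sym ?nb // => [|y /pA/nb //].
rewrite /release hb; case: eqP => [//|_]; case: eqP => [//|_] //.
Qed.

(** The walk brings c to [t], moving to [b] costs [t] at most c, and the free [b] adds its vote. *)
Lemma strong_no_free t b : strong t -> content t -> adj t b -> h0 b != b.
Proof.
move=> st ct tb; apply/eqP => hb.
have bB : b \notin A by rewrite (adj_side tb); case/andP: ct => ->.
have [s [t0 [p [_ [_ [h [Z [k [w le _ un]]]]]]]]] := strong_path st.
have := walk_take w (un b bB hb) tb; rewrite ct in le.
have /andP[] := vote_bounds t (Some b) (mate_opt h0 t).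
rewrite /mate_opt hb eqxx vote_SN (_ : vote b None None = 0); last by rewrite /vote subrr.
by have := c_gt3; nra.
Qed.

Lemma walk_block h Z s k t : walk h Z s k -> 0 <= k -> blocks s t -> t \notin Z -> content t -> False.
Proof.
move=> w k0 bl tZ ct; have sA : s \in A by case: w => -[].
have tA : t \in A by case/andP: ct.
have esb : envies s (h0 t) by case/andP: bl.
have asb : adj s (h0 t) by case/andP: esb.
have [h' [w' _]] := walk_step w tA tZ (content_neq ct) asb.
by have := walk_end w'; rewrite (envies_vote esb) (blocks_vote bl) //; lra.
Qed.

Lemma unhappy_content x : unhappy x -> content x = false.
Proof. by move=> ux; apply/negP => /content_unhappy; rewrite ux. Qed.

Lemma strong_no_block s t : strong s -> unhappy s -> t \in A -> ~~ blocks s t.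
Proof.
move=> ss us tA; apply/negP => bl; have sA : s \in A by case/andP: us.
have ct := blocks_content bl sA tA.
have [s0 [t0 [p [[us0 ct0 bl0 es [pp up]] [_ [h [Z [k [w le sub _]]]]]]]]] := strong_path ss.
rewrite unhappy_content // in le.
(* A walk cannot enter [t] twice; but if it has visited [t], then [t] reaches [s] and the pair
   closes a blocking cycle. *)
have [tp|tp] := boolP (t \in t0 :: p).
  suff /(no_blocking_cycle us ct) : connect arc t s by rewrite bl.
  rewrite es; move: tp; rewrite inE => /orP[/eqP->|tp]; first by apply/connectP; exists p.
  case/splitPr: tp pp => p1 p2; rewrite cat_path last_cat /= => /and3P[_ _ pp2].
  by apply/connectP; exists p2.
apply: (walk_block w _ bl _ ct); first by lra.
apply/negP => /sub; rewrite inE (negbTE tp) orbF => /eqP e.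
by move: (content_unhappy ct); rewrite e us0.
Qed.

Lemma weak_no_block s t : weak s -> unhappy s -> t \in A -> ~~ blocks s t.
Proof.
move=> ws us tA; apply/negP => bl; have sA : s \in A by case/andP: us.
have ct := blocks_content bl sA tA.
case/existsP: ws => s0 /and3P[us0 /eqP e0 /connectP[p0 pp0 es0]].
case/shortenP: pp0 es0 => p pp up _ es.
have s0A : s0 \in A by case/andP: us0.
have w0 := walk_start_unmatched s0A e0.
have dis : {in p, forall y, y \notin [:: s0]}.
  by move=> y yp; rewrite inE; apply: contraTneq yp => ->; case/andP: up.
have le0 : -1 + (if content s0 then c else 1) <= 0 by rewrite unhappy_content //; lra.
have [h [Z [k [w le sub _]]]] := path_walk w0 pp up dis le0.
rewrite -es unhappy_content // in w le.
have [tp|tp] := boolP (t \in s0 :: p).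
  suff /(no_blocking_cycle us ct) : connect arc t s by rewrite bl.
  rewrite es; move: tp; rewrite inE => /orP[/eqP->|tp]; first by apply/connectP; exists p.
  case/splitPr: tp pp => p1 p2; rewrite cat_path last_cat /= => /and3P[_ _ pp2].
  by apply/connectP; exists p2.
apply: (walk_block w _ bl _ ct); first by lra.
by apply: contra tp => /sub; rewrite mem_cat !inE orbC.
Qed.

Lemma unmatched_weak s : unhappy s -> h0 s = s -> weak s.
Proof. by move=> us e; apply/existsP; exists s; rewrite us e eqxx connect0. Qed.

Lemma unhappy_unmatched s : s \in A -> h0 s = s -> unhappy s.
Proof.
move=> sA e; rewrite /unhappy sA /= e; apply/negP => /topP[h _].
by have := adj_neq h; rewrite eqxx.
Qed.

Lemma arc_down s t : unhappy s -> content t -> envies s (h0 t) -> arc s t.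
Proof. by rewrite /arc => -> -> ->. Qed.

(** An unmatched [s] would be weak, and weak vertices block nobody; so [s] is matched, as [strong]
    requires. *)
Lemma blocks_strong s t : unhappy s -> content t -> blocks s t -> strong t.
Proof.
move=> us ct bl; have sA : s \in A by case/andP: us.
have tA : t \in A by case/andP: ct.
have [e|ne] := eqVneq (h0 s) s.
  by have := weak_no_block (unmatched_weak us e) us tA; rewrite bl.
by apply/existsP; exists s; apply/existsP; exists t; rewrite us ne ct bl connect0.
Qed.

(** * Positions and flags of a popular matching *)

Local Open Scope nat_scope.

(** Otherwise the first valid vertex of the post has it as top choice without getting it, so it
    blocks [t] and makes [t] strong. Hence the second pass of a top-choice post needs one place
    only. *)
Lemma not_strong_first t : content t -> ~~ strong t -> vrank (h0 t) t = 0.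
Proof.
move=> ct nst; have [tA tt] := andP ct; set b := h0 t in tt *.
have vt : valid b t by apply: top_valid.
case: (posnP (vrank b t)) => // lt; case/negP: nst.
have [a va ea] : exists2 a, valid b a & vrank b a = 0.
  by apply: vrank_surj; apply: leq_ltn_trans (vrank_lt_nvalid vt).
have fb := top_fpost tA tt; have ta := valid_top va fb; have [aA ab _] := validP va.
have rlt : rank b a < rank b t by apply: (vrank_ltW va); rewrite ea.
have na : h0 a != b.
  by apply/eqP => e; move: rlt; rewrite (inv_inj h0K (e : h0 a = h0 t)) ltnn.
have ua : unhappy a by rewrite /unhappy aA; apply: contra na => /top_uniq/(_ ta)->.
by apply: (blocks_strong ua ct); rewrite /blocks (top_envies ta na).
Qed.

(* Positions and odd marks of the solution read off a popular matching. *)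
Definition pop_pos q : nat :=
  if h0 q == q then nvalid q + nvalid q
  else if strong (h0 q) then vrank q (h0 q)
  else if fpost q then nvalid q else nvalid q + vrank q (h0 q).

(** Credit -1, the middle price, belongs to vertices that are weak but not strong. Single vertices
    are flagged too: in A they are weak and use [mild], and single posts satisfy [sol_top_odd] by
    their flag. *)
Definition pop_odd v : bool :=
  (h0 v == v) || [&& v \notin A, weak (h0 v) & ~~ strong (h0 v)].

Lemma valid_matched q a : valid q a -> h0 q != q -> valid q (h0 q).
Proof.
move=> /validP[aA aq qa] nq; have qq := h0adj nq.
have hA : h0 q \in A by rewrite (adj_side qq) (adj_side aq) aA.
by have := matched_valid hA; rewrite h0K eq_sym => /(_ nq).
Qed.

Lemma valid_content q a : valid q a -> h0 q = a -> content a = fpost q.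
Proof.
move=> va e; have [aA _ _] := validP va; rewrite /content aA -e h0K /=.
have [fq|nq] := boolP (fpost q); first by rewrite e (valid_top va fq).
by apply: contraNF nq; rewrite e; apply: top_fpost.
Qed.

Lemma valid_unhappy q a : valid q a -> h0 q = a -> unhappy a = ~~ fpost q.
Proof.
move=> va e; have [aA _ _] := validP va; have := valid_content va e.
by rewrite /content /unhappy aA /= => ->.
Qed.

Lemma pop_hi q a : hi pop_pos q a = [&& valid q a, h0 q == a & strong a].
Proof.
rewrite /hi; have [va|//] := boolP (valid q a) => /=; have lt := vrank_lt_nvalid va.
have [_ _ qa] := validP va.
apply/eqP/andP => [|[/eqP e st]]; last first.
  by rewrite /pop_pos e st eq_sym (negbTE (adj_neq qa)).
rewrite /pop_pos; case: eqP => [_|/eqP nq]; first by move: lt; clear; lia.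
case: ifP => st; last by case: ifP => _; move: lt; clear; lia.
move/(vrank_inj (valid_matched va nq) va) => e; by rewrite -e eqxx st.
Qed.

Lemma pop_lo q a : lo pop_pos q a = [&& valid q a, h0 q == a & ~~ strong a].
Proof.
rewrite /lo; have [va|//] := boolP (valid q a) => /=; have lt := vrank_lt_nvalid va.
have [_ _ qa] := validP va.
have low : fpost q -> h0 q != q -> ~~ strong (h0 q) -> vrank q (h0 q) = 0.
  move=> fq nq nst; have ct : content (h0 q).
    by rewrite (valid_content (valid_matched va nq)).
  by have := not_strong_first ct nst; rewrite h0K.
apply/eqP/andP => [|[/eqP e st]]; last first.
  rewrite /pop_pos e (negbTE st) eq_sym (negbTE (adj_neq qa)).
  by case: ifP => // fq; rewrite -e low ?addn0 // e // eq_sym (adj_neq qa).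
rewrite /pop_pos; case: eqP => [_|/eqP nq]; first by move: lt; clear; lia.
have vh := valid_matched va nq; have lth := vrank_lt_nvalid vh.
case: ifP => [_|/negbT st]; first by move: lth; clear; lia.
case: ifP => [fq|_].
  have := low fq nq st => r0 e.
  have -> : a = h0 q by apply: (vrank_inj va vh); move: e r0; clear; lia.
  by rewrite eqxx.
by move=> /addnI/(vrank_inj vh va) <-; rewrite eqxx.
Qed.

Lemma better_envies q a : valid q a -> h0 q = a -> ~~ fpost q ->
  forall b, b \in better a -> envies a b.
Proof.
move=> va e nq b; rewrite (better_sec _ (valid_sec va nq)) /envies => /andP[-> /=].
by rewrite -e h0K => ->; rewrite orbT.
Qed.

Lemma not_blocks_vrank a b : a \in A -> envies a b -> ~~ blocks a (h0 b) ->
  content (h0 b) /\ vrank b (h0 b) < vrank b a.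
Proof.
move=> aA eab nb; have [nbb tb] := envied_top aA eab.
have aab : adj a b by case/andP: eab.
have bA : h0 b \in A by rewrite (adj_side (h0adj nbb)) (adj_side aab) aA.
split; first by rewrite /content bA h0K.
apply: vrank_lt; first exact: top_valid.
move: nb; rewrite /blocks h0K eab /= -leqNgt leq_eqVlt => /orP[/eqP e|//].
have := envies_neq eab; rewrite -(rank_inj (h0adj nbb) _ e) ?h0K ?eqxx //.
by rewrite adj_sym.
Qed.

(** A weak vertex does not block, so each better post prefers its holder. The arc to that holder
    makes it weak as well: it is either strong, which puts the post in its first pass, or
    flagged. *)
Lemma weak_mild a : a \in A -> weak a -> unhappy a ->
  (forall b, b \in better a -> envies a b) -> mild pop_pos pop_odd a.
Proof.
move=> aA wa ua be; apply/allP => b bb; have eab := be _ bb.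
have [nbb tb] := envied_top aA eab.
have aab : adj a b by case/andP: eab.
have bB : b \notin A by rewrite (adj_side aab) aA.
have bA : h0 b \in A by rewrite (adj_side (h0adj nbb)) bB.
have [ct lt] := not_blocks_vrank aA eab (weak_no_block wa ua bA).
have wt : weak (h0 b) by apply: (weak_arc wa); apply: arc_down; rewrite ?h0K.
rewrite /pop_pos /pop_odd (negbTE nbb) bB wt /=.
have [st|nst] := boolP (strong _); first by rewrite lt.
by rewrite (leq_ltn_trans (leq0n _) lt) orbT.
Qed.

Lemma popular_solution : solution pop_pos pop_odd.
Proof.
have fpB b : fpost b -> b \notin A.
  by case/existsP => a /andP[aA /topP[ab _]]; rewrite (adj_side ab) aA.
split; first split.
- move=> b fb; have [nb tb] := fpost_matched fb; rewrite /pop_pos (negbTE nb) fb.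
  by case: ifP => // _; apply: vrank_le_nvalid.
- move=> p; rewrite /pop_pos; have := vrank_le_nvalid p (h0 p).
  by case: ifP => // _ le; case: ifP => _; [|case: ifP => _]; move: le; clear; lia.
- move=> a b fb; rewrite pop_hi => /and3P[va /eqP e st].
  have ct : content a by rewrite (valid_content va e).
  have [aA ab ba] := validP va.
  rewrite /pop_odd e st !andbF orbF eq_sym (adj_neq ba); split=> //.
  apply/hasPn => p; rewrite mem_pref_list => ap; rewrite negb_and negbK -ltnNge.
  have [//|np] := boolP (fpost p); rewrite /=.
  have nhp := strong_no_free st ct ap; have pp := h0adj nhp.
  have pB : p \notin A by rewrite (adj_side ap) aA.
  have sA : h0 p \in A by rewrite (adj_side pp).
  have vp : valid p (h0 p) by have := matched_valid sA; rewrite h0K eq_sym; apply.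
  have us : unhappy (h0 p) by rewrite (valid_unhappy vp).
  have lt := vrank_lt_nvalid vp.
  rewrite /pop_pos (negbTE nhp); case: ifP => [_|nst]; first exact: leq_trans lt (leq_addr _ _).
  rewrite (negbTE np) ltn_add2l; apply: vrank_lt => //.
  have pa : adj p a by rewrite adj_sym.
  (* If [p] preferred [a] to its holder, there would be an arc from the strong [a] to that holder,
     which is not strong. *)
  have [//|lta|e2] := ltngtP (rank p (h0 p)) (rank p a).
    move: nst; rewrite (strong_arc st) //; apply/orP; right.
    by rewrite ct us h0K eq_sym nhp ap lta.
  move: np; rewrite -(valid_content vp erefl).
  by rewrite (rank_inj pp pa e2) ct.
- move=> a p np; rewrite pop_hi => /and3P[va /eqP e st].
  have ua : unhappy a by rewrite (valid_unhappy va e).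
  have [aA ap pa] := validP va.
  rewrite /pop_odd e st !andbF orbF eq_sym (adj_neq pa); split=> //.
  apply/hasPn => b bb; rewrite -ltnNge.
  have eab := better_envies va e np bb; have [nbb tb] := envied_top aA eab.
  have aab : adj a b by case/andP: eab.
  have bA : h0 b \in A by rewrite (adj_side (h0adj nbb)) (adj_side aab) aA.
  have [ct lt] := not_blocks_vrank aA eab (strong_no_block st ua bA).
  have stb : strong (h0 b) by apply: (strong_arc st); apply: arc_down; rewrite ?h0K.
  by rewrite /pop_pos (negbTE nbb) stb.
- move=> a p np; rewrite pop_lo => /and3P[va /eqP e st].
  have ua : unhappy a by rewrite (valid_unhappy va e).
  have [aA ap pa] := validP va; have pB : p \notin A by rewrite (adj_side ap) aA.
  rewrite /pop_odd e pB st andbT eq_sym (negbTE (adj_neq pa)) /= => nw.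
  apply/hasPn => b bb; rewrite negb_and -ltnNge -lt0n.
  have eab := better_envies va e np bb; have [nbb tb] := envied_top aA eab.
  have aab : adj a b by case/andP: eab.
  have bA : h0 b \in A by rewrite (adj_side (h0adj nbb)) (adj_side aab) aA.
  have ctb : content (h0 b) by rewrite /content bA h0K.
  have [bl|nbl] := boolP (blocks a (h0 b)).
    rewrite /pop_pos (negbTE nbb) (blocks_strong ua ctb bl).
    by rewrite vrank_lt_nvalid // top_valid.
  have [_ lt] := not_blocks_vrank aA eab nbl.
  by rewrite (leq_ltn_trans (leq0n _) lt) orbT.
- move=> a p np; rewrite pop_lo => /and3P[va /eqP e st].
  have ua : unhappy a by rewrite (valid_unhappy va e).
  have [aA ap pa] := validP va; have pB : p \notin A by rewrite (adj_side ap) aA.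
  rewrite /pop_odd e pB st andbT eq_sym (negbTE (adj_neq pa)) /= => wa.
  split; first exact: weak_mild (better_envies va e np).
  move=> b tb; have bb := top_better aA tb; have eab := better_envies va e np bb.
  have [nbb _] := envied_top aA eab; have aab : adj a b by case/andP: eab.
  have bA : h0 b \in A by rewrite (adj_side (h0adj nbb)) (adj_side aab) aA.
  have [_ lt] := not_blocks_vrank aA eab (weak_no_block wa ua bA).
  exact: leq_ltn_trans lt.
- move=> a b aA ab na; rewrite /pop_odd aA /= orbF => /eqP e.
  have ua := unhappy_unmatched aA e.
  apply: weak_mild => //; first exact: unmatched_weak.
  by move=> q; rewrite (better_none _ na) /envies => ->; rewrite e eqxx.
- move=> a b p fb; rewrite pop_lo => /and3P[va /eqP e st].
  have ct : content a by rewrite (valid_content va e).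
  have [aA ab ba] := validP va; have bB : b \notin A by rewrite (adj_side ab) aA.
  rewrite {1}/pop_odd e bB st andbT eq_sym (negbTE (adj_neq ba)) /= => wa ap np.
  rewrite /pop_odd /pop_pos; have [//|nhp] := eqVneq (h0 p) p; first by rewrite orbT.
  have pp := h0adj nhp.
  have pB : p \notin A by rewrite (adj_side ap) aA.
  have sA : h0 p \in A by rewrite (adj_side pp).
  have vp : valid p (h0 p) by have := matched_valid sA; rewrite h0K eq_sym; apply.
  have us : unhappy (h0 p) by rewrite (valid_unhappy vp).
  have lt := vrank_lt_nvalid vp.
  rewrite pB (negbTE np); have [sp|nsp] := boolP (strong (h0 p)); first by rewrite (leq_trans lt (leq_addr _ _)).
  rewrite ltn_add2l andbT /=.
  have pa : adj p a by rewrite adj_sym.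
  have [lta|lta|e2] := ltngtP (rank p (h0 p)) (rank p a); first by rewrite vrank_lt.
    rewrite (weak_arc wa) ?orbT //; apply/orP; right.
    by rewrite ct us h0K eq_sym nhp ap lta.
  move: np; rewrite -(valid_content vp erefl).
  by rewrite (rank_inj pp pa e2) ct.
- move=> a b aA ab; have [e|ne] := eqVneq (h0 a) a.
    right; split; first exact: unmatched_second.
    by rewrite /pop_odd e eqxx.
  left; exists (h0 a); rewrite /held pop_hi pop_lo matched_valid // h0K eqxx /=.
  exact: orbN.
Qed.

End PopularSolution.

Local Open Scope nat_scope.

(** * Monotonicity of the local conditions *)

Section Descent.
Variable G : instance.
Local Notation V := 'I_(nvert G).
Local Notation A := (sideA G).
Implicit Types (a b p q v : V) (x : V -> nat) (o : V -> bool).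

Variables (X : V -> nat) (O : V -> bool).
Hypothesis S : solution X O.
Variables (x : V -> nat) (o : V -> bool).
Hypothesis xX : forall v, x v <= X v.
Hypothesis oO : forall v, o v -> O v.

Lemma bad2_mono a : bad2 x a -> bad2 X a.
Proof. by case/hasP => b bb h; apply/hasP; exists b => //; apply: leq_trans (xX b). Qed.

Lemma badT_mono a : badT x a -> badT X a.
Proof.
case/hasP => b bb /andP[nb h]; apply/hasP; exists b => //.
by rewrite nb; apply: leq_trans (xX b).
Qed.

Lemma bad0_mono a : bad0 x a -> bad0 X a.
Proof.
case/hasP => b bb /andP[h nb]; apply/hasP; exists b => //.
by rewrite nb andbT; apply: leq_trans (xX b).
Qed.

(** Coverage leaves [a] no other place: the first pass of its top post would violate [badT], the
    second pass there needs [vrank] 0, and [p] is already beyond its own first pass. *)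
Lemma sol_forced a b p : top a b -> sec a p -> a \in A -> 0 < vrank b a ->
  nvalid p + vrank p a <= X p -> lo X p a.
Proof.
move=> tb sp aA r0 le; have [ab _] := topP tb.
have [ap np] := secP sp.
case: (sol_cover S aA ab) => [[q hq]|[n _]]; last by move: sp; rewrite /sec n.
have vq := held_valid hq; have [fq|nq] := boolP (fpost q).
  have eq : q = b by apply: (top_uniq (valid_top vq fq)).
  case/orP: hq => hq; last by have := lo_top_vrank0 S fq hq; rewrite eq; lia.
  have [/hasPn/(_ p)] := sol_top_hi S fq hq.
  by rewrite mem_pref_list ap np => /(_ isT); rewrite le.
have eq : q = p by apply: (sec_uniq (valid_sec vq nq)).
case/orP: hq; rewrite eq // => /andP[vp /eqP e].
by have := vrank_lt_nvalid vp; lia.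
Qed.

Hypothesis St : stable x o.

(** Since [q] has not reached its place in [X], its position is still inside a pass and holds
    another vertex. It has no flag, because a flag pins the position down in both configurations. *)
Lemma misplaced a q : held X q a -> ~~ held x q a ->
  [/\ ~~ o q, x q <= X q & exists2 a', held x q a' & fpost q -> hi x q a'].
Proof.
move=> h nh; have va := held_valid h.
have ne : x q != X q.
  by apply: contra nh => /eqP e; move: h; rewrite /held /hi /lo e.
have lt : x q < X q by rewrite ltn_neqAle ne xX.
have [aA aq _] := validP va.
have vl := vrank_lt_nvalid va.
have noq : ~~ o q.
  apply/negP => oq; have Oq := oO oq.
  have [fq|nq] := boolP (fpost q).
    by move: ne; rewrite (odd_fpost S fq Oq) (odd_fpost St fq oq) eqxx.
  have loq : lo X q a by case/orP: h => // h; have [_] := sol_sec_hi S nq h; rewrite Oq.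
  have eX : X q = nvalid q + vrank q a by case/andP: loq => _ /eqP.
  have [l1|g1] := ltnP (x q) (nvalid q).
    by have [a' h'] := hi_exists l1; have [_] := sol_sec_hi St nq h'; rewrite oq.
  have [|a' h'] := @lo_exists _ x q; first by rewrite g1; lia.
  have va' : valid q a' by case/andP: h'.
  have [a'A a'q _] := validP va'.
  have [b tb] := top_exists a'q.
  have [_ /(_ _ tb) r0] := sol_sec_odd St nq h' oq.
  (* The holder of a flagged post in its second pass is forced to be there in [X] too, against
     [x q < X q]. *)
  have : lo X q a'.
    apply: (sol_forced tb (valid_sec va' nq)) => //.
    by case/andP: h' => _ /eqP<-; exact: xX.
  by case/andP: h' => _ /eqP e; case/andP => _ /eqP e'; lia.
split=> //; have [fq|nq] := boolP (fpost q).
  have [|a' h'] := @hi_exists _ x q; first by apply: leq_trans lt (sol_fpost S fq).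
  by exists a' => //; rewrite /held h'.
have [l1|g1] := ltnP (x q) (nvalid q).
  by have [a' h'] := hi_exists l1; exists a' => //; rewrite /held h'.
have [|a' h'] := @lo_exists _ x q; last by exists a' => //; rewrite /held h' orbT.
by rewrite g1; have := sol_post S q; lia.
Qed.

(** In the solution [(X, O)] the vertex has the middle price of its class, or it is single with its
    flag raised. *)
Definition odd_placed a :=
  (exists2 q, lo X q a & O q) \/ (second a = None /\ O a).

(** In [X] the middle price of [a'] imposes a condition on [q]. As [q] is in [X] at least where it
    holds [a'] in [x], the part on positions fails and only the flag of [q] can satisfy it; a flag
    puts [a], held by [q] in [X], in the second pass. *)
Lemma odd_placed_back a a' q :
  held X q a -> held x q a' -> a' != a -> (fpost q -> hi x q a') ->
  odd_placed a' -> odd_placed a.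
Proof.
move=> hX hx ne hif od'; have va' := held_valid hx; have [a'A a'q _] := validP va'.
have other q' : lo X q' a' -> q' != q.
  move=> h; apply: contraNneq ne => e; apply/eqP.
  by apply: (@held_uniq _ X q); rewrite // -e /held h orbT.
have [fq|nq] := boolP (fpost q).
  have hiq := hif fq; have tq := valid_top va' fq; have bq := top_better a'A tq.
  have mi : mild X O a'.
    case: od' => [[q' lq' Oq']|[n Oa']]; last exact: (sol_none_odd S a'A a'q).
    have [fq'|nq'] := boolP (fpost q'); last by have [] := sol_sec_odd S nq' lq' Oq'.
    have vq' : valid q' a' by case/andP: lq'.
    by have := other _ lq'; rewrite (top_uniq (valid_top vq' fq') tq) eqxx.
  have /allP/(_ _ bq) := mi.
  rewrite ltnNge; case/andP: hiq => _ /eqP<-; rewrite xX /= => /andP[Oq _].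
  left; exists q => //; case/orP: hX => // h.
  by have [_] := sol_top_hi S fq h; rewrite Oq.
have sq := valid_sec va' nq.
case: od' => [[q' lq' Oq']|[n _]]; last by move: sq; rewrite /sec n.
have vq' : valid q' a' by case/andP: lq'.
have [fq'|nq'] := boolP (fpost q'); last first.
  by have := other _ lq'; rewrite (sec_uniq (valid_sec vq' nq') sq) eqxx.
have r0 := lo_top_vrank0 S fq' lq'.
case/orP: hx => hx.
  have [/hasPn/(_ q')] := sol_sec_hi St nq hx.
  by rewrite r0 leq0n => /(_ (top_better a'A (valid_top vq' fq'))).
have := sol_top_odd S fq' lq' Oq' a'q nq.
rewrite ltnNge; case/andP: hx => _ /eqP<-; rewrite xX /= => Oq.
left; exists q => //; case/orP: hX => // h.
by have [_] := sol_sec_hi S nq h; rewrite Oq.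
Qed.

Definition covered a :=
  (exists q, held x q a) \/ (second a = None /\ (o a || ~~ bad2 x a)).

Variable a0 : V.
Hypothesis a0A : a0 \in A.
Variable w0 : V.
Hypothesis a0w : adj a0 w0.
Hypothesis nc : ~ covered a0.

(* Alternating between the holders in x and the places in X, one never comes
   back: D is the set of visited vertices. *)
Lemma odd_placed_chain n (D : {set V}) a b0 :
  #|~: D| < n -> a \in D -> a \in A -> adj a b0 ->
  (forall q, held X q a -> ~~ held x q a) ->
  (second a = None -> bad2 x a) ->
  (forall d, d \in D -> d != a0 -> exists q e,
     [/\ e \in D, e != a, held x q d & held X q e]) ->
  odd_placed a.
Proof.
elim: n D a b0 => // n IH D a b0 cD aD aA ab mis nob pred.
case: (sol_cover S aA ab) => [[q hq]|[na]]; last first.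
  case/orP => [Oa|nb]; first by right.
  by have := bad2_mono (nob na); rewrite (negbTE nb).
have [noq _ [a' ha' hif]] := misplaced hq (mis q hq).
have ne : a' != a by apply: contraNneq (mis q hq) => <-.
have va' := held_valid ha'; have [a'A a'q _] := validP va'.
apply: (odd_placed_back hq ha' ne hif).
have n0 : a' != a0 by apply: contra_not_neq nc => <-; left; exists q.
have a'D : a' \notin D.
  (* A visited vertex was reached from the vertex that its post in [x] holds in [X]. For [a'] this
     is [a], by uniqueness, and [a] has not been left before. *)
  apply/negP => a'D; have [q' [e [_ ea h1 h2]]] := pred _ a'D n0.
  have eq := held_post_uniq St h1 ha'; rewrite eq in h2.
  by rewrite (held_uniq h2 hq) eqxx in ea.
have aa' : a != a' by rewrite eq_sym.
apply: (IH (a' |: D) a' q) => //.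
- rewrite -ltnS; apply: leq_trans cD; rewrite ltnS; apply: proper_card.
  apply/properP; split; first by apply/subsetP => v; rewrite !inE negb_or => /andP[].
  by exists a'; rewrite !inE ?eqxx.
- by rewrite !inE eqxx.
- move=> q' h'; apply/negP => h2.
  have e := held_post_uniq St h2 ha'; rewrite e in h'.
  by rewrite (held_uniq h' hq) eqxx in ne.
- move=> na; apply/hasP; exists q.
    have fq : fpost q.
      by apply: contraT => nq; have := valid_sec va' nq; rewrite /sec na.
    exact: top_better a'A (valid_top va' fq).
  have fq : fpost q.
    by apply: contraT => nq; have := valid_sec va' nq; rewrite /sec na.
  by case/andP: (hif fq) => _ /eqP->.
move=> d; rewrite !inE => /orP[/eqP->|dD] d0.
  by exists q, a; rewrite !inE aD orbT.
have [q' [e [eD ea h1 h2]]] := pred _ dD d0.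
exists q', e; rewrite !inE eD orbT; split=> //.
by apply: contraNneq a'D => <-.
Qed.

Lemma uncovered_odd : odd_placed a0.
Proof.
have nh q : ~~ held x q a0 by apply/negP => h; apply: nc; left; exists q.
apply: (@odd_placed_chain #|~: [set a0]|.+1 [set a0] a0 w0) => //.
- by rewrite inE.
- by move=> na; apply/negPn/negP => nb; apply: nc; right; rewrite nb orbT.
- by move=> d; rewrite inE => ->.
Qed.

(** The unknown place of [a0] in [X] can be read off the current data: the middle price at the top
    post needs [vrank] 0, whereas at the second post, or for a single vertex, it needs a positive
    one. *)
Lemma uncovered_target b : top a0 b ->
  let z := if vrank b a0 == 0 then b else if second a0 is Some p then p else a0 in
  ~~ o z /\ O z.
Proof.
move=> tb z; have bb := top_better a0A tb.
have nh q : ~~ held x q a0 by apply/negP => h; apply: nc; left; exists q.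
case: uncovered_odd => [[q lq Oq]|[na Oa]].
  have hq : held X q a0 by rewrite /held lq orbT.
  have [nq _ _] := misplaced hq (nh q).
  suff -> : z = q by [].
  have vq := held_valid hq; rewrite /z; have [fq|nfq] := boolP (fpost q).
    have e := top_uniq (valid_top vq fq) tb.
    by rewrite -e (lo_top_vrank0 S fq lq) eqxx.
  have [_ /(_ _ tb)] := sol_sec_odd S nfq lq Oq.
  by have := valid_sec vq nfq; rewrite /sec => /eqP->; case: eqP => // ->.
have /allP/(_ _ bb) := sol_none_odd S a0A a0w na Oa.
move=> mb; have r0 : (vrank b a0 == 0) = false.
  by apply/negbTE/eqP => r0; move: mb; rewrite r0 ltn0 andbF.
rewrite /z r0 na; split=> //; apply/negP => oa; apply: nc; right; by rewrite oa.
Qed.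

End Descent.

(** * The fixpoint iteration *)

Section Algorithm.
Variable G : instance.
Local Notation V := 'I_(nvert G).
Local Notation A := (sideA G).
Implicit Types (a b p q v : V) (x : V -> nat) (o : V -> bool).

Definition updv T (f : {ffun V -> T}) v y : {ffun V -> T} :=
  [ffun u => if u == v then y else f u].

Record cfg := Cfg { pos : {ffun V -> nat}; flagged : {ffun V -> bool}; chg : bool; fail : bool }.

Record scan := Scan { s_seen : bool; s_bad2 : bool; s_bad0 : bool; s_badT : bool;
  s_odd : {ffun V -> bool}; s_chg : bool; s_fail : bool }.

Section Scan.
Variables (x : V -> nat) (m1 m0 : bool) (a : V).

Definition scan_step (s : scan) b : scan :=
  let r := vrank b a in
  let f := fpost b && ~~ s_seen s in
  let g := ~~ fpost b in
  let h := r <= x b in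
  let l := nvalid b + r <= x b in
  let push := (f && m1 && h || g && m0 && l) && ~~ s_odd s b in
  Scan (s_seen s || g) (s_bad2 s || f && h)
    (s_bad0 s || f && (nvalid b <= x b) && (r == 0)) (s_badT s || g && l)
    (updv (s_odd s) b (s_odd s b || push)) (s_chg s || push)
    (s_fail s || f && m1 && h && (r == 0)).

Definition prefix (seen : bool) (l : seq V) :=
  if seen then [::] else take (find (fun b => ~~ fpost b) l) l.

(** The posts that must be flagged once [a] has a middle price: [m1] stands for [a] at its second
    post or single, [m0] for [a] at its top post. *)
Definition pushed (bt l : seq V) v :=
  m1 && (v \in bt) && (vrank v a <= x v) ||
  m0 && (v \in l) && ~~ fpost v && (nvalid v + vrank v a <= x v).

Lemma prefix_cons seen b l :
  prefix seen (b :: l) =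
  if fpost b && ~~ seen then b :: prefix (seen || ~~ fpost b) l
  else prefix (seen || ~~ fpost b) l.
Proof. by rewrite /prefix /=; case: seen; case: (fpost b). Qed.

Lemma prefix_seen seen l b : b \in prefix seen l -> b \in l.
Proof. by rewrite /prefix; case: seen => // /mem_take. Qed.

(** The list has no repetition, so each flag is tested before the scan itself writes it and the
    result can be stated with the initial flags. *)
Lemma scan_foldE l s : uniq l ->
  let s' := foldl scan_step s l in let bt := prefix (s_seen s) l in
  [/\ s_bad2 s' = s_bad2 s || has (fun b => vrank b a <= x b) bt,
      s_bad0 s' = s_bad0 s || has (fun b => (nvalid b <= x b) && (vrank b a == 0)) bt,
      s_badT s' = s_badT s || has (fun p => ~~ fpost p && (nvalid p + vrank p a <= x p)) l
    & s_fail s' = s_fail s || m1 && has (fun b => (vrank b a <= x b) && (vrank b a == 0)) bt]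
  /\ (forall v, s_odd s' v = s_odd s v || pushed bt l v)
  /\ s_chg s' = s_chg s || has (fun v => pushed bt l v && ~~ s_odd s v) l.
Proof.
elim: l s => [|b l IH] s /=.
  rewrite /prefix; case: s_seen => /= _; rewrite ?andbF ?orbF; split=> //; split=> // v.
    by rewrite /pushed !in_nil !andbF orbF.
  by rewrite /pushed !in_nil !andbF orbF.
case/andP => bl ul; have [[-> -> -> ->] [ho ->]] := IH (scan_step s b) ul.
have bp : b \notin prefix (s_seen s || ~~ fpost b) l by apply: contra bl; apply: prefix_seen.
set f := fpost b && ~~ s_seen s.
set P := prefix _ l in ho *.
have Pc : prefix (s_seen s) (b :: l) = if f then b :: P else P by apply: prefix_cons.
have hs (Q : pred V) : has Q (prefix (s_seen s) (b :: l)) = f && Q b || has Q P.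
  by rewrite Pc; case: ifP.
have ms v : (v \in prefix (s_seen s) (b :: l)) = f && (v == b) || (v \in P).
  by rewrite Pc; case: ifP; rewrite ?inE.
rewrite !hs /= -/f.
have pb : pushed (prefix (s_seen s) (b :: l)) (b :: l) b =
    f && m1 && (vrank b a <= x b) || ~~ fpost b && m0 && (nvalid b + vrank b a <= x b).
  rewrite /pushed ms eqxx (negbTE bp) inE eqxx /= andbT orbF.
  by rewrite [m1 && f]andbC andbT [m0 && ~~ _]andbC.
have pv v : v != b -> pushed (prefix (s_seen s) (b :: l)) (b :: l) v = pushed P l v.
  by move=> vb; rewrite /pushed ms inE (negbTE vb) andbF.
split; first split.
- by rewrite orbA.
- by rewrite !orbA !andbA.
- by rewrite orbA.
- by rewrite [f && m1]andbC andb_orr !orbA !andbA.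
split=> [v|].
  rewrite ho /= ffunE -/f; have [->|vb] := eqVneq v b; last by rewrite pv.
  rewrite pb; have -> : pushed P l b = false by rewrite /pushed (negbTE bl) (negbTE bp) !andbF.
  rewrite orbF; by case: (s_odd s b); rewrite /= ?andbT.
rewrite pb /= -/f -orbA; congr (_ || (_ || _)).
apply: eq_in_has => v vl; have vb : v != b by apply: contraNneq bl => <-.
by rewrite pv // ffunE (negbTE vb).
Qed.

End Scan.

Section Body.
Variables (s : cfg) (a : V).

Definition first_post := head a (pref_list a).
Definition hi_first := pos s first_post == vrank first_post a.
Definition lo_first := (pos s first_post == nvalid first_post) && (vrank first_post a == 0).
Definition hi_second := if second a is Some p then pos s p == vrank p a else false.
Definition lo_second :=
  if second a is Some p then pos s p == nvalid p + vrank p a else false.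
Definition mode0 := lo_first && flagged s first_post.
(** With the test on [vrank], [sol_forced] carries this mode over to every larger solution. When the
    test fails, [kill_second] advances the post instead. *)
Definition mode1 := if second a is Some p then [&& lo_second, flagged s p & 0 < vrank first_post a]
  else flagged s a.

Definition scan_list :=
  foldl (scan_step (pos s) mode1 mode0 a)
    (Scan false false false false (flagged s) (chg s) (fail s)) (pref_list a).

(* A kill advances a position which violates a condition of [stable], whatever
   the larger positions and flags are. *)
Definition kill_first := hi_first && (s_badT scan_list || flagged s first_post).
Definition kill_second :=
  if second a is Some p then
    hi_second && (s_bad2 scan_list || flagged s p) ||
    lo_second && (if flagged s p then vrank first_post a == 0 else s_bad0 scan_list)
  else false.

Definition body : cfg :=
  let x1 := updv (pos s) first_post (pos s first_post + kill_first) in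
  Cfg (if second a is Some p then updv x1 p (x1 p + kill_second) else x1)
    (s_odd scan_list) (s_chg scan_list || kill_first || kill_second) (s_fail scan_list).

Definition claimed :=
  [|| hi_first, lo_first, hi_second, lo_second
    | (second a == None) && (flagged s a || ~~ s_bad2 scan_list)].

Definition target :=
  if vrank first_post a == 0 then first_post else if second a is Some p then p else a.

(* If nobody holds a, an alternating chain shows that every solution above the
   current stable configuration flags [target]; a second flag is a failure. *)
Definition body_mark : cfg :=
  let s' := body in
  if chg s' || claimed then s' else
  Cfg (pos s') (updv (flagged s') target true) (~~ flagged s' target) (fail s' || flagged s' target).

End Body.

Definition active a := (a \in A) && (pref_list a != [::]).

Definition pass (f : cfg -> V -> cfg) s (l : seq V) :=
  foldl (fun s a => if active a then f s a else s) s l.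

(** Marking is sound only on a stable configuration. A first pass without change certifies
    stability, and the second pass may then mark until its own first change. *)
Definition round s :=
  pass body_mark (pass body (Cfg (pos s) (flagged s) false (fail s)) (enum V)) (enum V).

Definition start := Cfg [ffun=> 0] [ffun=> false] false false.

Definition cap v := if fpost v then nvalid v else nvalid v + nvalid v.

(** Flags are confined to vertices with a neighbour so that they can be counted by the total degree
    as well as by the number of vertices. *)
Definition bounded s :=
  (forall v, pos s v <= cap v) /\ (forall v, flagged s v -> pref_list v != [::]).

Definition potential s := \sum_(v : V) (pos s v + flagged s v).

Lemma active_first a : active a -> [/\ a \in A, top a (first_post a) & adj a (first_post a)].
Proof.
case/andP => aA ne; have t : top a (first_post a).
  by rewrite /top /first_post; case: (pref_list a) ne.
by split=> //; case/topP: t.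
Qed.

Lemma active_adj a b : a \in A -> adj a b -> active a.
Proof. by move=> aA; rewrite -mem_pref_list /active aA; case: (pref_list a). Qed.

Lemma scanE s a :
  let s' := scan_list s a in let x := pos s in
  [/\ s_bad2 s' = bad2 x a, s_bad0 s' = bad0 x a, s_badT s' = badT x a
    & s_fail s' = fail s || mode1 s a && has (fun b => (vrank b a <= x b) && (vrank b a == 0)) (better a)]
  /\ (forall v, s_odd s' v = flagged s v || pushed x (mode1 s a) (mode0 s a) a (better a) (pref_list a) v)
  /\ s_chg s' = chg s ||
     has (fun v => pushed x (mode1 s a) (mode0 s a) a (better a) (pref_list a) v && ~~ flagged s v) (pref_list a).
Proof. exact: (scan_foldE _ _ _ _ (Scan _ _ _ _ _ _ _) (pref_list_uniq a)). Qed.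

Lemma potential_lt s s' v0 :
  (forall v, pos s v <= pos s' v) -> (forall v, flagged s v -> flagged s' v) ->
  (pos s v0 < pos s' v0) || (~~ flagged s v0 && flagged s' v0) -> potential s < potential s'.
Proof.
move=> hp ho h0; have le v : pos s v + flagged s v <= pos s' v + flagged s' v.
  by apply: leq_add => //; have := ho v; case: (flagged s v) => // ->.
rewrite /potential !(bigD1 (P := xpredT) v0) //= -addSn leq_add //; last by apply: leq_sum.
have := hp v0; case/orP: h0 => [h|/andP[/negbTE-> ->]]; last by rewrite addn0 addn1 ltnS.
by move=> _; have := ho v0; case: (flagged s v0) => [->|_] //; rewrite ?ltn_add2r // addn0 ltn_addr.
Qed.

Lemma potential_le s s' :
  (forall v, pos s v <= pos s' v) -> (forall v, flagged s v -> flagged s' v) ->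
  potential s <= potential s'.
Proof.
move=> hp ho; apply: leq_sum => v _.
by apply: leq_add => //; have := ho v; case: (flagged s v) => // ->.
Qed.

Lemma body_pos s a v : active a -> pos (body s a) v =
  pos s v + ((v == first_post a) && kill_first s a)
          + ((second a == Some v) && kill_second s a).
Proof.
move=> /active_first[aA tf _]; have ff := top_fpost aA tf.
rewrite /body /= /kill_second; case e: (second a) => [p|] /=.
  have sp : sec a p by rewrite /sec e.
  have [_ np] := secP sp.
  have pf : p != first_post a by apply: contraNneq np => ->.
  rewrite !ffunE (negbTE pf); have [->|vp] := eqVneq v p.
    by rewrite (negbTE pf) eqxx addn0.
  rewrite (_ : Some p == Some v = false) ?addn0; last first.
    by apply/eqP => -[epv]; rewrite epv eqxx in vp.
  by case: eqP => [->|_]; rewrite ?addn0.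
by rewrite ffunE addn0; case: eqP => [->|_]; rewrite ?addn0.
Qed.

Lemma body_odd s a v : flagged (body s a) v =
  flagged s v || pushed (pos s) (mode1 s a) (mode0 s a) a (better a) (pref_list a) v.
Proof. by have [_ [h _]] := scanE s a; apply: h. Qed.

Lemma body_chg s a : chg (body s a) =
  [|| chg s, has (fun v => flagged (body s a) v && ~~ flagged s v) (pref_list a),
      kill_first s a | kill_second s a].
Proof.
rewrite /body /=; have [_ [h ->]] := scanE s a; rewrite -!orbA; congr (_ || (_ || _)).
by apply: eq_has => v; rewrite h; case: (flagged s v); rewrite ?andbT ?andbF ?orbF.
Qed.

Lemma body_fail s a : fail (body s a) = fail s ||
  mode1 s a && has (fun b => (vrank b a <= pos s b) && (vrank b a == 0)) (better a).
Proof. by have [[_ _ _ h] _] := scanE s a. Qed.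

Lemma kill_firstE s a : kill_first s a =
  hi_first s a && (badT (pos s) a || flagged s (first_post a)).
Proof. by rewrite /kill_first; have [[_ _ -> _] _] := scanE s a. Qed.

Lemma kill_secondE s a p : second a = Some p -> kill_second s a =
    (pos s p == vrank p a) && (bad2 (pos s) a || flagged s p) ||
    (pos s p == nvalid p + vrank p a) &&
      (if flagged s p then vrank (first_post a) a == 0 else bad0 (pos s) a).
Proof.
by rewrite /kill_second /hi_second /lo_second => ->; have [[-> -> _ _] _] := scanE s a.
Qed.

Lemma body_pos_le s a v : active a -> pos s v <= pos (body s a) v.
Proof. by move=> /body_pos->; rewrite -addnA leq_addr. Qed.

Lemma body_odd_le s a v : flagged s v -> flagged (body s a) v.
Proof. by rewrite body_odd => ->. Qed.

Lemma body_potential s a : active a ->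
  potential s <= potential (body s a) /\ (~~ chg s -> chg (body s a) -> potential s < potential (body s a)).
Proof.
move=> ac; have lp v := body_pos_le s v ac; have lo v := @body_odd_le s a v.
split; first exact: potential_le.
rewrite body_chg => /negbTE-> /= /or3P[/hasP[v _ /andP[h1 h2]]|k|k].
- by apply: (potential_lt (v0 := v)) => //; rewrite h1 h2 orbT.
- by apply: (potential_lt (v0 := first_post a)) => //; rewrite body_pos // eqxx k /= addn1 ltn_addr.
case e: (second a) k => [p|] k; last by rewrite /kill_second e in k.
by apply: (potential_lt (v0 := p)) => //; rewrite body_pos // e eqxx k /= addn1 ltnS leq_addr.
Qed.

Lemma body_bounded s a : active a -> bounded s -> bounded (body s a).
Proof.
move=> ac [bp bo]; have [aA tf af] := active_first ac; split=> v.
  rewrite body_pos //; have bv := bp v.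
  have [ev|nv] /= := eqVneq v (first_post a).
    have fv := top_fpost aA tf; rewrite -ev in fv tf.
    have -> : (second a == Some v) = false.
      by apply/negP => h; have [_] := secP (h : sec a v); rewrite fv.
    rewrite addn0; move: bv; rewrite /cap fv kill_firstE /hi_first -ev.
    case: eqP => [-> _|_]; last by rewrite addn0.
    apply: leq_trans (vrank_lt_nvalid (top_valid aA tf)).
    by rewrite -addn1 leq_add2l leq_b1.
  rewrite addn0; have [sv|_] := boolP (second a == Some v); last by rewrite addn0.
  have [_ /negbTE nf] := secP (sv : sec a v).
  have := vrank_lt_nvalid (sec_valid aA (sv : sec a v)).
  move: bv; rewrite /cap nf (kill_secondE _ (eqP sv)) andTb.
  set k := (X in nat_of_bool X) => bv; have kb := leq_b1 k.
  have [e|n1] := eqVneq (pos s v) (vrank v a); first by lia.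
  have [e|n2] := eqVneq (pos s v) (nvalid v + vrank v a); first by lia.
  by rewrite /k (negbTE n1) (negbTE n2) addn0.
rewrite body_odd => /orP[/bo//|]; rewrite /pushed => h.
suff av : adj v a by rewrite -size_eq0 -lt0n; apply: leq_ltn_trans (rank_lt av).
rewrite adj_sym.
case/orP: h => [/andP[/andP[_ /better_adj]]|/andP[/andP[/andP[_]]]] //.
by rewrite mem_pref_list.
Qed.

End Algorithm.

(** * Fixed points, progress and soundness of the iteration *)

Section Correctness.
Variable G : instance.
Local Notation V := 'I_(nvert G).
Local Notation A := (sideA G).
Implicit Types (a b p q v : V) (s : cfg G).

Record fixed s a : Prop := Fixed {
  fix_hi_first : hi_first s a -> ~~ badT (pos s) a /\ ~~ flagged s (first_post a);
  fix_hi_second : forall p, second a = Some p -> pos s p == vrank p a ->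
    ~~ bad2 (pos s) a /\ ~~ flagged s p;
  fix_lo_second : forall p, second a = Some p -> pos s p == nvalid p + vrank p a ->
    if flagged s p then (0 < vrank (first_post a) a) && mild (pos s) (flagged s) a
    else ~~ bad0 (pos s) a;
  fix_none : second a = None -> flagged s a -> mild (pos s) (flagged s) a;
  fix_lo_first : lo_first s a -> flagged s (first_post a) -> forall p, adj a p -> ~~ fpost p ->
    (pos s p < nvalid p + vrank p a) || flagged s p
}.

(** The absence of pushes means that every flag demanded by a middle price is already raised, and
    the absence of failure supplies the positive ranks that [mild] asks for. *)
Lemma body_fixed s a : active a -> ~~ chg (body s a) -> ~~ fail (body s a) ->
  fixed s a.
Proof.
move=> ac; rewrite body_chg body_fail !negb_or.
case/and4P => _ /hasPn nopush nk1 nk2 /andP[_ nf].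
have push v : v \in pref_list a ->
    pushed (pos s) (mode1 s a) (mode0 s a) a (better a) (pref_list a) v -> flagged s v.
  by move=> vl pv; have := nopush _ vl; rewrite body_odd pv orbT negbK.
have mi : mode1 s a -> mild (pos s) (flagged s) a.
  move=> m1; apply/allP => b bb; rewrite m1 /= in nf.
  have /hasPn/(_ _ bb) := nf; rewrite negb_and -ltnNge => /orP[->//|r0].
  have [//|ge] := ltnP (pos s b) (vrank b a); rewrite /= lt0n r0 andbT.
  apply: push; first by rewrite mem_pref_list better_adj.
  by rewrite /pushed m1 bb ge.
split.
- by move=> h; move: nk1; rewrite kill_firstE h /= negb_or => /andP[].
- by move=> p e h; move: nk2; rewrite (kill_secondE _ e) h !negb_or /= => /andP[/andP[]].
- move=> p e h; move: nk2; rewrite (kill_secondE _ e) h negb_or /= => /andP[_].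
  case: ifP => [op|//] r0; rewrite lt0n r0 /=; apply: mi.
  by rewrite /mode1 /lo_second e h op lt0n r0.
- by move=> e oa; apply: mi; rewrite /mode1 e.
move=> lf of_ p ap np; have [//|ge] := ltnP (pos s p) _; rewrite /=.
apply: push; first by rewrite mem_pref_list.
by rewrite /pushed /mode0 lf of_ mem_pref_list ap np ge orbT.
Qed.

Lemma body_same s a : active a -> ~~ chg (body s a) ->
  pos (body s a) = pos s /\ flagged (body s a) = flagged s.
Proof.
move=> ac; rewrite body_chg !negb_or => /and4P[_ /hasPn nopush nk1 nk2].
split; apply/ffunP => v.
  by rewrite body_pos // (negbTE nk1) (negbTE nk2) !andbF !addn0.
apply/idP/idP; last exact: body_odd_le.
move=> ov; move: (ov); rewrite body_odd => /orP[//|pv].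
have vl : v \in pref_list a.
  case/orP: pv => [/andP[/andP[_ /better_adj]]|/andP[/andP[/andP[_]]]] //.
  by rewrite mem_pref_list.
by have := nopush _ vl; rewrite ov negbK.
Qed.

Lemma fixed_stable s : bounded s -> (forall a, active a -> fixed s a) ->
  stable (pos s) (flagged s).
Proof.
move=> [bp bo] F.
have ac a q : valid q a -> active a by move=> /validP[aA aq _]; apply: (active_adj aA aq).
have ef a b : active a -> top a b -> first_post a = b.
  by move=> /active_first[_ t _]; apply: top_uniq.
have sp a p : valid p a -> ~~ fpost p -> second a = Some p.
  by move=> va np; have := valid_sec va np; rewrite /sec => /eqP.
split.
- by move=> b fb; have := bp b; rewrite /cap fb.
- by move=> p; have := bp p; rewrite /cap; case: ifP => // _ /leq_trans; apply; apply: leq_addr.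
- move=> a b fb /andP[va e]; have ta := valid_top va fb.
  by have := fix_hi_first (F a (ac _ _ va)); rewrite /hi_first (ef a b) ?(ac _ _ va) //; apply.
- move=> a p np /andP[va e].
  exact: (fix_hi_second (F a (ac _ _ va)) (sp _ _ va np) e).
- move=> a p np /andP[va e] op.
  by have := fix_lo_second (F a (ac _ _ va)) (sp _ _ va np) e; rewrite (negbTE op).
- move=> a p np /andP[va e] op.
  have := fix_lo_second (F a (ac _ _ va)) (sp _ _ va np) e; rewrite op => /andP[r0 ->].
  by split=> // b tb; rewrite -(ef a b) ?(ac _ _ va).
- by move=> a b aA ab na; apply: (fix_none (F a _) na); apply: (active_adj aA ab).
move=> a b p fb /andP[va /eqP e] ob ap np; have ta := valid_top va fb.
have aca := ac _ _ va; apply: (fix_lo_first (F a aca)) => //; rewrite ?/lo_first (ef a b) //.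
have := bp b; rewrite /cap fb e; have := vrank_lt_nvalid va; move=> h1 h2; lia.
Qed.

Lemma claimed_covered s a : active a -> claimed s a ->
  (exists q, held (pos s) q a) \/ (second a = None /\ (flagged s a || ~~ bad2 (pos s) a)).
Proof.
move=> ac; have [aA tf _] := active_first ac.
have vf := top_valid aA tf.
rewrite /claimed; have [[-> _ _ _] _] := scanE s a.
case/orP => [h|]; first by left; exists (first_post a); rewrite /held /hi vf /=; apply/orP; left.
case/orP => [/andP[/eqP h1 /eqP h2]|].
  by left; exists (first_post a); rewrite /held /lo vf h1 h2 addn0 eqxx orbT.
rewrite /hi_second /lo_second; case e: (second a) => [p|] /=; last by right.
have vp : valid p a by apply: sec_valid; rewrite // /sec e.
by rewrite orbF => h; left; exists p; rewrite /held /hi /lo vp.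
Qed.

Lemma covered_claimed s a : active a -> bounded s ->
  (exists q, held (pos s) q a) \/ (second a = None /\ (flagged s a || ~~ bad2 (pos s) a)) ->
  claimed s a.
Proof.
move=> ac [bp _]; have [aA tf _] := active_first ac.
rewrite /claimed; have [[-> _ _ _] _] := scanE s a.
case=> [[q h]|[-> ->]]; last by rewrite /= !orbT.
have vq := held_valid h; have lt := vrank_lt_nvalid vq.
have [fq|nq] := boolP (fpost q).
  have e : first_post a = q by apply: top_uniq tf (valid_top vq fq).
  case/orP: h => /andP[_ h]; rewrite /hi_first /lo_first e; first by rewrite h.
  have := bp q; rewrite /cap fq (eqP h) => le.
  have r0 : vrank q a = 0 by lia.
  by rewrite r0 addn0 eqxx orbT.
have := valid_sec vq nq; rewrite /sec /hi_second /lo_second => /eqP->.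
by case/orP: h => /andP[_ ->]; rewrite !orbT.
Qed.

Lemma mark_fixed s a : active a -> ~~ chg (body_mark s a) -> ~~ fail (body_mark s a) ->
  [/\ fixed s a, claimed s a, pos (body_mark s a) = pos s & flagged (body_mark s a) = flagged s].
Proof.
move=> ac; rewrite /body_mark; case: ifP => [|/negbT]; last first.
  (* A mark that changes nothing met a raised flag, which is recorded as a failure. *)
  by move=> _ /negPn of_ /norP[_ /negP[]].
case/orP => [->//|cl] nc nf; have [ep eo] := body_same ac nc.
by split=> //; exact: body_fixed.
Qed.

Lemma mark_chg_le s a : chg s -> chg (body_mark s a).
Proof. move=> h; have h2 : chg (body s a) by rewrite body_chg h.
by rewrite /body_mark h2. Qed.

Lemma mark_fail_le s a : fail s -> fail (body_mark s a).
Proof.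
have e : fail s -> fail (body s a) by rewrite body_fail => ->.
by move=> /e h; rewrite /body_mark; case: ifP => // _; apply/orP; left.
Qed.

Lemma mark_bounded s a : active a -> bounded s -> bounded (body_mark s a).
Proof.
move=> ac bs; have [bp bo] := body_bounded ac bs; rewrite /body_mark; case: ifP => // _.
split=> //= v; rewrite ffunE; case: eqP => [-> _|_ /bo//].
have [aA tf af] := active_first ac; rewrite /target.
have ne (u w : V) : adj u w -> pref_list u != [::].
  by rewrite -mem_pref_list; case: (pref_list u).
case: ifP => _; first by apply: (ne _ a); rewrite adj_sym.
case e: (second a) => [p|]; last exact: ne af.
have sp : sec a p by rewrite /sec e.
by have [ap _] := secP sp; apply: (ne _ a); rewrite adj_sym.
Qed.

Lemma mark_potential s a : active a ->
  potential s <= potential (body_mark s a) /\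
  (~~ chg s -> chg (body_mark s a) -> potential s < potential (body_mark s a)).
Proof.
move=> ac; have [le lt] := body_potential s ac.
rewrite /body_mark; case: ifP => [h|_]; first by split.
set t := target a; set s' := Cfg _ _ _ _.
have h2 : forall v, flagged (body s a) v -> flagged s' v by move=> v; rewrite ffunE; case: eqP.
split; first by apply: leq_trans le _; apply: potential_le.
move=> _ nt; apply: leq_ltn_trans le _; apply: (potential_lt (v0 := t)) => //.
by rewrite (nt : ~~ flagged (body s a) t) ffunE eqxx orbT.
Qed.

Section Pass.
Variable f : cfg G -> V -> cfg G.
Hypothesis f_chg : forall s a, chg s -> chg (f s a).
Hypothesis f_fail : forall s a, fail s -> fail (f s a).
Hypothesis f_bounded : forall s a, active a -> bounded s -> bounded (f s a).
Hypothesis f_potential : forall s a, active a -> potential s <= potential (f s a) /\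
  (~~ chg s -> chg (f s a) -> potential s < potential (f s a)).

Lemma pass_chg s l : chg s -> chg (pass f s l).
Proof. by elim: l s => //= a l IH s h; apply: IH; case: ifP => // _; apply: f_chg. Qed.

Lemma pass_fail s l : fail s -> fail (pass f s l).
Proof. by elim: l s => //= a l IH s h; apply: IH; case: ifP => // _; apply: f_fail. Qed.

Lemma pass_bounded s l : bounded s -> bounded (pass f s l).
Proof. by elim: l s => //= a l IH s h; apply: IH; case: ifP => // /f_bounded; apply. Qed.

Lemma pass_potential s l : potential s <= potential (pass f s l) /\
  (~~ chg s -> chg (pass f s l) -> potential s < potential (pass f s l)).
Proof.
elim: l s => [|a l IH] s /=; first by split=> // /negbTE->.
case: ifP => // ac; have [le lt] := f_potential s ac; have [le' lt'] := IH (f s a).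
split; first exact: leq_trans le'.
move=> ns; have [ca|nca] := boolP (chg (f s a)) => cp.
  by apply: leq_trans le'; apply: lt.
by apply: leq_ltn_trans le _; apply: lt'.
Qed.

(** Neither [chg] nor [fail] is ever lowered inside a pass, so their absence at the end holds at
    every step; the configuration has then never moved and all local properties refer to the same
    one. *)
Lemma pass_fixed (P : cfg G -> V -> Prop) s l :
  (forall s s' a, pos s = pos s' -> flagged s = flagged s' -> P s a -> P s' a) ->
  (forall s a, active a -> ~~ chg (f s a) -> ~~ fail (f s a) ->
     [/\ P s a, pos (f s a) = pos s & flagged (f s a) = flagged s]) ->
  ~~ chg (pass f s l) -> ~~ fail (pass f s l) ->
  [/\ forall a, a \in l -> active a -> P s a, pos (pass f s l) = pos s & flagged (pass f s l) = flagged s].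
Proof.
move=> Pe fP; elim: l s => [|a l IH] s //=; case: ifP => ac nc nf.
  have nc' : ~~ chg (f s a) by apply: contra nc; apply: pass_chg.
  have nf' : ~~ fail (f s a) by apply: contra nf; apply: pass_fail.
  have [Pa ep eo] := fP _ _ ac nc' nf'; have [Pl -> ->] := IH _ nc nf.
  split=> // b; rewrite inE => /orP[/eqP-> //|bl] acb.
  by apply: (Pe (f s a)) => //; apply: Pl.
have [Pl ep eo] := IH _ nc nf; split=> // b; rewrite inE => /orP[/eqP->|]; last exact: Pl.
by rewrite ac.
Qed.

End Pass.

Lemma body_chg_le s a : chg s -> chg (body s a).
Proof. by rewrite body_chg => ->. Qed.
Lemma body_fail_le s a : fail s -> fail (body s a).
Proof. by rewrite body_fail => ->. Qed.

Lemma fixed_eq s s' a : pos s = pos s' -> flagged s = flagged s' -> fixed s a -> fixed s' a.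
Proof.
move=> ep eo [h1 h2 h3 h4 h5]; rewrite ep eo in h2 h3 h4.
by split=> //; move: h1 h5; rewrite /hi_first /lo_first ep eo.
Qed.

Lemma claimed_eq s s' a : pos s = pos s' -> flagged s = flagged s' -> claimed s a -> claimed s' a.
Proof.
move=> ep eo; rewrite /claimed; have [[-> _ _ _] _] := scanE s a.
have [[-> _ _ _] _] := scanE s' a.
by rewrite /hi_first /lo_first /hi_second /lo_second ep eo.
Qed.

Definition reset s := Cfg (pos s) (flagged s) false (fail s).

Lemma round_bounded s : bounded s -> bounded (round s).
Proof.
move=> bs; apply: pass_bounded => [|]; first exact: mark_bounded.
by apply: pass_bounded => //; exact: body_bounded.
Qed.

Lemma round_potential s : potential s <= potential (round s) /\
  (chg (round s) -> potential s < potential (round s)).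
Proof.
rewrite /round; set s1 := pass (@body G) _ _.
have [le1 lt1] := pass_potential (@body_potential G) (reset s) (enum V).
have [le2 lt2] := pass_potential mark_potential s1 (enum V).
have e : potential (reset s) = potential s by [].
rewrite e -/s1 in le1 lt1; split; first exact: leq_trans le2.
move=> c2; have [c1|n1] := boolP (chg s1).
  by apply: leq_trans le2; apply: lt1.
by apply: leq_ltn_trans le1 _; apply: lt2.
Qed.

Lemma round_solution s : bounded s -> ~~ chg (round s) -> ~~ fail (round s) ->
  solution (pos (round s)) (flagged (round s)).
Proof.
move=> bs; have bs' := round_bounded bs; move: bs'.
rewrite /round; set s1 := pass (@body G) _ _ => bs' nc nf.
have [F ep eo] := pass_fixed mark_chg_le mark_fail_le
   (P := fun s a => fixed s a /\ claimed s a)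
   (fun s s' a e1 e2 h => conj (fixed_eq e1 e2 (proj1 h)) (claimed_eq e1 e2 (proj2 h)))
   (fun s a ac nc nf => let: And4 h1 h2 h3 h4 := mark_fixed ac nc nf in And3 (conj h1 h2) h3 h4)
   nc nf.
set s2 := pass _ _ _ in bs' nc nf ep eo *.
have F' a : active a -> fixed s2 a /\ claimed s2 a.
  move=> ac; have [h1 h2] := F a (mem_enum _ _) ac.
  by split; [apply: fixed_eq h1 | apply: claimed_eq h2].
split; first by apply: fixed_stable => // a /F'[].
move=> a b aA ab; have ac := active_adj aA ab.
by apply: claimed_covered => //; have [] := F' a ac.
Qed.

Section Soundness.
Variables (X : V -> nat) (O : V -> bool).
Hypothesis S : solution X O.

(** Stated for an arbitrary solution and containing the absence of failure: once [fail] is set, no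
    solution can exist. *)
Definition below s :=
  [/\ forall v, pos s v <= X v, forall v, flagged s v -> O v & ~~ fail s].

Lemma body_below s a : active a -> below s -> below (body s a).
Proof.
move=> ac [xX oO nf]; have [aA tf af] := active_first ac.
have ff := top_fpost aA tf; have vf := top_valid aA tf.
have mi : mode1 s a -> mild X O a.
  rewrite /mode1 /lo_second; case e: (second a) => [p|] => [/and3P[/eqP lp op r0]|oa].
    have sp : sec a p by rewrite /sec e.
    have [_ np] := secP sp.
    have lX : lo X p a by apply: (sol_forced S tf sp) => //; rewrite -lp.
    by have [] := sol_sec_odd S np lX (oO _ op).
  exact: (sol_none_odd S aA af e (oO _ oa)).
split=> [v|v|].
- rewrite body_pos //; have xv := xX v.
  have [ev|nv] /= := eqVneq v (first_post a).
    have -> : (second a == Some v) = false.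
      by apply/negP => h; have [_] := secP (h : sec a v); rewrite ev ff.
    rewrite addn0 kill_firstE /hi_first -ev; case: eqP => [e|_]; last by rewrite addn0.
    case: (boolP (_ || _)) => h; rewrite ?addn0 // addn1 ltn_neqAle xv andbT.
    (* If the position were final, the violated condition would persist in the solution by
       monotonicity. So there is room for one more step. *)
    apply/eqP => eX; have hX : hi X v a by rewrite /hi -eX e ev vf eqxx.
    have fv : fpost v by rewrite ev.
    have [/negP nT /negP nO] := sol_top_hi S fv hX.
    by case/orP: h => [/(badT_mono xX)|/oO].
  rewrite addn0; have [sv|_] := boolP (second a == Some v); last by rewrite addn0.
  have [_ nv'] := secP (sv : sec a v); have vv := sec_valid aA (sv : sec a v).
  rewrite (kill_secondE _ (eqP sv)) andTb.
  case: (boolP (_ || _)) => h; rewrite ?addn0 // addn1 ltn_neqAle xv andbT.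
  apply/eqP => eX; case/orP: h => /andP[/eqP e h].
    have hX : hi X v a by rewrite /hi -eX e vv eqxx.
    have [/negP n2 /negP nO] := sol_sec_hi S nv' hX.
    by case/orP: h => [/(bad2_mono xX)|/oO].
  have lX : lo X v a by rewrite /lo -eX e vv eqxx.
  (* The solution may flag [v] although the current data do not; [mild] then excludes [bad0] just as
     [sol_sec_lo] does without the flag. *)
  have [Ov|nO] := boolP (O v).
    have [mX /(_ _ tf)] := sol_sec_odd S nv' lX Ov.
    case: ifP h => [_ /eqP->//|_ /(bad0_mono xX)/hasP[b bb /andP[h1 /eqP h2]]] _.
    by have /allP/(_ _ bb) := mX; rewrite h2 ltn0 andbF.
  case: ifP h => [/oO|_ /(bad0_mono xX)]; first by rewrite (negbTE nO).
  by rewrite (negbTE (sol_sec_lo S nv' lX nO)).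
- rewrite body_odd => /orP[/oO//|/orP[/andP[/andP[m1 vb] ge]|]].
    have /allP/(_ _ vb) := mi m1; rewrite ltnNge (leq_trans ge (xX v)) /=.
    by case/andP.
  case/andP => /andP[/andP[/andP[/andP[/eqP lf /eqP r0] of_] vl] nv] ge.
  have Of := oO _ of_; have lX : lo X (first_post a) a.
    by rewrite /lo vf r0 addn0 (odd_fpost S ff Of) eqxx.
  have := sol_top_odd S ff lX Of _ nv; rewrite -mem_pref_list => /(_ vl).
  by rewrite ltnNge (leq_trans ge (xX v)).
rewrite body_fail negb_or nf /=; apply/negP => /andP[/mi mX /hasP[b bb /andP[_ /eqP r0]]].
by have /allP/(_ _ bb) := mX; rewrite r0 ltn0 andbF.
Qed.

Lemma mark_below s a : active a -> bounded s -> below s ->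
  (~~ chg (body s a) -> stable (pos s) (flagged s)) -> below (body_mark s a).
Proof.
move=> ac bs bel st; have [xX oO nf] := body_below ac bel; have [xX0 oO0 _] := bel.
rewrite /body_mark; case: ifP => [_|/negbT]; first by split.
rewrite negb_or => /andP[nc ncl]; have [ep eo] := body_same ac nc.
have [aA tf af] := active_first ac.
have nco : ~ covered (pos s) (flagged s) a.
  by move=> h; case/negP: ncl; apply: covered_claimed.
have [nz Oz] := uncovered_target S xX0 oO0 (st nc) aA af nco tf.
rewrite -/(target a) in nz Oz.
split=> [//|v|]; first by rewrite ffunE; case: eqP => [->|_ /oO].
by apply/norP; split; [exact: nf | rewrite eo].
Qed.

Lemma pass_body_below s l : below s -> below (pass (@body G) s l).
Proof. by elim: l s => //= a l IH s bs; apply: IH; case: ifP => // ac; apply: body_below. Qed.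

Lemma pass_mark_below s l : bounded s -> below s ->
  (~~ chg s -> stable (pos s) (flagged s)) -> below (pass (@body_mark G) s l).
Proof.
elim: l s => //= a l IH s bs bel st; case: ifP => ac; last exact: IH.
have st' : ~~ chg (body s a) -> stable (pos s) (flagged s).
  by move=> nc; apply: st; apply: contra nc; apply: body_chg_le.
have bel' := mark_below ac bs bel st'.
apply: IH => //; first exact: mark_bounded.
move=> nc; have [_ _ nf] := bel'; have [_ _ -> ->] := mark_fixed ac nc nf.
by apply: st; apply: contra nc; apply: mark_chg_le.
Qed.

Lemma round_below s : bounded s -> below s -> below (round s).
Proof.
move=> bs bel; rewrite /round.
have bel1 : below (pass (@body G) (reset s) (enum V)) by apply: pass_body_below.
have bs1 : bounded (pass (@body G) (reset s) (enum V)).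
  by apply: pass_bounded => //; exact: body_bounded.
apply: pass_mark_below => // nc; have [_ _ nf] := bel1.
have [F ep eo] := pass_fixed body_chg_le body_fail_le (P := @fixed) fixed_eq
   (fun s a ac nc nf => let: conj h1 h2 := body_same ac nc in
      And3 (body_fixed ac nc nf) h1 h2) nc nf.
apply: fixed_stable => // a ac; apply: (fixed_eq (s := reset s)) => //.
by apply: F; rewrite ?mem_enum.
Qed.

Lemma start_below : below (start G).
Proof. by split=> //= v; rewrite ffunE. Qed.

End Soundness.

Lemma start_bounded : bounded (start G).
Proof. by split=> v /=; rewrite ffunE. Qed.

End Correctness.

(** * Expressions and timed Hoare triples for the machine *)

Arguments upd f i x j /.

Inductive op := OAdd | OSub | OAnd | OOr | OLe | OEq.

Inductive expr :=
| Var (r : nat)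
| Lit (k : nat)
| Deref (e : expr)
| Bin (o : op) (e1 e2 : expr).

(** Conjunction and disjunction of truth values coded as numbers, not the negated connectives; the
    machine has only sums and truncated differences. *)
Definition nand x y := x + y - 1.
Definition nor x y := 1 - (1 - (x + y)).

Lemma nandE (p q : bool) : nand p q = (p && q). Proof. by case: p; case: q. Qed.
Lemma norE (p q : bool) : nor p q = (p || q). Proof. by case: p; case: q. Qed.

Definition apply_op o x y : nat :=
  match o with
  | OAdd => x + y | OSub => x - y | OAnd => nand x y | OOr => nor x y
  | OLe => x <= y | OEq => x == y
  end.

Fixpoint eval e s : nat :=
  match e with
  | Var r => reg s r
  | Lit k => k
  | Deref e => ram s (eval e s)
  | Bin o e1 e2 => apply_op o (eval e1 s) (eval e2 s)
  end.

(** Truncated subtraction decides comparisons: [x <= y] is [1 - (x - y)], and equality is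
    [1 - ((x - y) + (y - x))]. *)
Definition comp_op o t : cmd :=
  match o with
  | OAdd => Add t t t.+1
  | OSub => Defs.Sub t t t.+1
  | OAnd => Seq (Add t t t.+1) (Seq (Const t.+1 1) (Defs.Sub t t t.+1))
  | OOr => Seq (Add t t t.+1) (Seq (Const t.+1 1) (Seq (Defs.Sub t t.+1 t) (Defs.Sub t t.+1 t)))
  | OLe => Seq (Defs.Sub t t t.+1) (Seq (Const t.+1 1) (Defs.Sub t t.+1 t))
  | OEq => Seq (Defs.Sub t.+2 t t.+1) (Seq (Defs.Sub t.+1 t.+1 t)
             (Seq (Add t t.+2 t.+1) (Seq (Const t.+1 1) (Defs.Sub t t.+1 t))))
  end.

(* The value of e goes to register t; only registers from t on are used. *)
Fixpoint comp e t : cmd :=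
  match e with
  | Var r => Seq (Const t.+1 0) (Defs.Sub t r t.+1)
  | Lit k => Const t k
  | Deref e => Seq (comp e t) (Fetch t t)
  | Bin o e1 e2 => Seq (comp e1 t) (Seq (comp e2 t.+1) (comp_op o t))
  end.

Fixpoint cost e : nat :=
  match e with
  | Var _ => 2
  | Lit _ => 1
  | Deref e => cost e + 1
  | Bin o e1 e2 => cost e1 + (cost e2 +
      match o with OAdd | OSub => 1 | OAnd | OLe => 3 | OOr => 4 | OEq => 5 end)
  end.

Fixpoint uses_below t e : bool :=
  match e with
  | Var r => r < t
  | Lit _ => true
  | Deref e => uses_below t e
  | Bin _ e1 e2 => uses_below t e1 && uses_below t e2
  end.

(** The number of operands bounds the value in units of [D]; a dereference counts once because
    [small] bounds the fetched cell anew. With at most 64 units no addition overflows a word. *)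
Fixpoint weight_of e : nat :=
  match e with Bin _ e1 e2 => weight_of e1 + weight_of e2 | _ => 1 end.

Fixpoint fits e : bool :=
  match e with
  | Deref e => fits e
  | Bin _ e1 e2 => [&& weight_of e1 + weight_of e2 <= 64, fits e1 & fits e2]
  | _ => true
  end.

Section Triples.
Variable W : nat.

(* Registers from NR on serve as scratch space: two states are identified when
   they agree on the other registers and on the memory. *)
Definition NR := 60.
Definition agree s s' := (forall j, j < NR -> reg s j = reg s' j) /\ ram s = ram s'.

Definition Assign r e := Seq (comp e NR) (Seq (Const NR.+1 0) (Defs.Sub r NR NR.+1)).
Definition Write e1 e2 := Seq (comp e1 NR) (Seq (comp e2 NR.+1) (Store NR NR.+1)).
Definition Skip := Const NR 0.

(** The postcondition is about a representative state, free of scratch values, so that successive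
    assignments can be followed by plain register updates. *)
Definition runs p s T (Q : state -> Prop) := forall s1, agree s1 s ->
  exists t s1' s', [/\ exec W p s1 t s1', t <= T, agree s1' s' & Q s'].

Lemma runs_conseq p s T T' (Q Q' : state -> Prop) :
  runs p s T Q -> T <= T' -> (forall s', Q s' -> Q' s') -> runs p s T' Q'.
Proof.
move=> h le qq s1 /h[t [s1' [s' [h1 h2 h3 h4]]]]; exists t, s1', s'; split=> //.
  exact: leq_trans le.
exact: qq.
Qed.

Lemma runs_seq p q s T1 T2 (Q : state -> Prop) :
  runs p s T1 (fun s' => runs q s' T2 Q) -> runs (Seq p q) s (T1 + T2) Q.
Proof.
move=> h s1 /h[t [s1' [s' [h1 h2 h3 h4]]]].
have [t2 [s2' [s2 [g1 g2 g3 g4]]]] := h4 _ h3.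
exists (t + t2), s2', s2; split=> //; first exact: exec_seq h1 g1.
exact: leq_add.
Qed.

Lemma runs_skip s T (Q : state -> Prop) : 0 < T -> Q s -> runs Skip s T Q.
Proof.
move=> T0 q s1 [ar am]; eexists 1, _, s; split; [by constructor | done | split=> //= | done].
by move=> j jn; rewrite ltn_eqF // ar.
Qed.

Lemma runs_if a b p q k s T1 T2 (Q : state -> Prop) : a < NR -> b < NR ->
  runs (if reg s a < reg s b then p else q) s T1 (fun s' => runs k s' T2 Q) ->
  runs (Seq (IfLt a b p q) k) s (T1.+1 + T2) Q.
Proof.
move=> aN bN h; apply: runs_seq => s1 ag; have [ar am] := ag.
have [t [s1' [s' [h1 h2 h3 h4]]]] := h _ ag.
exists t.+1, s1', s'; split=> //.
case: ltnP h1 => lt h1; first by apply: exec_if_true; rewrite ?ar.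
by apply: exec_if_false; rewrite ?ar.
Qed.

Lemma runs_seq_le T1 T2 p q s T (Q : state -> Prop) : T1 + T2 <= T ->
  runs p s T1 (fun s' => runs q s' T2 Q) -> runs (Seq p q) s T Q.
Proof. by move=> le h; apply: runs_conseq (runs_seq h) le _. Qed.

Lemma runs_if_le T1 T2 a b p q k s T (Q : state -> Prop) : T1 + T2 < T -> a < NR -> b < NR ->
  runs (if reg s a < reg s b then p else q) s T1 (fun s' => runs k s' T2 Q) ->
  runs (Seq (IfLt a b p q) k) s T Q.
Proof. by move=> le aN bN h; apply: runs_conseq (runs_if aN bN h) le _. Qed.

Lemma runs_while_step a b p s T1 T2 (Q : state -> Prop) : a < NR -> b < NR ->
  reg s a < reg s b -> runs p s T1 (fun s' => runs (WhileLt a b p) s' T2 Q) ->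
  runs (WhileLt a b p) s (T1 + T2).+1 Q.
Proof.
move=> aN bN lt h s1 ag; have [ar am] := ag.
have [t [s1' [s' [h1 h2 h3 h4]]]] := h _ ag.
have [t2 [s2' [s2 [g1 g2 g3 g4]]]] := h4 _ h3.
exists (t + t2).+1, s2', s2; split=> //; last by rewrite ltnS leq_add.
by apply: exec_while_true h1 g1; rewrite !ar.
Qed.

Lemma runs_while_end a b p s T (Q : state -> Prop) : a < NR -> b < NR ->
  reg s b <= reg s a -> 0 < T -> Q s -> runs (WhileLt a b p) s T Q.
Proof.
move=> aN bN le T0 q s1 ag; have [ar am] := ag.
by exists 1, s1, s; split=> //; apply: exec_while_false; rewrite !ar.
Qed.

Lemma runs_for (I : nat -> state -> Prop) (C : nat -> nat) a b p n s : a < NR -> b < NR ->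
  (forall i s, i <= n -> I i s -> reg s a = i /\ reg s b = n) ->
  (forall i s, i < n -> I i s -> runs p s (C i) (I i.+1)) ->
  I 0 s -> runs (WhileLt a b p) s (\sum_(0 <= i < n) (C i).+1).+1 (I n).
Proof.
move=> aN bN Ir Ip; suff H k i s' : i + k = n -> I i s' ->
    runs (WhileLt a b p) s' (\sum_(i <= j < n) (C j).+1).+1 (I n).
  by move=> I0; apply: (H n).
elim: k i s' => [|k IH] i s' e Ii.
  have ei : i = n by rewrite addn0 in e.
  rewrite ei in Ii *; have [ra rb] := Ir n s' (leqnn n) Ii.
  by apply: runs_while_end; rewrite ?ra ?rb.
have lt : i < n by lia.
have [ra rb] := Ir i s' (ltnW lt) Ii.
rewrite big_ltn // addSn -addnS; apply: runs_while_step; rewrite ?ra ?rb //.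
apply: runs_conseq (Ip _ _ lt Ii) (leqnn _) _ => s2 I2.
by apply: IH => //; lia.
Qed.

Lemma runs_loop (I : nat -> state -> Prop) (C : nat -> nat) n a b p s T (Q : state -> Prop) :
  a < NR -> b < NR ->
  (forall i s, i <= n -> I i s -> reg s a = i /\ reg s b = n) ->
  I 0 s -> (\sum_(0 <= i < n) (C i).+1).+1 <= T -> (forall s', I n s' -> Q s') ->
  (forall i s, i < n -> I i s -> runs p s (C i) (I i.+1)) ->
  runs (WhileLt a b p) s T Q.
Proof.
move=> aN bN Ir I0 leT IQ Ip.
exact: runs_conseq (runs_for aN bN Ir Ip I0) leT IQ.
Qed.

(** The measure need only grow when another iteration follows, as the last round changes nothing;
    this gives at most [M.+1] iterations. *)
Lemma runs_while (I : state -> Prop) (mu : state -> nat) C a b p s M : a < NR -> b < NR ->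
  (forall s, I s -> mu s <= M) ->
  (forall s, I s -> reg s a < reg s b ->
     runs p s C (fun s' => I s' /\ (reg s' a < reg s' b -> mu s < mu s'))) ->
  I s -> runs (WhileLt a b p) s (M.+1 * C.+1).+1 (fun s' => I s' /\ reg s' b <= reg s' a).
Proof.
move=> aN bN Im Ip.
suff H k s' : I s' -> (reg s' a < reg s' b -> M < mu s' + k) ->
    runs (WhileLt a b p) s' (k * C.+1).+1 (fun s' => I s' /\ reg s' b <= reg s' a).
  by move=> I0; apply: H => // _; rewrite addnS ltnS leq_addl.
elim: k s' => [|k IH] s' Is le; have [lt|ge] := ltnP (reg s' a) (reg s' b).
- by have := le lt; rewrite addn0 ltnNge Im.
- exact: runs_while_end.
- rewrite mulSn addSn -addnS; apply: runs_while_step => //.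
  apply: runs_conseq (Ip _ Is lt) (leqnn _) _ => s2 [I2 h2].
  by apply: IH => // lt2; have := le lt; have := h2 lt2; lia.
- exact: runs_while_end.
Qed.

End Triples.

Section Machine.
Variables W D : nat.
Hypothesis DW : 64 * D <= W.
Hypothesis D0 : 0 < D.
Local Notation runs := (runs W).

Fixpoint small e s : Prop :=
  match e with
  | Var r => reg s r <= D
  | Lit k => k <= D
  | Deref e => small e s /\ ram s (eval e s) <= D
  | Bin _ e1 e2 => small e1 s /\ small e2 s
  end.

Lemma eval_small e s : small e s -> eval e s <= weight_of e * D.
Proof.
elim: e => [r|k|e IH|o e1 IH1 e2 IH2] /=; rewrite ?mul1n //; first by case.
case=> /IH1 h1 /IH2 h2; rewrite mulnDl.
have D1 : 1 <= weight_of e1 * D.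
  by rewrite muln_gt0 D0 andbT; elim: (e1) => //= *; lia.
by case: o => /=; rewrite /nand /nor; lia.
Qed.

Lemma eval_ext e s s' t : uses_below t e ->
  (forall j, j < t -> reg s' j = reg s j) -> ram s' = ram s -> eval e s' = eval e s.
Proof.
elim: e => [r|k|e IH|o e1 IH1 e2 IH2] //= u hr hm; first exact: hr.
  by rewrite IH // hm.
by case/andP: u => u1 u2; rewrite IH1 // IH2.
Qed.

Lemma small_ext e s s' t : uses_below t e ->
  (forall j, j < t -> reg s' j = reg s j) -> ram s' = ram s -> small e s -> small e s'.
Proof.
elim: e => [r|k|e IH|o e1 IH1 e2 IH2] //= u hr hm; first by rewrite hr.
  by case=> h1 h2; rewrite (eval_ext u hr hm) hm; split=> //; apply: IH.
by case/andP: u => u1 u2 [h1 h2]; split; [apply: IH1 | apply: IH2].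
Qed.

Lemma uses_belowS t e : uses_below t e -> uses_below t.+1 e.
Proof.
elim: e => [r|k|e IH|o e1 IH1 e2 IH2] //=; first exact: ltnW.
by case/andP => /IH1-> /IH2->.
Qed.

Lemma comp_exec e t s : uses_below t e -> fits e -> small e s ->
  exists s', [/\ exec W (comp e t) s (cost e) s', reg s' t = eval e s, ram s' = ram s
    & forall j, j < t -> reg s' j = reg s j].
Proof.
elim: e t s => [r|k|e IH|o e1 IH1 e2 IH2] t s /=.
- move=> rt _ _; eexists; split; first by apply: (exec_seq (t1 := 1) (t2 := 1)); constructor.
  + by rewrite /= eqxx; case: eqP rt => [->|_]; rewrite ?eqxx ?subn0 // ltnNge leqnSn.
  + by [].
  + by move=> j jt /=; rewrite !ltn_eqF // ltnS ltnW.
- move=> _ _ _; eexists; split; first by constructor.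
  + by rewrite /= eqxx.
  + by [].
  + by move=> j jt /=; rewrite ltn_eqF.
- move=> u w [sm _]; have [s' [h1 h2 h3 h4]] := IH t s u w sm.
  eexists; split; first by apply: exec_seq; [exact: h1 | constructor].
  + by rewrite /= eqxx h2 h3.
  + by [].
  + by move=> j jt /=; rewrite ltn_eqF // h4.
case/andP => u1 u2 /and3P[w w1 w2] [sm1 sm2].
have [s1 [h1 v1 m1 r1]] := IH1 t s u1 w1 sm1.
have u2' := uses_belowS u2.
have ev2 : eval e2 s1 = eval e2 s by apply: eval_ext u2 r1 m1.
have sm2' : small e2 s1 by apply: small_ext u2 r1 m1 sm2.
have [s2 [h2 v2 m2 r2]] := IH2 t.+1 s1 u2' w2 sm2'.
have v1' : reg s2 t = eval e1 s by rewrite r2.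
rewrite ev2 in v2.
have bnd : eval e1 s + eval e2 s <= W.
  have := eval_small sm1; have := eval_small sm2.
  have := leq_mul w (leqnn D); rewrite mulnDl; lia.
have n1 : t.+1 == t = false by apply/eqP; lia.
have n2 : t == t.+1 = false by apply/eqP; lia.
have n3 : t.+2 == t = false by apply/eqP; lia.
have n4 : t == t.+2 = false by apply/eqP; lia.
have n5 : t.+1 == t.+2 = false by apply/eqP; lia.
have n6 : t.+2 == t.+1 = false by apply/eqP; lia.
have jn j : j < t -> [/\ j == t = false, j == t.+1 = false & j == t.+2 = false].
  by move=> jt; split; apply/eqP; lia.
suff [s3 [h3 v3 m3 r3]] : exists s3, [/\ exec W (comp_op o t) s2
     (match o with OAdd | OSub => 1 | OAnd | OLe => 3 | OOr => 4 | OEq => 5 end) s3,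
     reg s3 t = apply_op o (reg s2 t) (reg s2 t.+1), ram s3 = ram s2
   & forall j, j < t -> reg s3 j = reg s2 j].
  exists s3; split.
  - by apply: exec_seq h1 _; apply: exec_seq h2 h3.
  - by rewrite v3 v1' v2.
  - by rewrite m3 m2.
  - by move=> j jt; rewrite r3 // r2 ?r1 // ltnS ltnW.
have bnd' : reg s2 t + reg s2 t.+1 <= W by rewrite v1' v2.
clear -bnd' n1 n2 n3 n4 n5 n6 jn.
case: o.
- eexists; split; first by constructor.
  + by rewrite /= eqxx.
  + by [].
  + by move=> j /jn[e1 e2 e3]; rewrite /= e1.
- eexists; split; first by constructor.
  + by rewrite /= eqxx.
  + by [].
  + by move=> j /jn[e1 e2 e3]; rewrite /= e1.
- eexists; split.
  + apply: (exec_seq (t1 := 1) (t2 := 2)); first by constructor.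
    by apply: (exec_seq (t1 := 1) (t2 := 1)); constructor.
  + by rewrite /= !eqxx ?n1 ?n2 ?eqxx.
  + by [].
  + by move=> j /jn[e1 e2 e3]; rewrite /= e1 e2.
- eexists; split.
  + apply: (exec_seq (t1 := 1) (t2 := 3)); first by constructor.
    apply: (exec_seq (t1 := 1) (t2 := 2)); first by constructor.
    by apply: (exec_seq (t1 := 1) (t2 := 1)); constructor.
  + by rewrite /= !eqxx ?n1 ?n2 ?eqxx.
  + by [].
  + by move=> j /jn[e1 e2 e3]; rewrite /= e1 e2.
- eexists; split.
  + apply: (exec_seq (t1 := 1) (t2 := 2)); first by constructor.
    by apply: (exec_seq (t1 := 1) (t2 := 1)); constructor.
  + by rewrite /= !eqxx ?n1 ?n2 ?eqxx; lia.
  + by [].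
  + by move=> j /jn[e1 e2 e3]; rewrite /= e1 e2.
- eexists; split.
  + apply: (exec_seq (t1 := 1) (t2 := 4)); first by constructor.
    apply: (exec_seq (t1 := 1) (t2 := 3)); first by constructor.
    apply: (exec_seq (t1 := 1) (t2 := 2)).
      by constructor; rewrite /= ?eqxx ?n1 ?n2 ?n3 ?n4 ?n5 ?n6; lia.
    by apply: (exec_seq (t1 := 1) (t2 := 1)); constructor.
  + by rewrite /= !eqxx ?n1 ?n2 ?n3 ?n4 ?n5 ?n6 ?eqxx; case: eqP; lia.
  + by [].
  + by move=> j /jn[e1 e2 e3]; rewrite /= e1 e2 e3.
Qed.

Lemma runs_assign r e q s T (Q : state -> Prop) :
  [&& r < NR, uses_below NR e, fits e & cost e + 2 <= T] -> small e s ->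
  runs q (State (upd (reg s) r (eval e s)) (ram s)) (T - (cost e + 2)) Q ->
  runs (Seq (Assign r e) q) s T Q.
Proof.
case/and4P => rN ub fe leT sm h; rewrite -(subnKC leT); apply: runs_seq => s1 [ar am].
have sm1 : small e s1 by apply: small_ext ub ar am sm.
have [s' [h1 h2 h3 h4]] := comp_exec ub fe sm1.
eexists (cost e + 2), _, _; split; last exact: h.
- apply: exec_seq h1 _; apply: (exec_seq (t1 := 1) (t2 := 1)); constructor.
- by [].
split=> /= [j jn|]; last by rewrite h3 am.
rewrite subn0 h2 (eval_ext ub ar am); case: eqP => // _.
have -> : (j == NR.+1) = false by apply/eqP; lia.
by rewrite h4 // ar.
Qed.

Lemma runs_write e1 e2 q s T (Q : state -> Prop) :
  [&& uses_below NR e1, uses_below NR e2, fits e1, fits e2 & cost e1 + cost e2 + 1 <= T] ->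
  small e1 s -> small e2 s ->
  runs q (State (reg s) (upd (ram s) (eval e1 s) (eval e2 s))) (T - (cost e1 + cost e2 + 1)) Q ->
  runs (Seq (Write e1 e2) q) s T Q.
Proof.
case/and5P => u1 u2 f1 f2 leT sm1 sm2 h; rewrite -(subnKC leT); apply: runs_seq => s1 [ar am].
have sm1' : small e1 s1 by apply: small_ext u1 ar am sm1.
have [s' [h1 h2 h3 h4]] := comp_exec u1 f1 sm1'.
have ar' j : j < NR -> reg s' j = reg s j by move=> jn; rewrite h4 // ar.
have am' : ram s' = ram s by rewrite h3.
have sm2' : small e2 s' by apply: small_ext u2 ar' am' sm2.
have [s'' [g1 g2 g3 g4]] := comp_exec (uses_belowS u2) f2 sm2'.
eexists (cost e1 + cost e2 + 1), _, _; split; last exact: h.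
- rewrite -addnA; apply: exec_seq h1 _; apply: exec_seq g1 _; constructor.
- by [].
split=> /= [j jn|]; first by rewrite g4 ?ar' // ltnS ltnW.
rewrite g2 g3 am' g4 // h2 (eval_ext u1 ar am); congr (upd _ _ _).
exact: eval_ext u2 ar' am'.
Qed.

End Machine.

(** * Memory layout and preprocessing *)

Lemma nth_flatten_sumn T (x0 : T) (ss : seq (seq T)) k i :
  i < size (nth [::] ss k) ->
  nth x0 (flatten ss) (sumn (take k [seq size t | t <- ss]) + i) = nth x0 (nth [::] ss k) i.
Proof.
elim: ss k => [|t ss IH] [|k] //= lt; rewrite nth_cat ?add0n ?lt //.
by rewrite -addnA ltnNge leq_addr /= addKn IH.
Qed.

Section Layout.
Variable G : instance.
Local Notation V := 'I_(nvert G).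
Local Notation n := (nvert G).
Implicit Types (u v : V) (M : nat -> nat) (arr : nat -> V -> nat).

Definition deg v := size (pref_list v).
(** The lists start after two header cells and four blocks of n cells. At [k = n] this is the end of
    the input, where the rows of working tables begin. *)
Definition offs k := 2 + 4 * n + sumn (take k [seq deg v | v <- enum V]).
Definition base k := offs n + n * k.

Lemma deg_le v : deg v <= n.
Proof. by rewrite /deg size_sort -cardE -[leqRHS]card_ord max_card. Qed.

Lemma offsS v : offs v.+1 = offs v + deg v.
Proof.
have lt : v < size [seq deg v | v <- enum V] by rewrite size_map size_enum_ord.
rewrite /offs (take_nth 0 lt) sumn_rcons addnA; congr (_ + _).
by rewrite (nth_map v) ?size_enum_ord // nth_ord_enum.
Qed.

Lemma offs_mono i j : i <= j -> offs i <= offs j.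
Proof.
move=> le; rewrite /offs leq_add2l -(subnKC le) takeD sumn_cat; exact: leq_addr.
Qed.

Lemma sumn_deg : sumn [seq deg v | v <- enum V] = \sum_v deg v.
Proof. by rewrite sumnE big_map enumT. Qed.

Lemma offs_n : offs n = 2 + 4 * n + \sum_v deg v.
Proof. by rewrite /offs take_oversize ?sumn_deg // size_map size_enum_ord. Qed.

Lemma offs0 : offs 0 = 2 + 4 * n. Proof. by rewrite /offs take0 addn0. Qed.

Lemma offs_deg v i : i < deg v -> 2 + 4 * n <= offs v + i < offs n.
Proof.
move=> lt; have := offs_mono (ltn_ord v); rewrite offsS; have := offs_mono (leq0n v).
rewrite offs0; move: (offs v) (offs n) => a b; lia.
Qed.

Lemma base_inj k k' v v' : base k + v = base k' + v' -> k = k' /\ v = v'.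
Proof.
rewrite /base -[_ + _ + v]addnA -[_ + _ + v']addnA => /addnI; rewrite ![n * _]mulnC => e.
have n0 : 0 < n by apply: leq_ltn_trans (ltn_ord v).
have k_eq : k = k'.
  by have := congr1 (divn^~ n) e; rewrite /= !divnMDl // !divn_small ?addn0.
split=> //; apply: val_inj; move: e; rewrite k_eq; exact: addnI.
Qed.

Lemma base_ge k : offs n <= base k. Proof. exact: leq_addr. Qed.

Lemma baseE k : base k = offs n + n * k. Proof. by []. Qed.

(** The blocks of numerators and denominators are recycled for the addresses of the lists and of the
    rank rows; [i] and [j] count the entries already overwritten. *)
Record layout i j M arr : Prop := Layout {
  lay_n : M 0 = n;
  lay_side : forall v, M (2 + v) = (v \in sideA G);
  lay_off : forall v, v < i -> M (2 + n + v) = offs v;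
  lay_row : forall v, v < j -> M (2 + n + n + v) = base (6 + v);
  lay_deg : forall v, M (2 + n + n + n + v) = deg v;
  lay_lst : forall v k, k < deg v -> M (offs v + k) = nth v (pref_list v) k;
  lay_arr : forall k v, M (base k + v) = arr k v
}.

Definition aset arr k v y k' v' := if (k' == k) && (v' == v) then y else arr k' v'.

Lemma initial_layout : layout 0 0 (nth 0 (encoding G)) (fun _ _ => 0).
Proof.
have sz T (f : V -> T) : size [seq f v | v <- enum V] = n by rewrite size_map size_enum_ord.
have nm (f : V -> nat) v : nth 0 [seq f v | v <- enum V] v = f v.
  by rewrite (nth_map v) ?size_enum_ord // nth_ord_enum.
set r := [seq nat_of_bool (v \in sideA G) | v <- enum V]
  ++ [seq `|numq (weight v)|%N | v <- enum V]
  ++ [seq `|denq (weight v)|%N | v <- enum V]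
  ++ [seq size (pref_list v) | v <- enum V]
  ++ flatten [seq [seq nat_of_ord u | u <- pref_list v] | v <- enum V].
have enc z : nth 0 (encoding G) (2 + z) = nth 0 r z by [].
have szr : size r = 4 * n + \sum_v deg v.
  rewrite /r !size_cat !sz size_flatten /shape -map_comp sumnE big_map.
  have -> : \sum_(j <- enum V) size [seq nat_of_ord u | u <- pref_list j] = \sum_v deg v.
    by rewrite -sumn_deg sumnE big_map; apply: eq_bigr => u _; rewrite size_map.
  by lia.
split=> //.
- by move=> v; rewrite enc /r nth_cat sz ltn_ord nm.
- move=> v; rewrite (_ : 2 + n + n + n + v = 2 + (n + (n + (n + v)))); last by lia.
  rewrite enc /r; do 3 rewrite nth_cat sz ltnNge leq_addr /= addKn.
  by rewrite nth_cat sz ltn_ord nm.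
- move=> v k lt; have := leq0n v; move/offs_mono; rewrite offs0 => le.
  rewrite (_ : offs v + k = 2 + (n + (n + (n + (n + (offs v - (2 + 4 * n) + k)))))); last first.
    by move: le; move: (offs v) => z; lia.
  rewrite enc /r; do 4 rewrite nth_cat sz ltnNge leq_addr /= addKn.
  rewrite /offs addKn.
  have -> : [seq deg v | v <- enum V] =
      [seq size t | t <- [seq [seq nat_of_ord u | u <- pref_list v] | v <- enum V]].
    by rewrite -map_comp; apply: eq_map => u; rewrite /= size_map.
  have e : nth [::] [seq [seq nat_of_ord u | u <- pref_list v] | v <- enum V] v =
      [seq nat_of_ord u | u <- pref_list v].
    by rewrite (nth_map v) ?size_enum_ord // nth_ord_enum.
  by rewrite nth_flatten_sumn e ?size_map // (nth_map v).
(* Cells beyond the input read 0, so all rows start out cleared. Clearing the quadratic table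
   explicitly could exceed the time bound. *)
move=> k v; have := base_ge k; rewrite offs_n.
move: (base k) => z le; rewrite (_ : z + v = 2 + (z + v - 2)); last by lia.
by rewrite enc nth_default // szr; lia.
Qed.

Section Set_.
Variables (i j : nat) (M : nat -> nat) (arr : nat -> V -> nat).
Hypothesis L : layout i j M arr.

Lemma layout_set k v y : layout i j (upd M (base k + v) y) (aset arr k v y).
Proof.
have [h1 h2 h3 h4 h5 h6 h7] := L; have := base_ge k; rewrite offs_n => ge.
have far z : z < offs n -> upd M (base k + v) y z = M z.
  by rewrite offs_n => lt; rewrite /=; case: eqP => // e; lia.
split=> [|w|w wi|w wj|w|w l ld|k' w].
- by rewrite far // offs_n.
- by rewrite far ?h2 // offs_n; have := ltn_ord w; lia.
- by rewrite far ?h3 // offs_n; have := ltn_ord w; lia.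
- by rewrite far ?h4 // offs_n; have := ltn_ord w; lia.
- by rewrite far ?h5 // offs_n; have := ltn_ord w; lia.
- by rewrite far ?h6 //; have /andP[] := offs_deg ld.
rewrite /= /aset; case: eqP => [/base_inj[-> ->]|ne]; first by rewrite !eqxx.
by rewrite h7; case: andP => // -[/eqP ek /eqP ev]; case: ne; rewrite ek ev.
Qed.

Lemma layout_set_off v : nat_of_ord v = i ->
  layout i.+1 j (upd M (2 + n + v) (offs v)) arr.
Proof.
move=> ei; have [h1 h2 h3 h4 h5 h6 h7] := L; have lv := ltn_ord v.
have far z : (z < 2 + n) || (2 + n + n <= z) -> upd M (2 + n + v) (offs v) z = M z.
  by move=> lt; rewrite /=; case: eqP => // e; lia.
split=> [|w|w wi|w wj|w|w l ld|k' w].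
- by rewrite far.
- by rewrite far ?h2 //; have := ltn_ord w; lia.
- rewrite /=; case: eqP => [/addnI/val_inj->//|ne]; apply: h3.
  by move: wi; rewrite ltnS leq_eqVlt => /orP[/eqP e|//]; case: ne; rewrite e ei.
- by rewrite far ?h4 //; lia.
- by rewrite far ?h5 //; lia.
- by rewrite far ?h6 //; have := offs_deg ld; lia.
by rewrite far ?h7 //; have := base_ge k'; rewrite offs_n; lia.
Qed.

Lemma layout_set_row v : nat_of_ord v = j ->
  layout i j.+1 (upd M (2 + n + n + v) (base (6 + v))) arr.
Proof.
move=> ei; have [h1 h2 h3 h4 h5 h6 h7] := L; have lv := ltn_ord v.
have far z : (z < 2 + n + n) || (2 + n + n + n <= z) ->
    upd M (2 + n + n + v) (base (6 + v)) z = M z.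
  by move=> lt; rewrite /=; case: eqP => // e; lia.
split=> [|w|w wi|w wj|w|w l ld|k' w].
- by rewrite far.
- by rewrite far ?h2 //; have := ltn_ord w; lia.
- by rewrite far ?h3 //; have := ltn_ord w; lia.
- rewrite /=; case: eqP => [/addnI/val_inj->//|ne]; apply: h4.
  by move: wj; rewrite ltnS leq_eqVlt => /orP[/eqP e|//]; case: ne; rewrite e ei.
- by rewrite far ?h5 //; lia.
- by rewrite far ?h6 //; have := offs_deg ld; lia.
by rewrite far ?h7 //; have := base_ge k'; rewrite offs_n; lia.
Qed.

Lemma layout_ext arr' : (forall k v, arr k v = arr' k v) -> layout i j M arr'.
Proof. by move=> e; have [h1 h2 h3 h4 h5 h6 h7] := L; split=> // k v; rewrite h7. Qed.

End Set_.

End Layout.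

Notation "x +' y" := (Bin OAdd x y) (at level 50, left associativity).
Notation "x -' y" := (Bin OSub x y) (at level 50, left associativity).
Notation "x &' y" := (Bin OAnd x y) (at level 51, left associativity).
Notation "x |' y" := (Bin OOr x y) (at level 52, left associativity).
Notation "x <=' y" := (Bin OLe x y) (at level 50).
Notation "x ==' y" := (Bin OEq x y) (at level 50).
Notation "~' x" := (Bin OLe x (Lit 0)) (at level 35).
Notation "r :=' e" := (Assign r e) (at level 60).
Notation "p ;; q" := (Seq p q) (at level 61, right associativity).
Notation "# r" := (Var r) (at level 1).
Notation "' k" := (Lit k) (at level 1).
Notation "a @' e" := (Deref (Bin OAdd (Var a) e)) (at level 45).

Lemma notE (p : bool) : (p <= 0) = ~~ p :> bool. Proof. by case: p. Qed.

Notation "'r_ans'" := 0.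
Notation "'r_out'" := 1.
Notation "'r_zero'" := 2.
Notation "'r_n'" := 4.
Notation "'r_side'" := 5.
Notation "'r_off'" := 6.
Notation "'r_row'" := 7.
Notation "'r_deg'" := 8.
Notation "'r_fp'" := 9.
Notation "'r_pos'" := 10.
Notation "'r_flag'" := 11.
Notation "'r_nv'" := 12.
Notation "'r_snd'" := 13.
Notation "'r_v'" := 15.
Notation "'r_d'" := 16.
Notation "'r_o'" := 17.
Notation "'r_i'" := 18.
Notation "'r_acc'" := 19.

Definition setup_offsets :=
  r_n :=' Deref '0 ;;
  r_side :=' '2 ;;
  r_off :=' #r_side +' #r_n ;;
  r_row :=' #r_off +' #r_n ;;
  r_deg :=' #r_row +' #r_n ;;
  r_acc :=' #r_deg +' #r_n ;;
  Skip.

Definition offsets_body :=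
  Write (#r_off +' #r_v) #r_acc ;;
  r_acc :=' #r_acc +' (r_deg @' #r_v) ;;
  r_v :=' #r_v +' '1 ;; Skip.

Definition setup_bases :=
  r_fp :=' #r_acc ;;
  r_pos :=' #r_fp +' #r_n ;;
  r_flag :=' #r_pos +' #r_n ;;
  r_out :=' #r_flag +' #r_n ;;
  r_nv :=' #r_out +' #r_n ;;
  r_snd :=' #r_nv +' #r_n ;;
  r_acc :=' #r_snd +' #r_n ;;
  r_v :=' '0 ;; Skip.

Section Setup.
Variable G : instance.
Local Notation V := 'I_(nvert G).
Local Notation n := (nvert G).
Lemma baseS k : base G k + n = base G k.+1.
Proof. by rewrite !baseE mulnS; lia. Qed.

Lemma base_mono i j : i <= j -> base G i <= base G j.
Proof. by move=> le; rewrite !baseE leq_add2l leq_mul2l le orbT. Qed.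

Variables W D : nat.
Hypothesis DW : 64 * D <= W.
Hypothesis D60 : 60 <= D.
Hypothesis DB : base G (8 + n) <= D.

Lemma base_D k : k <= 8 + n -> base G k <= D.
Proof. by move=> le; apply: leq_trans (base_mono le) DB. Qed.

Lemma offs_D k : k <= n -> offs G k <= D.
Proof.
move=> kn; apply: leq_trans (offs_mono G kn) _.
by have := base_D (leq0n _); rewrite baseE muln0 addn0.
Qed.

Lemma n_D : 2 + 4 * n <= D.
Proof. by have := @offs_D 0 (leq0n _); rewrite offs0. Qed.

Lemma D_gt0 : 0 < D. Proof. exact: leq_trans D60. Qed.

Definition low_regs s := [/\ reg s r_zero = 0, reg s r_n = n & reg s r_side = 2] /\
  [/\ reg s r_off = 2 + n, reg s r_row = 2 + n + n & reg s r_deg = 2 + n + n + n].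

Lemma setup_offsets_ok s : reg s = (fun _ => 0) -> ram s 0 = n ->
  runs W setup_offsets s 200 (fun s' => [/\ low_regs s', reg s' r_v = 0, reg s' r_acc = offs G 0 & ram s' = ram s]).
Proof.
move=> r0 m0; have nD := n_D; have d0 := D_gt0; rewrite /setup_offsets.
apply: (runs_assign DW d0) => //=; first by rewrite m0; lia.
apply: (runs_assign DW d0) => //=; first by lia.
apply: (runs_assign DW d0) => //=; first by rewrite m0; lia.
apply: (runs_assign DW d0) => //=; first by rewrite m0; lia.
apply: (runs_assign DW d0) => //=; first by rewrite m0; lia.
apply: (runs_assign DW d0) => //=; first by rewrite m0; lia.
apply: runs_skip => //; rewrite /low_regs /= m0 r0 offs0; split=> //.
by lia.
Qed.

Lemma offsets_loop_ok s : low_regs s -> reg s r_v = 0 -> reg s r_acc = offs G 0 ->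
  layout 0 0 (ram s) (fun _ (_ : V) => 0) ->
  runs W (WhileLt r_v r_n offsets_body) s (\sum_(0 <= i < n) 100.+1).+1
    (fun s' => [/\ low_regs s', reg s' r_v = n, reg s' r_acc = offs G n &
       layout n 0 (ram s') (fun _ (_ : V) => 0)]).
Proof.
move=> lr v0 a0 L0; have nD := n_D; have d0 := D_gt0.
pose Inv i s' := [/\ low_regs s', reg s' r_v = i, reg s' r_acc = offs G i &
       layout i 0 (ram s') (fun _ (_ : V) => 0)].
apply: (@runs_loop W Inv (fun _ => 100) n) => //.
  by move=> i s' _ [[[_ h _] _] -> _ _].
move=> i s' lt [[[r2 r4 r5] [r6 r7 r8]] rv ra L].
pose v := Ordinal lt; have ev : i = v by [].
have aD : offs G i <= D by apply: offs_D; exact: ltnW.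
have dv : deg v <= n := deg_le v.
rewrite /offsets_body.
apply: (runs_write DW d0) => //=; rewrite ?r6 ?rv ?ra //; first by lia.
have L' := layout_set_off L (esym ev : nat_of_ord v = i).
apply: (runs_assign DW d0) => //=; rewrite ?r8 ?rv ?ra.
  by have := lay_deg L' v; rewrite /= => ->; lia.
have -> : (if 2 + n + n + n + i == 2 + n + i then offs G i else ram s' (2 + n + n + n + i)) = deg v.
  exact: (lay_deg L' v).
apply: (runs_assign DW d0) => //=; rewrite ?rv; first by lia.
apply: runs_skip => //; split=> /=; rewrite ?r2 ?r4 ?r5 ?r6 ?r7 ?r8 //.
- by rewrite addn1.
- by rewrite ev -offsS.
Qed.

End Setup.

Section Tables.
Variable G : instance.
Local Notation V := 'I_(nvert G).
Local Notation n := (nvert G).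
Implicit Types (c : V -> nat) (f : V -> V -> nat).

(* Rows of the table kept after the input: first-choice posts, positions, flags,
   output, numbers of valid neighbours, second choices (shifted by one, 0 for
   none), then the ranks [vrank b] for each post b. *)
Definition tab c0 c1 c2 c3 c4 c5 f (k : nat) (w : V) : nat :=
  match k with
  | 0 => c0 w | 1 => c1 w | 2 => c2 w | 3 => c3 w | 4 => c4 w | 5 => c5 w
  | k'.+2.+4 => if (insub k' : option V) is Some b then f b w else 0
  end.

Definition fset c (v : V) y w := if w == v then y else c w.
Definition fset2 f (b v : V) y b' w := if (b' == b) && (w == v) then y else f b' w.

Lemma tab_row c0 c1 c2 c3 c4 c5 f (b w : V) : tab c0 c1 c2 c3 c4 c5 f (6 + b) w = f b w.
Proof. by rewrite /= valK. Qed.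

Variables (i j : nat) (M : nat -> nat).
Variables (c0 c1 c2 c3 c4 c5 : V -> nat) (f : V -> V -> nat).
Hypothesis L : layout i j M (tab c0 c1 c2 c3 c4 c5 f).

Lemma tab_set0 (v : V) y : layout i j (upd M (base G 0 + v) y) (tab (fset c0 v y) c1 c2 c3 c4 c5 f).
Proof. by refine (layout_ext (layout_set L 0 v y) _) => -[|[|[|[|[|[|k]]]]]] w. Qed.
Lemma tab_set1 (v : V) y : layout i j (upd M (base G 1 + v) y) (tab c0 (fset c1 v y) c2 c3 c4 c5 f).
Proof. by refine (layout_ext (layout_set L 1 v y) _) => -[|[|[|[|[|[|k]]]]]] w. Qed.
Lemma tab_set2 (v : V) y : layout i j (upd M (base G 2 + v) y) (tab c0 c1 (fset c2 v y) c3 c4 c5 f).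
Proof. by refine (layout_ext (layout_set L 2 v y) _) => -[|[|[|[|[|[|k]]]]]] w. Qed.
Lemma tab_set3 (v : V) y : layout i j (upd M (base G 3 + v) y) (tab c0 c1 c2 (fset c3 v y) c4 c5 f).
Proof. by refine (layout_ext (layout_set L 3 v y) _) => -[|[|[|[|[|[|k]]]]]] w. Qed.
Lemma tab_set4 (v : V) y : layout i j (upd M (base G 4 + v) y) (tab c0 c1 c2 c3 (fset c4 v y) c5 f).
Proof. by refine (layout_ext (layout_set L 4 v y) _) => -[|[|[|[|[|[|k]]]]]] w. Qed.
Lemma tab_set5 (v : V) y : layout i j (upd M (base G 5 + v) y) (tab c0 c1 c2 c3 c4 (fset c5 v y) f).
Proof. by refine (layout_ext (layout_set L 5 v y) _) => -[|[|[|[|[|[|k]]]]]] w. Qed.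
Lemma tab_set6 (b v : V) y :
  layout i j (upd M (base G (6 + b) + v) y) (tab c0 c1 c2 c3 c4 c5 (fset2 f b v y)).
Proof.
refine (layout_ext (layout_set L (6 + b) v y) _) => k w; rewrite /aset.
case: eqP => [->|ne]; first by rewrite !tab_row /fset2 eqxx.
case: k ne => [|[|[|[|[|[|k]]]]]] //= ne; case: insubP => //= b' _ eb.
rewrite /fset2; case: (b' =P b) => // e; case: ne.
by rewrite -e eb.
Qed.

End Tables.

(** Row addresses are accumulated by repeated addition of n, since the machine cannot multiply; the
    same loop marks the top choices. *)
Definition rows_body :=
  Write (#r_row +' #r_v) #r_acc ;;
  r_acc :=' #r_acc +' #r_n ;;
  r_o :=' (r_off @' #r_v) ;; r_d :=' (r_deg @' #r_v) ;;
  20 :=' (r_side @' #r_v) &' ('1 <=' #r_d) ;;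
  IfLt r_zero 20 (Write (#r_fp +' Deref #r_o) '1 ;; Skip) Skip ;;
  r_v :=' #r_v +' '1 ;; Skip.

Definition scan_second :=
  21 :=' Deref (#r_o +' #r_i) ;;
  22 :=' (#25 ==' '0) &' (~' (r_fp @' #21)) ;;
  IfLt r_zero 22 (25 :=' #21 +' '1 ;; Skip) Skip ;;
  r_i :=' #r_i +' '1 ;; Skip.

Definition marks_body :=
  r_o :=' (r_off @' #r_v) ;; r_d :=' (r_deg @' #r_v) ;;
  20 :=' (r_side @' #r_v) &' ('1 <=' #r_d) ;;
  IfLt r_zero 20
    (21 :=' Deref #r_o ;; Write ((r_row @' #21) +' #r_v) '1 ;;
     25 :=' '0 ;; r_i :=' '0 ;;
     WhileLt r_i r_d scan_second ;;
     Write (#r_snd +' #r_v) #25 ;;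
     IfLt r_zero 25 (21 :=' #25 -' '1 ;; Write ((r_row @' #21) +' #r_v) '1 ;; Skip) Skip ;;
     Skip)
    Skip ;;
  r_v :=' #r_v +' '1 ;; Skip.

(** A row first holds 0/1 validity marks. Going down the list of the post, each mark is read and
    then replaced by the number of marks before it, which is [vrank]. *)
Definition count_step :=
  22 :=' #21 +' Deref (#r_o +' #r_i) ;;
  23 :=' Deref #22 ;;
  Write #22 #24 ;;
  24 :=' #24 +' #23 ;;
  r_i :=' #r_i +' '1 ;; Skip.

Definition counts_body :=
  r_o :=' (r_off @' #r_v) ;; r_d :=' (r_deg @' #r_v) ;;
  21 :=' (r_row @' #r_v) ;; 24 :=' '0 ;; r_i :=' '0 ;;
  WhileLt r_i r_d count_step ;;
  Write (#r_nv +' #r_v) #24 ;;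
  r_v :=' #r_v +' '1 ;; Skip.

Section Setup.
Variable G : instance.
Local Notation V := 'I_(nvert G).
Local Notation n := (nvert G).
Local Notation A := (sideA G).
Variables W D : nat.
Hypothesis DW : 64 * D <= W.
Hypothesis D60 : 60 <= D.
Hypothesis DB : base G (8 + n) <= D.
Let d0 : 0 < D := D_gt0 D60.

Definition all_regs s := low_regs G s /\
  [/\ reg s r_fp = base G 0, reg s r_pos = base G 1 & reg s r_flag = base G 2] /\
  [/\ reg s r_out = base G 3, reg s r_nv = base G 4 & reg s r_snd = base G 5].

Lemma setup_bases_ok s : low_regs G s -> reg s r_acc = offs G n ->
  runs W setup_bases s 200 (fun s' => [/\ all_regs s', reg s' r_v = 0,
    reg s' r_acc = base G 6 & ram s' = ram s]).
Proof.
move=> [[r2 r4 r5] [r6 r7 r8]] ra; have nD := n_D DB.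
have b0 : offs G n = base G 0 by rewrite baseE muln0 addn0.
have bD k : k <= 8 -> base G k <= D by move=> kn; apply: base_D DB _ _; apply: leq_trans kn (leq_addr _ _).
rewrite /setup_bases.
apply: (runs_assign DW d0) => //=; first by rewrite ra b0 bD.
rewrite ra b0.
do 6 (apply: (runs_assign DW d0) => //=; first (by rewrite r4 bD //; lia); rewrite r4 baseS).
apply: (runs_assign DW d0) => //=.
by apply: runs_skip => //; rewrite /all_regs /low_regs /=.
Qed.

Definition first_marks i (w : V) : nat := [exists u : V, [&& u < i, u \in A & top u w]].

Definition zero1 (_ : V) := 0.
Definition zero2 (_ _ : V) := 0.

Lemma active_deg (v : V) : active v = (v \in A) && (0 < deg v).
Proof. by rewrite /active /deg lt0n size_eq0. Qed.

Lemma lst_head (v : V) M i j (arr : nat -> V -> nat) : active v -> layout i j M arr -> M (offs G v) = first_post v.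
Proof.
rewrite active_deg => /andP[_ d] L; have := lay_lst L d; rewrite addn0 => ->.
by rewrite /first_post nth0.
Qed.

Lemma rows_loop_ok s : all_regs s -> reg s r_v = 0 -> reg s r_acc = base G 6 ->
  layout n 0 (ram s) (fun _ (_ : V) => 0) ->
  runs W (WhileLt r_v r_n rows_body) s (\sum_(0 <= i < n) 200.+1).+1
    (fun s' => [/\ all_regs s', reg s' r_v = n &
       layout n n (ram s') (tab (fun w => fpost w) zero1 zero1 zero1 zero1 zero1 zero2)]).
Proof.
move=> lr v0 a0 L0; have nD := n_D DB.
pose Inv i s' := [/\ all_regs s', reg s' r_v = i, reg s' r_acc = base G (6 + i) &
       layout n i (ram s') (tab (first_marks i) zero1 zero1 zero1 zero1 zero1 zero2)].
apply: (@runs_loop W Inv (fun _ => 200) n) => //.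
- by move=> i s' _ [[[[_ h _] _] _] -> _ _].
- split=> //; refine (layout_ext L0 _) => -[|[|[|[|[|[|k]]]]]] w //=.
    by rewrite /first_marks; case: existsP => // -[].
  by case: insub.
- move=> s' [h1 h2 _ h4]; split=> //; refine (layout_ext h4 _) => -[|k] w //=.
  congr nat_of_bool; apply: eq_existsb => u; by rewrite ltn_ord.
move=> i s' lt; have [v ev] : exists v : V, i = v by exists (Ordinal lt).
subst i; move=> [[[[r2 r4 r5] [r6 r7 r8]] [[r9 r10 r11] [r1 r12 r13]]] rv ra L].
have dv : deg v <= n := deg_le v.
have vD : v <= D by lia.
have accD : base G (6 + v) <= D by apply: (base_D DB); lia.
have oD := offs_D DB (ltnW lt).
rewrite /rows_body.
apply: (runs_write DW d0) => //=; rewrite ?r7 ?rv ?ra //; first by lia.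
have L' := layout_set_row L (erefl (nat_of_ord v)).
set M' := upd _ _ _ in L' *.
apply: (runs_assign DW d0) => //=; rewrite ?ra ?r4; first by lia.
rewrite baseS.
apply: (runs_assign DW d0) => //=; rewrite ?r6 ?rv (lay_off L') //.
  by repeat split; lia.
apply: (runs_assign DW d0) => //=; rewrite ?r8 ?rv (lay_deg L').
  by repeat split; lia.
apply: (runs_assign DW d0) => //=; rewrite ?r5 ?rv (lay_side L').
  by repeat split; lia.
rewrite nandE -active_deg.
rewrite -[200 - _ - _ - _ - _ - _](subnKC (_ : 60 <= _)) //.
apply: (runs_if (T1 := 59)) => //=; rewrite r2.
have fin s2 (c : V -> nat) T : all_regs s2 -> reg s2 r_v = v -> reg s2 r_acc = base G (6 + v).+1 ->
    layout n v.+1 (ram s2) (tab c zero1 zero1 zero1 zero1 zero1 zero2) ->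
    c =1 first_marks v.+1 -> 20 <= T ->
    runs W (r_v :=' #r_v +' '1 ;; Skip) s2 T (Inv v.+1).
  move=> [[[q2 q4 q5] [q6 q7 q8]] [[q9 q10 q11] [q1 q12 q13]]] qv qa L2 ec T20.
  apply: (runs_assign DW d0) => //=; rewrite ?qv; [lia | lia | rewrite addn1].
  apply: runs_skip; first by lia.
  split=> //; refine (layout_ext L2 _) => -[|[|[|[|[|[|k]]]]]] w //=.
case: (boolP (active v)) => ac /=; last first.
  apply: runs_skip => //; apply: (fin _ (first_marks v)) => // w.
  rewrite /first_marks; congr nat_of_bool; apply: eq_existsb => u.
  rewrite [u < v.+1]ltnS [u <= v]leq_eqVlt; case: eqP => //= /val_inj->.
  rewrite ltnn; apply/esym/negbTE/negP => /andP[vA tv].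
  by case/negP: ac; have [ab _] := topP tv; apply: active_adj vA ab.
have hd := lst_head ac L'; have fn := ltn_ord (first_post v).
have [vA tv _] := active_first ac.
apply: (runs_write DW d0) => //=; rewrite ?r9 ?hd.
  repeat split; [exact: (base_D DB) | exact: oD | lia].
apply: runs_skip => //; apply: (fin _ (fset (first_marks v) (first_post v) 1)) => //; first exact: tab_set0 L' _ _.
move=> w; 
rewrite /fset /first_marks; case: eqP => [->|ne].
  have -> : [exists u : V, [&& u < v.+1, u \in A & top u (first_post v)]] by apply/existsP; exists v; rewrite ltnSn vA.
  by [].
congr nat_of_bool; apply: eq_existsb => u.
rewrite [u < v.+1]ltnS [u <= v]leq_eqVlt; case: eqP => //= /val_inj->.
rewrite ltnn; apply/esym/negbTE/negP => /andP[_ tw].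
by case: ne; apply: top_uniq tw tv.
Qed.

Definition scode (v : V) j : nat :=
  if ohead [seq b <- take j (pref_list v) | ~~ fpost b] is Some p then p.+1 else 0.

Lemma scodeS (v : V) j : j < deg v -> scode v j.+1 =
  if (scode v j == 0) && ~~ fpost (nth v (pref_list v) j)
  then (nth v (pref_list v) j).+1 else scode v j.
Proof.
move=> lt; rewrite /scode (take_nth v lt) filter_rcons.
case: ifP => np; last by rewrite andbF.
by case: [seq b <- _ | _] => [|z t].
Qed.

Lemma scode_deg (v : V) : scode v (deg v) = if second v is Some p then p.+1 else 0.
Proof. by rewrite /scode take_size. Qed.

Lemma scode_le (v : V) j : scode v j <= n.
Proof. by rewrite /scode; case: ohead => // p; apply: ltn_ord. Qed.

Lemma scan_second_ok (v : V) s M (c5 : V -> nat) f : all_regs s -> reg s r_o = offs G v ->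
  reg s r_d = deg v -> reg s r_i = 0 -> reg s 25 = 0 -> reg s r_v = v -> ram s = M ->
  layout n n M (tab (fun w => fpost w) zero1 zero1 zero1 zero1 c5 f) ->
  runs W (WhileLt r_i r_d scan_second) s (deg v * 101).+1
    (fun s' => [/\ all_regs s', reg s' r_o = offs G v, reg s' r_v = v,
       reg s' 25 = scode v (deg v) & ram s' = M]).
Proof.
move=> ar ro rd ri r25 rv rm L; have nD := n_D DB.
have oD := offs_D DB (ltnW (ltn_ord v)).
pose Inv i s' := [/\ all_regs s', reg s' r_o = offs G v, reg s' r_v = v, reg s' 25 = scode v i & ram s' = M]
  /\ reg s' r_d = deg v /\ reg s' r_i = i.
apply: (@runs_loop W Inv (fun _ => 100) (deg v)) => //.
- by move=> i s' _ [_ [-> ->]].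
- by split=> //; split=> //; rewrite r25 /scode take0.
- by rewrite sum_nat_const_nat subn0.
- by move=> s' [].
move=> i s' lt [[ar' ro' rv' r25' rm'] [rd' ri']].
have [[[r2 r4 r5] [r6 r7 r8]] [[r9 r10 r11] [r1 r12 r13]]] := ar'.
have lst := lay_lst L lt; set u := nth v (pref_list v) i in lst.
have fpu := lay_arr L 0 u; rewrite /= in fpu.
have un := ltn_ord u; have sn := scode_le v i.
have iD : i <= D by have := deg_le v; lia.
have b0 : base G 0 <= D by apply: (base_D DB).
rewrite /scan_second.
apply: (runs_assign DW d0) => //=; rewrite ?ro' ?ri' ?rm' ?lst; first by repeat split; lia.
apply: (runs_assign DW d0) => //=; rewrite ?r25' ?r9 ?rm' ?fpu; first by repeat split=> //; lia.
rewrite notE nandE -[100 - _ - _](subnKC (_ : 40 <= _)) //.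
apply: (runs_if (T1 := 39)) => //=; rewrite r2 lt0b.
have fin s2 T : all_regs s2 -> reg s2 r_o = offs G v -> reg s2 r_v = v -> reg s2 25 = scode v i.+1 ->
   ram s2 = M -> reg s2 r_d = deg v -> reg s2 r_i = i -> 20 <= T ->
   runs W (r_i :=' #r_i +' '1 ;; Skip) s2 T (Inv i.+1).
  move=> [[[q2 q4 q5] [q6 q7 q8]] [[q9 q10 q11] [q1 q12 q13]]] *.
  apply: (runs_assign DW d0) => //=; [lia | lia | ].
  apply: runs_skip; first by lia.
  by split=> //=; split=> //; lia.
rewrite scodeS // -/u in fin.
case: ifP fin => h fin.
  apply: (runs_assign DW d0) => //=; first by lia.
  by apply: runs_skip => //; apply: fin => //=; rewrite addn1.
by apply: runs_skip => //; apply: fin.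
Qed.

Definition sndcode (w : V) : nat :=
  if active w then if second w is Some p then p.+1 else 0 else 0.

Definition snd_upto i (w : V) : nat := if w < i then sndcode w else 0.
Definition val_upto i (b w : V) : nat := valid b w && (w < i).

Lemma marks_loop_ok s : all_regs s -> reg s r_v = 0 ->
  layout n n (ram s) (tab (fun w => fpost w) zero1 zero1 zero1 zero1 zero1 zero2) ->
  runs W (WhileLt r_v r_n marks_body) s (\sum_(v : V) (300 + 101 * deg v).+1).+1
    (fun s' => [/\ all_regs s', reg s' r_v = n &
       layout n n (ram s') (tab (fun w => fpost w) zero1 zero1 zero1 zero1 sndcode (fun b w => valid b w))]).
Proof.
move=> lr v0 L0; have nD := n_D DB.
pose Inv i s' := [/\ all_regs s', reg s' r_v = i &
       layout n n (ram s') (tab (fun w => fpost w) zero1 zero1 zero1 zero1 (snd_upto i) (val_upto i))].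
pose C i := oapp (fun v : V => 300 + 101 * deg v) 0 (insub i).
apply: (@runs_loop W Inv C n) => //.
- by move=> i s' _ [[[[_ h _] _] _] ->].
- split=> //; refine (layout_ext L0 _) => -[|[|[|[|[|[|k]]]]]] w //=.
  by case: insub => // b; rewrite /val_upto andbF.
- by rewrite big_mkord ltnS; apply: leq_sum => v _; rewrite /C valK.
- move=> s' [h1 h2 h4]; split=> //; refine (layout_ext h4 _) => -[|[|[|[|[|[|k]]]]]] w //=.
    by rewrite /snd_upto ltn_ord.
  by case: insub => // b; rewrite /val_upto ltn_ord andbT.
move=> i s' lt; have [v ev] : exists v : V, i = v by exists (Ordinal lt).
subst i; move=> [ar rv L].
have -> : C v = 300 + 101 * deg v by rewrite /C valK.
have [[[r2 r4 r5] [r6 r7 r8]] [[r9 r10 r11] [r1 r12 r13]]] := ar.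
have dv : deg v <= n := deg_le v.
have vD : v <= D by lia.
have oD := offs_D DB (ltnW lt).
rewrite /marks_body.
apply: (runs_assign DW d0) => //=; rewrite ?r6 ?rv ?(lay_off L) //; first by repeat split; lia.
apply: (runs_assign DW d0) => //=; rewrite ?r8 ?rv ?(lay_deg L) //; first by repeat split; lia.
apply: (runs_assign DW d0) => //=; rewrite ?r5 ?rv ?(lay_side L) //; first by repeat split; lia.
rewrite nandE -active_deg.
have fin s2 T : all_regs s2 -> reg s2 r_v = v ->
    layout n n (ram s2) (tab (fun w => fpost w) zero1 zero1 zero1 zero1 (snd_upto v.+1) (val_upto v.+1)) ->
    20 <= T -> runs W (r_v :=' #r_v +' '1 ;; Skip) s2 T (Inv v.+1).
  move=> [[[q2 q4 q5] [q6 q7 q8]] [[q9 q10 q11] [q1 q12 q13]]] qv L2 T20.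
  apply: (runs_assign DW d0) => //=; rewrite ?qv; [lia | lia | rewrite addn1].
  by apply: runs_skip; first by lia.
apply: (@runs_if_le _ (210 + 101 * deg v) 30) => //=; first by lia.
rewrite r2 lt0b; case: ifP => ac; last first.
  apply: runs_skip; first by lia.
  apply: fin => //=; refine (layout_ext L _) => -[|[|[|[|[|[|k]]]]]] w //=.
    rewrite /snd_upto ltnS [w <= v]leq_eqVlt; case: eqP => // /val_inj->.
    by rewrite ltnn /sndcode ac.
  case: insub => // b; rewrite /val_upto; congr nat_of_bool.
  rewrite ltnS [w <= v]leq_eqVlt; case: eqP => //= /val_inj->.
  rewrite ltnn andbF andbT; apply/esym/negbTE/negP => /validP[vA vb _].
  by rewrite (active_adj vA vb) in ac.
have hd := lst_head ac L; have fn := ltn_ord (first_post v).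
have [vA tv vf] := active_first ac.
have rD b : b < n -> base G (6 + b) <= D by move=> bn; apply: (base_D DB); lia.
apply: (runs_assign DW d0) => //=; rewrite ?hd; first by repeat split; lia.
have rowf := lay_row L fn.
apply: (runs_write DW d0) => //=; rewrite ?r7 ?rv ?rowf.
  by repeat split; [lia | lia | apply: rD | lia].
have L1 := tab_set6 L (first_post v) v 1; set M1 := upd _ _ _ in L1 *.
apply: (runs_assign DW d0) => //=.
apply: (runs_assign DW d0) => //=.
apply: (@runs_seq_le _ (101 * deg v).+1 150); first by lia.
apply: runs_conseq (scan_second_ok (M := M1) _ _ _ _ _ _ _ L1) _ _ => //=; first by lia.
move=> s2 [ar2 ro2 rv2 r25 rm2]; rewrite scode_deg in r25.
have [[[q2 q4 q5] [q6 q7 q8]] [[q9 q10 q11] [q1 q12 q13]]] := ar2.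
have sn : (if second v is Some p then p.+1 else 0) <= n by case: (second v) => // p; apply: ltn_ord.
have b5 : base G 5 <= D by apply: (base_D DB); lia.
apply: (runs_write DW d0) => //=; rewrite ?q13 ?rv2 ?r25 ?rm2; [by repeat split; lia | by lia |].
have L2 := tab_set5 L1 v (if second v is Some p then p.+1 else 0).
set M2 := upd _ _ _ in L2 *.
have okv c f : layout n n f (tab (fun w => fpost w) zero1 zero1 zero1 zero1 
   (fset (snd_upto v) v (if second v is Some p then p.+1 else 0)) c) ->
   (forall b w, c b w = val_upto v.+1 b w) ->
   layout n n f (tab (fun w => fpost w) zero1 zero1 zero1 zero1 (snd_upto v.+1) (val_upto v.+1)).
  move=> Lf ec; refine (layout_ext Lf _) => -[|[|[|[|[|[|k]]]]]] w //=.
    rewrite /snd_upto /fset; case: eqP => [->|ne]; first by rewrite ltnSn /sndcode ac.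
    rewrite ltnS [w <= v]leq_eqVlt; case: eqP => // /val_inj e; by case: ne.
  by case: insub => // b; rewrite ec.
have val0 b w : w != v -> val_upto v.+1 b w = val_upto v b w.
  move=> wv; rewrite /val_upto ltnS [w <= v]leq_eqVlt; case: eqP => // /val_inj e.
  by rewrite e eqxx in wv.
have valv b : val_upto v.+1 b v = top v b || sec v b.
  by rewrite /val_upto ltnSn andbT /valid vA.
apply: (@runs_if_le _ 60 25) => //=; rewrite q2 r25.
case e: (second v) => [p|] /=; last first.
  apply: runs_skip => //; apply: runs_skip => //; apply: fin => //=.
  rewrite e in L2 okv; apply: (okv _ _ L2) => b w; rewrite /fset2.
  have [->|wv] := eqVneq w v; last by rewrite andbF val0.
  rewrite valv /sec e orbF andbT; case: eqP => [->|ne]; first by rewrite tv.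
  have -> : top v b = false by apply/negP => tb; case: ne; apply: top_uniq tb tv.
  by rewrite /val_upto ltnn andbF.
have pn := ltn_ord p; have rowp := lay_row L2 pn; rewrite e in rowp L2 okv.
have sp : sec v p by rewrite /sec e.
have [_ np] := secP sp; have ff := top_fpost vA tv.
apply: (runs_assign DW d0) => //=; rewrite ?r25 e; first by repeat split; lia.
rewrite subn1 /=.
apply: (runs_write DW d0) => //=; rewrite ?q7 ?rv2 ?rowp.
  by repeat split; [lia | lia | apply: rD | lia].
have L3 := tab_set6 L2 p v 1.
apply: runs_skip => //; apply: runs_skip => //; apply: fin => //=.
apply: (okv _ _ L3) => b w; rewrite /fset2.
have [->|wv] := eqVneq w v; last by rewrite !andbF val0.
rewrite valv !andbT; case: eqP => [->|nep]; first by rewrite sp orbT.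
case: eqP => [->|nef]; first by rewrite tv.
have -> : top v b = false by apply/negP => tb; case: nef; apply: top_uniq tb tv.
have -> : sec v b = false by apply/negP => tb; case: nep; apply: sec_uniq tb sp.
by rewrite /val_upto ltnn andbF.
Qed.

Definition vmat (b w : V) : nat := if adj b w then vrank b w else 0.
Definition mat_upto i (b w : V) : nat := if b < i then vmat b w else valid b w.
Definition nv_upto i (w : V) : nat := if w < i then nvalid w else 0.
Definition row_upto (v : V) j (b w : V) : nat :=
  if b == v then (if rank v w < j then vrank v w else valid v w) else mat_upto v b w.

Let fp (w : V) : nat := fpost w.

Lemma rank_nth (v : V) j : j < deg v -> rank v (nth v (pref_list v) j) = j.
Proof. by move=> lt; rewrite /rank index_uniq ?pref_list_uniq. Qed.

Lemma count_loop_ok (v : V) s : all_regs s -> reg s r_o = offs G v ->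
  reg s r_d = deg v -> reg s r_i = 0 -> reg s 21 = base G (6 + v) -> reg s 24 = 0 -> reg s r_v = v ->
  layout n n (ram s) (tab fp zero1 zero1 zero1 (nv_upto v) sndcode (mat_upto v)) ->
  runs W (WhileLt r_i r_d count_step) s (deg v * 101).+1
    (fun s' => [/\ all_regs s', reg s' r_v = v, reg s' 24 = nvalid v &
       layout n n (ram s') (tab fp zero1 zero1 zero1 (nv_upto v) sndcode (mat_upto v.+1))]).
Proof.
move=> ar ro rd ri r21 r24 rv L; have nD := n_D DB.
have oD := offs_D DB (ltnW (ltn_ord v)).
pose Inv j s' := [/\ all_regs s', reg s' r_o = offs G v, reg s' r_v = v,
    reg s' 24 = count (valid v) (take j (pref_list v)) &
    layout n n (ram s') (tab fp zero1 zero1 zero1 (nv_upto v) sndcode (row_upto v j))]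
  /\ [/\ reg s' r_d = deg v, reg s' r_i = j & reg s' 21 = base G (6 + v)].
apply: (@runs_loop W Inv (fun _ => 100) (deg v)) => //.
- by move=> i s' _ [_ [-> ->]].
- split=> //; split=> //; rewrite ?take0 //; refine (layout_ext L _) => -[|[|[|[|[|[|k]]]]]] w //=.
  by case: insub => // b; rewrite /row_upto /mat_upto; case: eqP => // ->; rewrite ltnn.
- by rewrite sum_nat_const_nat subn0.
- move=> s' [[h1 _ h2 h3 h4] _]; split=> //; first by rewrite h3 /nvalid take_size.
  refine (layout_ext h4 _) => -[|[|[|[|[|[|k]]]]]] w //=.
  case: insub => // b; rewrite /row_upto /mat_upto ltnS [b <= v]leq_eqVlt.
  case: eqP => [->|ne]; last by case: eqP => // /val_inj.
  rewrite eqxx /= /vmat; have [vw|vw] := boolP (adj v w); first by rewrite rank_lt.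
  (* A vertex off the list has rank [deg v] and is not valid, so its untouched cell is 0, as in
     [vmat]. *)
  have -> : rank v w < deg v = false by rewrite /rank index_mem mem_pref_list (negbTE vw).
  by case: (boolP (valid v w)) => // /validP[_ _]; rewrite (negbTE vw).
move=> j s' lt [[ar' ro' rv' r24' L'] [rd' ri' r21']].
have [[[r2 r4 r5] [r6 r7 r8]] [[r9 r10 r11] [r1 r12 r13]]] := ar'.
have lst := lay_lst L' lt; set u := nth v (pref_list v) j in lst.
have ru : rank v u = j by apply: rank_nth.
have un := ltn_ord u; have vn := ltn_ord v.
have rowD : base G (6 + v) <= D by apply: (base_D DB); lia.
have auD : base G (6 + v) + u <= D.
  apply: leq_trans (_ : base G (7 + v) <= D); last by apply: (base_D DB); lia.
  by rewrite -[base G (7 + v)]baseS leq_add2l ltnW.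
have jD : j <= D by have := deg_le v; lia.
have cD : count (valid v) (take j (pref_list v)) <= D.
  by apply: leq_trans (count_size _ _) _; rewrite size_take; have := deg_le v; case: ifP; lia.
have rd0 : ram s' (base G (6 + v) + u) = valid v u.
  by rewrite (lay_arr L' (6 + v) u) tab_row /row_upto eqxx ru ltnn.
rewrite /count_step.
apply: (runs_assign DW d0) => //=; rewrite ?ro' ?ri' ?r21' ?lst; first by repeat split; lia.
apply: (runs_assign DW d0) => //=; rewrite ?rd0; first by split=> //; have := leq_b1 (valid v u); lia.
apply: (runs_write DW d0) => //=; rewrite ?r24' //.
have L1 := tab_set6 L' v u (count (valid v) (take j (pref_list v))).
apply: (runs_assign DW d0) => //=; rewrite ?r24'; first by split=> //; have := leq_b1 (valid v u); lia.
apply: (runs_assign DW d0) => //=; rewrite ?ri'; first by lia.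
apply: runs_skip => //; split=> /=; last by rewrite addn1.
split=> //=.
  by rewrite (take_nth v lt) -cats1 count_cat /= addn0.
refine (layout_ext L1 _) => -[|[|[|[|[|[|k]]]]]] w //=.
case: insub => // b; rewrite /fset2 /row_upto.
case: (b =P v) => //= _; case: (w =P u) => [->|ne].
  by rewrite ru ltnSn /vrank ru.
rewrite ltnS [rank v w <= j]leq_eqVlt; case: (rank v w =P j) => //= e.
have wu : w \notin pref_list v.
  apply/negP => wl; case: ne; rewrite /u -e; by rewrite /rank nth_index.
by move: e; rewrite /rank (memNindex wu) => e; move: lt; rewrite -e /deg ltnn.
Qed.

Lemma counts_loop_ok s : all_regs s -> reg s r_v = 0 ->
  layout n n (ram s) (tab fp zero1 zero1 zero1 zero1 sndcode (fun b w => valid b w)) ->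
  runs W (WhileLt r_v r_n counts_body) s (\sum_(v : V) (300 + 101 * deg v).+1).+1
    (fun s' => [/\ all_regs s', reg s' r_v = n &
       layout n n (ram s') (tab fp zero1 zero1 zero1 (fun w => nvalid w) sndcode vmat)]).
Proof.
move=> lr v0 L0; have nD := n_D DB.
pose Inv i s' := [/\ all_regs s', reg s' r_v = i &
       layout n n (ram s') (tab fp zero1 zero1 zero1 (nv_upto i) sndcode (mat_upto i))].
pose C i := oapp (fun v : V => 300 + 101 * deg v) 0 (insub i).
apply: (@runs_loop W Inv C n) => //.
- by move=> i s' _ [[[[_ h _] _] _] ->].
- by rewrite big_mkord ltnS; apply: leq_sum => v _; rewrite /C valK.
- move=> s' [h1 h2 h4]; split=> //; refine (layout_ext h4 _) => -[|[|[|[|[|[|k]]]]]] w //=.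
    by rewrite /nv_upto ltn_ord.
  by case: insub => // b; rewrite /mat_upto ltn_ord.
move=> i s' lt; have [v ev] : exists v : V, i = v by exists (Ordinal lt).
subst i; move=> [ar rv L].
have -> : C v = 300 + 101 * deg v by rewrite /C valK.
have [[[r2 r4 r5] [r6 r7 r8]] [[r9 r10 r11] [r1 r12 r13]]] := ar.
have dv : deg v <= n := deg_le v.
have vD : v <= D by lia.
have oD := offs_D DB (ltnW lt).
have rowD : base G (6 + v) <= D by apply: (base_D DB); lia.
have b4 : base G 4 <= D by apply: (base_D DB); lia.
rewrite /counts_body.
apply: (runs_assign DW d0) => //=; rewrite ?r6 ?rv ?(lay_off L) //; first by repeat split; lia.
apply: (runs_assign DW d0) => //=; rewrite ?r8 ?rv ?(lay_deg L) //; first by repeat split; lia.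
apply: (runs_assign DW d0) => //=; rewrite ?r7 ?rv ?(lay_row L) //; first by repeat split; lia.
apply: (runs_assign DW d0) => //=.
apply: (runs_assign DW d0) => //=.
apply: (@runs_seq_le _ (101 * deg v).+1 150); first by lia.
apply: runs_conseq (@count_loop_ok v _ _ _ _ _ _ _ _ _) _ _ => //=; first by lia.
move=> s2 [ar2 rv2 r24 L2].
have [[[q2 q4 q5] [q6 q7 q8]] [[q9 q10 q11] [q1 q12 q13]]] := ar2.
have nvD : nvalid v <= D.
  by apply: leq_trans (count_size _ _) _; rewrite -/(deg v); lia.
apply: (runs_write DW d0) => //=; rewrite ?q12 ?rv2 ?r24 //. 
have L3 := tab_set4 L2 v (nvalid v).
apply: (runs_assign DW d0) => //=; rewrite ?rv2; first by lia.
apply: runs_skip => //; split=> //=; first by rewrite addn1.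
refine (layout_ext L3 _) => -[|[|[|[|[|[|k]]]]]] w //=.
rewrite /fset /nv_upto ltnS [w <= v]leq_eqVlt; case: eqP => [->|ne]; first by rewrite eqxx.
by case: eqP => // /val_inj.
Qed.

End Setup.

(** * The main loop on the machine *)

(* Registers 21-25 describe the first post of the current vertex, 33-37 its
   second post (register 26 is 0 if there is none) and 44-48 the scanned post;
   42 records a change of the configuration and 43 a failure. *)
Definition load_first :=
  r_o :=' (r_off @' #r_v) ;; r_d :=' (r_deg @' #r_v) ;;
  21 :=' Deref #r_o ;;
  22 :=' Deref ((r_row @' #21) +' #r_v) ;;
  23 :=' (r_pos @' #21) ;; 24 :=' (r_nv @' #21) ;; 25 :=' (r_flag @' #21) ;;
  26 :=' (r_snd @' #r_v) ;;
  27 :=' (#23 ==' #22) ;;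
  28 :=' (#23 ==' #24) &' (#22 ==' '0) ;;
  31 :=' #28 &' #25 ;; Skip.

Definition load_second :=
  IfLt r_zero 26
    (33 :=' #26 -' '1 ;;
     34 :=' Deref ((r_row @' #33) +' #r_v) ;;
     35 :=' (r_pos @' #33) ;; 36 :=' (r_nv @' #33) ;; 37 :=' (r_flag @' #33) ;;
     29 :=' (#35 ==' #34) ;;
     30 :=' (#35 ==' (#36 +' #34)) ;;
     32 :=' #30 &' #37 &' ('1 <=' #22) ;; Skip)
    (29 :=' '0 ;; 30 :=' '0 ;; 32 :=' (r_flag @' #r_v) ;; Skip) ;;
  38 :=' '0 ;; 39 :=' '0 ;; 40 :=' '0 ;; 41 :=' '0 ;; r_i :=' '0 ;; Skip.

Definition scan_body :=
  44 :=' Deref (#r_o +' #r_i) ;;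
  45 :=' Deref ((r_row @' #44) +' #r_v) ;;
  46 :=' (r_pos @' #44) ;; 47 :=' (r_nv @' #44) ;; 48 :=' (r_flag @' #44) ;;
  49 :=' (r_fp @' #44) &' (~' #38) ;;
  50 :=' ~' (r_fp @' #44) ;;
  51 :=' (#45 <=' #46) ;;
  52 :=' ((#47 +' #45) <=' #46) ;;
  53 :=' (((#49 &' #32) &' #51) |' ((#50 &' #31) &' #52)) &' (~' #48) ;;
  39 :=' #39 |' (#49 &' #51) ;;
  40 :=' #40 |' ((#49 &' (#47 <=' #46)) &' (#45 ==' '0)) ;;
  41 :=' #41 |' (#50 &' #52) ;;
  43 :=' #43 |' (((#49 &' #32) &' #51) &' (#45 ==' '0)) ;;
  38 :=' #38 |' #50 ;;
  42 :=' #42 |' #53 ;;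
  Write (#r_flag +' #44) (#48 |' #53) ;;
  r_i :=' #r_i +' '1 ;; Skip.

(** The flags tested here were loaded before the scan and may have been raised since; this agrees
    with [body], whose kills look at the flags it was given. *)
Definition kill :=
  54 :=' #27 &' (#41 |' #25) ;;
  Write (#r_pos +' #21) (#23 +' #54) ;;
  42 :=' #42 |' #54 ;;
  IfLt r_zero 26
    (54 :=' (#29 &' (#39 |' #37)) |' (#30 &' ((#37 &' (#22 ==' '0)) |' ((~' #37) &' #40))) ;;
     Write (#r_pos +' #33) (#35 +' #54) ;;
     42 :=' #42 |' #54 ;; Skip)
    Skip ;; Skip.

Definition body_prog := load_first ;; load_second ;; WhileLt r_i r_d scan_body ;; kill.

Section Blocks.
Variable G : instance.
Local Notation V := 'I_(nvert G).
Local Notation n := (nvert G).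
Local Notation A := (sideA G).
Variables W D : nat.
Hypothesis DW : 64 * D <= W.
Hypothesis D60 : 60 <= D.
Hypothesis DB : base G (8 + n) <= D.
Let d0 : 0 < D := D_gt0 D60.
Implicit Types (c : cfg G) (a p b u v : V) (out : V -> nat) (s : state).

(** Only positions and flags live in memory; [chg] and [fail] are kept in registers by [status],
    which is why they can be replaced by dummies in configurations under construction. *)
Definition rep c out M := layout n n M
  (tab (fun w => fpost w) (pos c) (fun w => flagged c w) out (fun w => nvalid w) (@sndcode G) (@vmat G)).

Definition loaded c a s :=
  [/\ reg s 21 = first_post a, reg s 22 = vrank (first_post a) a,
      reg s 23 = pos c (first_post a), reg s 24 = nvalid (first_post a)
    & reg s 25 = flagged c (first_post a)] /\
  [/\ reg s 26 = sndcode a, reg s 27 = hi_first c a, reg s 28 = lo_first c a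
    & reg s 31 = mode0 c a].

Definition loaded2 c a s :=
  [/\ reg s 29 = hi_second c a, reg s 30 = lo_second c a, reg s 32 = mode1 c a &
  forall p, second a = Some p -> [/\ reg s 33 = p, reg s 34 = vrank p a,
      reg s 35 = pos c p, reg s 36 = nvalid p & reg s 37 = flagged c p]].

Definition at_vertex a s := [/\ reg s r_v = a, reg s r_o = offs G a & reg s r_d = deg a].
Definition status ch fl s := reg s 42 = nat_of_bool ch /\ reg s 43 = nat_of_bool fl.

Lemma nvalid_le u : nvalid u <= n.
Proof. by apply: leq_trans (count_size _ _) (deg_le u). Qed.

Lemma pos_D c u : bounded c -> pos c u <= D.
Proof.
move=> [/(_ u) le _]; have := n_D DB; have := nvalid_le u.
by move: le; rewrite /cap; case: ifP => _; lia.
Qed.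

Lemma bool_D (b : bool) : b <= D. Proof. exact: leq_trans (leq_b1 b) d0. Qed.

Lemma ord_D u : u <= D.
Proof. by have := n_D DB; have := ltn_ord u; lia. Qed.

Lemma nvalid_D u : nvalid u <= D.
Proof. by have := n_D DB; have := nvalid_le u; lia. Qed.

Lemma vrank_D u v : vrank u v <= D.
Proof. by apply: leq_trans (vrank_le_nvalid _ _) (nvalid_D u). Qed.

Lemma row_D u : base G (6 + u) <= D.
Proof. by apply: (base_D DB); have := ltn_ord u; lia. Qed.

Lemma sndcode_D u : sndcode u <= D.
Proof.
rewrite /sndcode; case: ifP => // _; case: (second u) => // p.
by have := n_D DB; have := ltn_ord p; lia.
Qed.

Lemma deg_D u : deg u <= D.
Proof. by have := n_D DB; have := deg_le u; lia. Qed.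

Lemma rows_D s : all_regs G s -> [/\ reg s r_side <= D, reg s r_off <= D, reg s r_row <= D & reg s r_deg <= D] /\
  [/\ reg s r_fp <= D, reg s r_pos <= D, reg s r_flag <= D & reg s r_out <= D] /\ reg s r_nv <= D /\ reg s r_snd <= D.
Proof.
have nD := n_D DB; have b k : k <= 8 -> base G k <= D.
  by move=> h; apply: (base_D DB); apply: leq_trans h (leq_addr _ _).
move=> [[[r2 r4 r5] [r6 r7 r8]] [[r9 r10 r11] [r1 r12 r13]]].
rewrite r5 r6 r7 r8 r9 r10 r11 r1 r12 r13 !b //; repeat split; lia.
Qed.

Ltac small_tac := rewrite /= ?nandE ?norE ?notE; repeat split;
  first [done | assumption | exact: ord_D | exact: bool_D | exact: nvalid_D | exact: vrank_D
        | exact: row_D | exact: sndcode_D | exact: deg_D | exact: pos_D | lia].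

Lemma load_first_ok c a out s : all_regs G s -> reg s r_v = a -> active a -> bounded c ->
  rep c out (ram s) ->
  runs W load_first s 400 (fun s' => [/\ all_regs G s', at_vertex a s', loaded c a s',
    ram s' = ram s & forall j, 37 < j -> reg s' j = reg s j]).
Proof.
move=> ar rv ac bc L; have [[b5 b6 b7 b8] [[b9 b10 b11 b1] [b12 b13]]] := rows_D ar.
have [[[r2 r4 r5] [r6 r7 r8]] [[r9 r10 r11] [r1 r12 r13]]] := ar.
have oD := offs_D DB (ltnW (ltn_ord a)).
have hd := lst_head ac L; have [aA tf af] := active_first ac.
rewrite /load_first.
apply: (runs_assign DW d0) => //; first by rewrite /= r6 rv (lay_off L) // -r6; small_tac.
rewrite /= r6 rv (lay_off L) //.
apply: (runs_assign DW d0) => //; first by rewrite /= r8 rv (lay_deg L) // -r8; small_tac.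
rewrite /= r8 rv (lay_deg L) //.
apply: (runs_assign DW d0) => //; first by rewrite /= hd; small_tac.
rewrite /= hd; set b := first_post a in hd *.
have Lb k := lay_arr L k b; have ev : vmat b a = vrank b a by rewrite /vmat adj_sym af.
have rowb : ram s (2 + n + n + b) = base G (6 + b) by apply: (lay_row L).
have mat : ram s (base G (6 + b) + a) = vrank b a by rewrite (lay_arr L) tab_row.
apply: (runs_assign DW d0) => //; first by rewrite /= r7 rv rowb mat -r7; small_tac.
rewrite /= r7 rv rowb mat.
apply: (runs_assign DW d0) => //; first by rewrite /= r10 (Lb 1) -r10; small_tac.
rewrite /= r10 (Lb 1) /=.
apply: (runs_assign DW d0) => //; first by rewrite /= r12 (Lb 4) -r12; small_tac.
rewrite /= r12 (Lb 4) /=.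
apply: (runs_assign DW d0) => //; first by rewrite /= r11 (Lb 2) -r11; small_tac.
rewrite /= r11 (Lb 2) /=.
apply: (runs_assign DW d0) => //; first by rewrite /= r13 rv (lay_arr L 5 a) -r13; small_tac.
rewrite /= r13 rv (lay_arr L 5 a) /=.
apply: (runs_assign DW d0) => //; first by small_tac.
apply: (runs_assign DW d0) => //; first by small_tac.
apply: (runs_assign DW d0) => //; first by small_tac.
rewrite /= !nandE.
apply: runs_skip => //; split=> //.
move=> j lt /=.
by do ![case: eqP => [e|_]; first (by move: lt; rewrite e)].
Qed.

Definition ready c a s := [/\ all_regs G s, at_vertex a s, loaded c a s & loaded2 c a s].

Lemma load_second_ok c a out s : all_regs G s -> at_vertex a s -> loaded c a s -> active a ->
  bounded c -> rep c out (ram s) ->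
  runs W load_second s 400 (fun s' => [/\ ready c a s',
    [/\ reg s' 38 = 0, reg s' 39 = 0, reg s' 40 = 0, reg s' 41 = 0 & reg s' r_i = 0],
    ram s' = ram s & forall j, 41 < j -> reg s' j = reg s j]).
Proof.
move=> ar av ld ac bc L; have [[b5 b6 b7 b8] [[b9 b10 b11 b1] [b12 b13]]] := rows_D ar.
have [[[r2 r4 r5] [r6 r7 r8]] [[r9 r10 r11] [r1 r12 r13]]] := ar.
have [rv ro rd] := av; have [[l21 l22 l23 l24 l25] [l26 l27 l28 l31]] := ld.
have sc : reg s 26 = if second a is Some p then p.+1 else 0 by rewrite l26 /sndcode ac.
have fin s2 T : all_regs G s2 -> at_vertex a s2 -> loaded c a s2 -> loaded2 c a s2 ->
    ram s2 = ram s -> (forall j, 41 < j -> reg s2 j = reg s j) -> 30 <= T ->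
    runs W (38 :=' '0 ;; 39 :=' '0 ;; 40 :=' '0 ;; 41 :=' '0 ;; r_i :=' '0 ;; Skip) s2 T
    (fun s' => [/\ ready c a s',
    [/\ reg s' 38 = 0, reg s' 39 = 0, reg s' 40 = 0, reg s' 41 = 0 & reg s' r_i = 0],
    ram s' = ram s & forall j, 41 < j -> reg s' j = reg s j]).
  move=> ar2 av2 ld2 ld3 rm2 un2 T30.
  do 5 (apply: (runs_assign DW d0) => //=; first lia).
  apply: runs_skip => /=; first by lia.
  split=> //= j lt; rewrite -un2 //.
  by do ![case: eqP => [e|_]; first (by move: lt; rewrite e)].
rewrite /load_second; apply: (@runs_if_le _ 250 100) => //; rewrite r2 sc.
case e: (second a) sc => [p|] sc /=.
  have Lp k := lay_arr L k p; have pv : adj p a.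
    have sp : sec a p by rewrite /sec e.
    by rewrite adj_sym; have [? _] := secP sp.
  have mp : vmat p a = vrank p a by rewrite /vmat pv.
  have rowp : ram s (2 + n + n + p) = base G (6 + p) by apply: (lay_row L).
  have mat : ram s (base G (6 + p) + a) = vrank p a by rewrite (lay_arr L) tab_row.
  apply: (runs_assign DW d0) => //.
    by rewrite /= sc; have := sndcode_D a; rewrite /sndcode ac e; small_tac.
  rewrite /= sc subn1 /=.
  apply: (runs_assign DW d0) => //; first by rewrite /= r7 rv rowp mat -r7; small_tac.
  rewrite /= r7 rv rowp mat.
  apply: (runs_assign DW d0) => //; first by rewrite /= r10 (Lp 1) -r10; small_tac.
  rewrite /= r10 (Lp 1) /=.
  apply: (runs_assign DW d0) => //; first by rewrite /= r12 (Lp 4) -r12; small_tac.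
  rewrite /= r12 (Lp 4) /=.
  apply: (runs_assign DW d0) => //; first by rewrite /= r11 (Lp 2) -r11; small_tac.
  rewrite /= r11 (Lp 2) /=.
  apply: (runs_assign DW d0) => //; first by small_tac.
  apply: (runs_assign DW d0) => //; first by small_tac.
  apply: (runs_assign DW d0) => //; first by rewrite /= l22; small_tac.
  rewrite /= !nandE l22.
  apply: runs_skip => //; apply: fin => //=.
  - rewrite /loaded2 /= /hi_second /lo_second /mode1 /lo_second e; split=> //.
      by rewrite andbA.
    by move=> p' [<-].
  - by move=> j lt; do ![case: eqP => [e1|_]; first (by move: lt; rewrite e1)].
apply: (runs_assign DW d0) => //=; apply: (runs_assign DW d0) => //=.
have La := lay_arr L 2 a.
apply: (runs_assign DW d0) => //=; first by rewrite r11 rv La -r11; small_tac.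
rewrite r11 rv La /=; apply: runs_skip => //; apply: fin => //=.
- by rewrite /loaded2 /= /hi_second /lo_second /mode1 e.
- by move=> j lt; do ![case: eqP => [e1|_]; first (by move: lt; rewrite e1)].
Qed.

Definition scan_upto c a j :=
  foldl (scan_step (pos c) (mode1 c a) (mode0 c a) a)
    (Scan false false false false (flagged c) (chg c) (fail c)) (take j (pref_list a)).

Definition scan_regs (t : scan G) s :=
  [/\ reg s 38 = s_seen t, reg s 39 = s_bad2 t, reg s 40 = s_bad0 t & reg s 41 = s_badT t] /\
  status (s_chg t) (s_fail t) s.

Lemma scan_upto_deg c a : scan_upto c a (deg a) = scan_list c a.
Proof. by rewrite /scan_upto take_size. Qed.

Lemma scan_loop_ok c a out s : ready c a s -> bounded c ->
  rep c out (ram s) -> reg s r_i = 0 -> reg s 38 = 0 -> reg s 39 = 0 -> reg s 40 = 0 -> reg s 41 = 0 ->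
  status (chg c) (fail c) s ->
  runs W (WhileLt r_i r_d scan_body) s (deg a * 601).+1
    (fun s' => [/\ ready c a s', scan_regs (scan_list c a) s' &
      rep (Cfg (pos c) (s_odd (scan_list c a)) false false) out (ram s')]).
Proof.
move=> rdy bc L0 ri0 r38 r39 r40 r41 st.
pose Inv j s' := [/\ ready c a s', scan_regs (scan_upto c a j) s', reg s' r_i = j &
      rep (Cfg (pos c) (s_odd (scan_upto c a j)) false false) out (ram s')].
apply: (@runs_loop W Inv (fun _ => 600) (deg a)) => //.
- by move=> j s' _ [[_ [_ _ ->] _ _] _ -> _].
- by rewrite /Inv /scan_regs /scan_upto take0.
- by rewrite sum_nat_const_nat subn0.
- by move=> s' [h1 h2 _ h3]; rewrite -scan_upto_deg.
move=> j s' lt [[ar av ld ld2] [[t38 t39 t40 t41] [t42 t43]] ri L].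
have [[b5 b6 b7 b8] [[b9 b10 b11 b1] [b12 b13]]] := rows_D ar.
have [[[r2 r4 r5] [r6 r7 r8]] [[r9 r10 r11] [r1 r12 r13]]] := ar.
have [rv ro rd] := av; have [_ [_ _ _ l31]] := ld; have [_ _ l32 _] := ld2.
have oD := offs_D DB (ltnW (ltn_ord a)).
have dD := deg_D a; have jD : j <= D by apply: leq_trans dD; exact: ltnW.
have lst := lay_lst L lt; set b := nth a (pref_list a) j in lst.
have step : scan_upto c a j.+1 = scan_step (pos c) (mode1 c a) (mode0 c a) a (scan_upto c a j) b.
  by rewrite /scan_upto (take_nth a lt) foldl_rcons.
have ba : adj b a by rewrite adj_sym -mem_pref_list mem_nth.
rewrite {}/Inv; set t := scan_upto c a j in t38 t39 t40 t41 t42 t43 L step *.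
have Lb k := lay_arr L k b; have mb : vmat b a = vrank b a by rewrite /vmat ba.
have rowb : ram s' (2 + n + n + b) = base G (6 + b) by apply: (lay_row L).
have mat : ram s' (base G (6 + b) + a) = vrank b a by rewrite (lay_arr L) tab_row.
rewrite /scan_body.
apply: (runs_assign DW d0) => //; first by rewrite /= ro ri lst; small_tac.
rewrite /= ro ri lst.
apply: (runs_assign DW d0) => //; first by rewrite /= r7 rv rowb mat -r7; small_tac.
rewrite /= r7 rv rowb mat.
apply: (runs_assign DW d0) => //; first by rewrite /= r10 (Lb 1) -r10; small_tac.
rewrite /= r10 (Lb 1) /=.
apply: (runs_assign DW d0) => //; first by rewrite /= r12 (Lb 4) -r12; small_tac.
rewrite /= r12 (Lb 4) /=.
apply: (runs_assign DW d0) => //; first by rewrite /= r11 (Lb 2) -r11; small_tac.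
rewrite /= r11 (Lb 2) /=.
apply: (runs_assign DW d0) => //; first by rewrite /= r9 (Lb 0) t38 -r9; small_tac.
rewrite /= r9 (Lb 0) t38 /= notE nandE.
apply: (runs_assign DW d0) => //; first by rewrite /= r9 (Lb 0) -r9; small_tac.
rewrite /= r9 (Lb 0) /= notE.
apply: (runs_assign DW d0) => //; first by small_tac.
apply: (runs_assign DW d0) => //; first by small_tac.
apply: (runs_assign DW d0) => //; first by rewrite /= l31 l32; small_tac.
rewrite /= l31 l32 !nandE norE notE nandE.
apply: (runs_assign DW d0) => //; first by rewrite /= t39; small_tac.
rewrite /= t39 nandE norE.
apply: (runs_assign DW d0) => //; first by rewrite /= t40; small_tac.
rewrite /= t40 !nandE norE.
apply: (runs_assign DW d0) => //; first by rewrite /= t41; small_tac.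
rewrite /= t41 nandE norE.
apply: (runs_assign DW d0) => //; first by rewrite /= l32 t43; small_tac.
rewrite /= l32 t43 !nandE norE.
apply: (runs_assign DW d0) => //; first by rewrite /= t38; small_tac.
rewrite /= t38 norE.
apply: (runs_assign DW d0) => //; first by rewrite /= t42; small_tac.
rewrite /= t42 norE.
apply: (runs_write DW d0) => //; first by rewrite /= r11 -r11; small_tac.
  by small_tac.
rewrite /= norE r11.
have L1 := tab_set2 L b (s_odd t b || (fpost b && ~~ s_seen t && mode1 c a && (vrank b a <= pos c b)
   || ~~ fpost b && mode0 c a && (nvalid b + vrank b a <= pos c b)) && ~~ s_odd t b).
apply: (runs_assign DW d0) => //; first by rewrite /= ri; small_tac.
rewrite /= ri addn1; apply: runs_skip => //; split=> //.
  by rewrite step.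
rewrite step; refine (layout_ext L1 _) => -[|[|[|[|[|[|k]]]]]] w //=.
by rewrite /fset ffunE; case: eqP.
Qed.

Lemma kill_ok c a out s : ready c a s -> bounded c -> active a ->
  scan_regs (scan_list c a) s ->
  rep (Cfg (pos c) (s_odd (scan_list c a)) false false) out (ram s) ->
  runs W kill s 400 (fun s' => [/\ ready c a s', reg s' 39 = s_bad2 (scan_list c a),
    status (chg (body c a)) (fail (body c a)) s' & rep (body c a) out (ram s')]).
Proof.
move=> [ar av ld ld2] bc ac [[t38 t39 t40 t41] [t42 t43]] L.
have [[b5 b6 b7 b8] [[b9 b10 b11 b1] [b12 b13]]] := rows_D ar.
have [[[r2 r4 r5] [r6 r7 r8]] [[r9 r10 r11] [r1 r12 r13]]] := ar.
have [[l21 l22 l23 l24 l25] [l26 l27 l28 l31]] := ld; have [l29 l30 l32 l33] := ld2.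
have [aA tf af] := active_first ac; have ff := top_fpost aA tf.
set t := scan_list c a in t38 t39 t40 t41 t42 t43 L *.
set b := first_post a in l21 l22 l23 l24 l25 tf af ff *.
rewrite /kill.
apply: (runs_assign DW d0) => //; first by rewrite /= l27 t41 l25; small_tac.
rewrite /= l27 t41 l25 norE nandE.
rewrite -[_ && (_ || _)]/(kill_first c a).
apply: (runs_write DW d0) => //; first by rewrite /= l21; small_tac.
  by rewrite /= l23; small_tac.
rewrite /= r10 l21 l23.
have L1 := tab_set1 L b (pos c b + kill_first c a).
apply: (runs_assign DW d0) => //; first by rewrite /= t42; small_tac.
rewrite /= t42 norE.
have sc : reg s 26 = if second a is Some p then p.+1 else 0 by rewrite l26 /sndcode ac.
apply: (@runs_if_le _ 150 30) => //=; rewrite r2 sc.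
case e: (second a) sc => [p|] sc /=; last first.
  apply: runs_skip => //; apply: runs_skip => //; split=> //.
    by split=> //=; rewrite /kill_second e orbF.
  by refine (layout_ext L1 _) => -[|[|[|[|[|[|k]]]]]] w //=; rewrite e /fset ffunE; case: eqP.
have [l33p l34 l35 l36 l37] := l33 p e.
have sp : sec a p by rewrite /sec e.
(* A second choice is nobody's top choice, so the first write has not touched its position and the
   copy in register 35 is still current. *)
have pb : p != b by apply: contraNneq (proj2 (secP sp)) => ->.
apply: (runs_assign DW d0) => //.
  by rewrite /= l29 t39 l37 l30 l22 t40; small_tac.
rewrite /= l29 t39 l37 l30 l22 t40 notE !(nandE, norE).
have -> : hi_second c a && (s_bad2 t || flagged c p)
       || lo_second c a && (flagged c p && (vrank b a == 0) || ~~ flagged c p && s_bad0 t) = kill_second c a.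
  by rewrite /kill_second e -/t -/b; case: (flagged c p); rewrite /= ?orbF.
apply: (runs_write DW d0) => //; first by rewrite /= l33p; small_tac.
  by rewrite /= l35; small_tac.
rewrite /= r10 l33p l35.
have L2 := tab_set1 L1 p (pos c p + kill_second c a).
apply: (runs_assign DW d0) => //; first by small_tac.
rewrite /= norE.
apply: runs_skip => //; apply: runs_skip => //; split=> //.
refine (layout_ext L2 _) => -[|[|[|[|[|[|k]]]]]] w //=; rewrite e /fset !ffunE (negbTE pb).
by case: eqP => // _; case: eqP.
Qed.

Lemma body_ok c a out s : all_regs G s -> reg s r_v = a -> active a -> bounded c ->
  status (chg c) (fail c) s -> rep c out (ram s) ->
  runs W body_prog s (1300 + 601 * deg a)
    (fun s' => [/\ ready c a s', reg s' 39 = s_bad2 (scan_list c a),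
      status (chg (body c a)) (fail (body c a)) s' & rep (body c a) out (ram s')]).
Proof.
move=> ar rv ac bc st L; rewrite /body_prog.
apply: (@runs_seq_le _ 400 (900 + 601 * deg a)); first by lia.
apply: runs_conseq (load_first_ok ar rv ac bc L) (leqnn _) _ => s1 [ar1 av1 ld1 rm1 un1].
rewrite -rm1 in L.
apply: (@runs_seq_le _ 400 (500 + 601 * deg a)); first by lia.
apply: runs_conseq (load_second_ok ar1 av1 ld1 ac bc L) (leqnn _) _.
move=> s2 [rdy [z38 z39 z40 z41 zi] rm2 un2].
rewrite -rm2 in L.
apply: (@runs_seq_le _ (deg a * 601).+1 400); first by lia.
have st2 : status (chg c) (fail c) s2.
  by have [h1 h2] := st; split; rewrite un2 // un1.
apply: runs_conseq (scan_loop_ok rdy bc L zi z38 z39 z40 z41 st2) (leqnn _) _.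
move=> s3 [rdy3 sr L3].
exact: kill_ok.
Qed.

End Blocks.

(** * The marking pass and the search loop *)

Definition mark :=
  55 :=' ((#27 |' #28) |' (#29 |' #30)) |' ((#26 ==' '0) &' (#32 |' (~' #39))) ;;
  57 :=' #42 |' #55 ;;
  IfLt r_zero 57 Skip
    (IfLt r_zero 22
       (IfLt r_zero 26 (56 :=' #26 -' '1 ;; Skip) (56 :=' #r_v ;; Skip) ;; Skip)
       (56 :=' #21 ;; Skip) ;;
     48 :=' r_flag @' #56 ;;
     43 :=' #43 |' #48 ;;
     42 :=' ~' #48 ;;
     Write (#r_flag +' #56) '1 ;; Skip) ;;
  Skip.

Definition mark_prog := body_prog ;; mark.

Definition visit p :=
  20 :=' (r_side @' #r_v) &' ('1 <=' (r_deg @' #r_v)) ;;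
  IfLt r_zero 20 p Skip ;;
  r_v :=' #r_v +' '1 ;; Skip.

Definition round_prog :=
  42 :=' '0 ;;
  r_v :=' '0 ;; WhileLt r_v r_n (visit body_prog) ;;
  r_v :=' '0 ;; WhileLt r_v r_n (visit mark_prog) ;; Skip.

Definition search := 42 :=' '1 ;; WhileLt r_zero 42 round_prog ;; Skip.

Section Search.
Variable G : instance.
Local Notation V := 'I_(nvert G).
Local Notation n := (nvert G).
Local Notation A := (sideA G).
Variables W D : nat.
Hypothesis DW : 64 * D <= W.
Hypothesis D60 : 60 <= D.
Hypothesis DB : base G (8 + n) <= D.
Let d0 : 0 < D := D_gt0 D60.
Implicit Types (c : cfg G) (a p b u v : V) (out : V -> nat) (s : state).

Ltac small_tac := rewrite /= ?nandE ?norE ?notE; repeat split;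
  first [done | assumption | exact: (ord_D DW D60 DB) | exact: (bool_D D60) | exact: (nvalid_D DW D60 DB)
        | exact: (vrank_D DW D60 DB) | exact: (row_D DW D60 DB) | exact: (sndcode_D DW D60 DB) | exact: (deg_D DW D60 DB)
        | exact: (pos_D DW D60 DB)
        | exact: (leq_trans _ D60)].

Lemma mark_ok c a out s : ready c a s -> active a -> reg s 39 = s_bad2 (scan_list c a) ->
  status (chg (body c a)) (fail (body c a)) s -> rep (body c a) out (ram s) ->
  runs W mark s 400 (fun s' => [/\ all_regs G s', reg s' r_v = a,
    status (chg (body_mark c a)) (fail (body_mark c a)) s' & rep (body_mark c a) out (ram s')]).
Proof.
move=> [ar av ld ld2] ac t39.
have : body_mark c a = if chg (body c a) || claimed c a then body c a else
  Cfg (pos (body c a)) (updv (flagged (body c a)) (target a) true)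
   (~~ flagged (body c a) (target a)) (fail (body c a) || flagged (body c a) (target a)) by [].
move: (body c a) (body_mark c a) => cb cm ecm [t42 t43] L.
have [[b5 b6 b7 b8] [[b9 b10 b11 b1] [b12 b13]]] := rows_D DW D60 DB ar.
have [[[r2 r4 r5] [r6 r7 r8]] [[r9 r10 r11] [r1 r12 r13]]] := ar.
have [rv ro rd] := av.
have [[l21 l22 l23 l24 l25] [l26 l27 l28 l31]] := ld; have [l29 l30 l32 l33] := ld2.
have sc : reg s 26 = if second a is Some p then p.+1 else 0 by rewrite l26 /sndcode ac.
rewrite /mark.
apply: (runs_assign DW d0) => //.
  by rewrite /= l27 l28 l29 l30 l26 l32 t39; small_tac.
rewrite /= l27 l28 l29 l30 sc l32 t39 notE !(nandE, norE).
have -> : hi_first c a || lo_first c a || (hi_second c a || lo_second c a)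
      || ((if second a is Some p then p.+1 else 0) == 0) && (mode1 c a || ~~ s_bad2 (scan_list c a))
    = claimed c a.
  rewrite /claimed /mode1 -!orbA; do 4 congr (_ || _).
  by case: (second a).
apply: (runs_assign DW d0) => //; first by rewrite /= t42; small_tac.
rewrite /= t42 norE.
apply: (@runs_if_le _ 250 10) => //=; rewrite r2 lt0b ecm.
case: ifP => h.
  by apply: runs_skip => //; apply: runs_skip.
have Lz (z : V) : ram s (base G 2 + z) = flagged cb z := lay_arr L 2 z.
have fin (z : V) s2 : all_regs G s2 -> reg s2 r_v = a -> reg s2 56 = z -> target a = z -> 
    reg s2 42 = chg cb -> reg s2 43 = fail cb -> ram s2 = ram s ->
  runs W (48 :=' r_flag @' #56 ;; 43 :=' #43 |' #48 ;; 42 :=' ~' #48 ;;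
     Write (#r_flag +' #56) '1 ;; Skip) s2 150 (fun s0 => runs W Skip s0 10 (fun s' =>
    [/\ all_regs G s', reg s' r_v = a,
      status (~~ flagged cb (target a)) (fail cb || flagged cb (target a)) s' &
      rep (Cfg (pos cb) (updv (flagged cb) (target a) true)
        (~~ flagged cb (target a)) (fail cb || flagged cb (target a))) out (ram s')])).
  move=> ar2 rv2 q56 ez q42 q43 rm2; rewrite ez.
  have [_ [[q9 q10 q11] _]] := ar2; have [_ [[_ _ c11 _] _]] := rows_D DW D60 DB ar2; have Lz2 := Lz z.
  rewrite -rm2 in Lz2.
  have L2 : rep cb out (ram s2) by rewrite rm2.
  apply: (runs_assign DW d0) => //=; first by rewrite q11 q56 Lz2 -q11; small_tac.
  rewrite q11 q56 Lz2.
  apply: (runs_assign DW d0) => //=; first by rewrite q43; small_tac.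
  rewrite q43 norE.
  apply: (runs_assign DW d0) => //=; first by small_tac.
  rewrite notE.
  apply: (runs_write DW d0) => //=; first by rewrite q11 q56 -q11; small_tac.
  rewrite q11 q56; have L1 := tab_set2 L2 z 1.
  apply: runs_skip => //; apply: runs_skip => //; split=> //.
  refine (layout_ext L1 _) => -[|[|[|[|[|[|k]]]]]] w //=.
  by rewrite /fset ffunE; case: eqP.
apply: (@runs_if_le _ 50 150) => //=; rewrite r2 l22.
have tg : target a = if 0 < vrank (first_post a) a then (if second a is Some p then p else a) else first_post a.
  by rewrite /target; case: vrank.
case: ifP tg => _ tg; last first.
  apply: (runs_assign DW d0) => //; first by rewrite /= l21; small_tac.
  rewrite /= l21; apply: runs_skip => //.
  by apply: (fin (first_post a)).
apply: (@runs_if_le _ 30 10) => //=; rewrite r2 sc.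
case: (second a) tg sc => [p|] tg sc /=.
  apply: (runs_assign DW d0) => //; first by rewrite /= l26; small_tac.
  rewrite /= sc subn1; apply: runs_skip => //; apply: runs_skip => //.
  by apply: (fin p).
apply: (runs_assign DW d0) => //; first by rewrite /= rv; small_tac.
rewrite /= rv; apply: runs_skip => //; apply: runs_skip => //.
by apply: (fin a).
Qed.

Lemma mark_prog_ok c a out s : all_regs G s -> reg s r_v = a -> active a -> bounded c ->
  status (chg c) (fail c) s -> rep c out (ram s) ->
  runs W mark_prog s (1800 + 601 * deg a) (fun s' => [/\ all_regs G s', reg s' r_v = a,
    status (chg (body_mark c a)) (fail (body_mark c a)) s' & rep (body_mark c a) out (ram s')]).
Proof.
move=> ar rv ac bc st L; rewrite /mark_prog.
apply: (@runs_seq_le _ (1300 + 601 * deg a) 400); first by lia.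
apply: runs_conseq (body_ok DW D60 DB ar rv ac bc st L) (leqnn _) _ => s1 [h1 h2 h3 h4].
exact: mark_ok.
Qed.

(** Shared by both passes, with the budget of the dearer one; the cost of a vertex grows with its
    degree, so a pass is linear in the size of the graph. *)
Lemma pass_ok (f : cfg G -> V -> cfg G) (p : cmd) : (forall c a, active a -> bounded c -> bounded (f c a)) ->
  (forall c a out s, all_regs G s -> reg s r_v = a -> active a -> bounded c ->
    status (chg c) (fail c) s -> rep c out (ram s) ->
    runs W p s (1800 + 601 * deg a) (fun s' => [/\ all_regs G s', reg s' r_v = a,
      status (chg (f c a)) (fail (f c a)) s' & rep (f c a) out (ram s')])) ->
  forall c out s, all_regs G s -> reg s r_v = 0 -> bounded c -> status (chg c) (fail c) s ->
  rep c out (ram s) ->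
  runs W (WhileLt r_v r_n (visit p)) s (\sum_(v : V) (2000 + 601 * deg v).+1).+1
   (fun s' => [/\ all_regs G s', status (chg (pass f c (enum V))) (fail (pass f c (enum V))) s'
      & rep (pass f c (enum V)) out (ram s')]).
Proof.
move=> fb fp c out s ar0 rv0 bc0 st0 L0.
pose ci i := pass f c (take i (enum V)).
have bci i : bounded (ci i).
  rewrite /ci; elim: (take i _) c bc0 {st0 L0 ci} => //= a l IH c bc0; apply: IH.
  by case: ifP => // ac; apply: fb.
pose Inv i s' := [/\ all_regs G s', reg s' r_v = i, status (chg (ci i)) (fail (ci i)) s'
      & rep (ci i) out (ram s')].
pose C i := oapp (fun v : V => 2000 + 601 * deg v) 0 (insub i).
apply: (@runs_loop W Inv C n) => //.
- by move=> i s' _ [[[[_ h _] _] _] ->].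
- by rewrite /Inv /ci take0.
- by rewrite big_mkord ltnS; apply: leq_sum => v _; rewrite /C valK.
- by move=> s'; rewrite /Inv /ci take_oversize ?size_enum_ord // => -[].
move=> i s' lt; have [v ev] : exists v : V, i = v by exists (Ordinal lt).
subst i; move=> [ar rv st L].
have -> : C v = 2000 + 601 * deg v by rewrite /C valK.
have cS : ci v.+1 = if active v then f (ci v) v else ci v.
  by rewrite /ci (take_nth v) ?size_enum_ord // nth_ord_enum -cats1 /pass foldl_cat.
have [[b5 b6 b7 b8] _] := rows_D DW D60 DB ar.
have [[[r2 r4 r5] [r6 r7 r8]] _] := ar.
rewrite /visit.
apply: (runs_assign DW d0) => //.
  by rewrite /= r5 r8 rv (lay_side L) (lay_deg L) -r8; small_tac.
rewrite /= r5 r8 rv (lay_side L) (lay_deg L) nandE -active_deg.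
apply: (@runs_if_le _ (1800 + 601 * deg v) 100) => //=; first by lia.
rewrite r2 lt0b.
have fin s2 : all_regs G s2 -> reg s2 r_v = v -> status (chg (ci v.+1)) (fail (ci v.+1)) s2 ->
    rep (ci v.+1) out (ram s2) -> runs W (r_v :=' #r_v +' '1 ;; Skip) s2 100 (Inv v.+1).
  move=> ar2 rv2 st2 L2; apply: (runs_assign DW d0) => //=; first by rewrite rv2; small_tac.
  by rewrite rv2 addn1; apply: runs_skip.
rewrite cS in fin; case: ifP fin => ac fin.
  have h s2 : [/\ all_regs G s2, reg s2 r_v = v, status (chg (f (ci v) v)) (fail (f (ci v) v)) s2
      & rep (f (ci v) v) out (ram s2)] -> runs W (r_v :=' #r_v +' '1 ;; Skip) s2 100 (Inv v.+1).
    by case=> h1 h2 h3 h4; apply: fin.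
  by apply: (runs_conseq (fp (ci v) v out _ _ _ ac (bci v) _ _) (leqnn _) h).
by apply: runs_skip; [lia | apply: fin].
Qed.

Definition round_time := 100 + 2 * (\sum_(v : V) (2000 + 601 * deg v).+1).+1.

Lemma round_ok c out s : all_regs G s -> bounded c -> reg s 43 = fail c -> rep c out (ram s) ->
  runs W round_prog s round_time (fun s' => [/\ all_regs G s',
    status (chg (round c)) (fail (round c)) s' & rep (round c) out (ram s')]).
Proof.
move=> ar bc r43 L; rewrite /round_prog /round_time.
set S := (\sum_v _).+1; have S0 : 0 < S by [].
have eT : 100 + 2 * S = 20 + (S + (40 + (S + 40))) by lia.
rewrite {}eT.
apply: (runs_assign DW d0) => //.
apply: (runs_assign DW d0) => //=.
apply: (@runs_seq_le _ S (40 + (S + 40))); first by lia.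
apply: runs_conseq (pass_ok (@body_bounded G) _ (c := reset c) (out := out) _ _ _ _ _) (leqnn _) _ => //=.
  move=> c' a out' s' ar' rv ac bc' st L'.
  apply: runs_conseq (body_ok DW D60 DB ar' rv ac bc' st L') _ _; first by lia.
  by move=> s2 [[h1 [h2 _ _] _ _] _ h3 h4].
move=> s2 [ar2 st2 L2]; set c2 := pass (@body G) (reset c) (enum V) in st2 L2.
have bc2 : bounded c2 by apply: pass_bounded => //; exact: body_bounded.
apply: (runs_assign DW d0) => //=.
apply: (@runs_seq_le _ S 40); first by lia.
apply: runs_conseq (pass_ok (@mark_bounded G) (@mark_prog_ok) (c := c2) (out := out) _ _ _ _ _) (leqnn _) _ => //=.
move=> s3 [ar3 st3 L3]; by apply: runs_skip.
Qed.

(** The loop register [b] is kept apart from [chg c] because the first round is entered with [b]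
    true although the starting configuration has no change. Being below all solutions is invariant;
    being a solution is known only on exit. *)
Definition search_inv out (b : bool) c s :=
  [/\ all_regs G s, status b (fail c) s, rep c out (ram s) & bounded c] /\
  (forall X O, solution X O -> below X O c) /\ (~~ b -> ~~ fail c -> solution (pos c) (flagged c)).

Lemma search_ok out s P : (forall c, bounded c -> potential c <= P) ->
  all_regs G s -> reg s 43 = 0 -> rep (start G) out (ram s) ->
  runs W search s (20 + (P.+1 * round_time.+1).+1) (fun s' => exists c, search_inv out false c s').
Proof.
move=> hP ar r43 L; rewrite /search.
apply: (runs_assign DW d0) => //=.
(* The loop rule wants a measure of machine states, so the potential is recovered from the rows of
   positions and flags in memory. *)
pose mu s' := \sum_(v : V) (ram s' (base G 1 + v) + ram s' (base G 2 + v)).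
have muE c s' : rep c out (ram s') -> mu s' = potential c.
  by move=> L'; apply: eq_bigr => v _; rewrite (lay_arr L' 1) (lay_arr L' 2).
pose Inv s' := exists (d : bool) c, search_inv out d c s'.
apply: (@runs_seq_le _ (P.+1 * round_time.+1).+1 10); first by move: (_ * _).+1 => z; clear; lia.
apply: (runs_conseq (runs_while (I := Inv) (mu := mu) (C := round_time) (M := P) _ _ _ _ _) (leqnn _)) => //.
- by move=> s' [b [c [[_ _ L' bc] _]]]; rewrite (muE c) // hP.
- move=> s' [b [c [[ar' [st1 st2] L' bc] [bel sol]]]] lt.
  apply: (runs_conseq (round_ok ar' bc st2 L') (leqnn _)) => s2 [ar2 st L2].
  have [le plt] := round_potential c.
  split; last first.
    rewrite (muE _ _ L') (muE _ _ L2); have [[[r2 _ _] _] _] := ar2; have [-> _] := st.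
    by rewrite r2 lt0b.
  exists (chg (round c)), (round c); split; first by split=> //; exact: round_bounded.
  split; first by move=> X O so; apply: round_below => //; exact: bel.
  exact: round_solution.
- exists true, (start G); split; last by split=> // X O so; apply: start_below.
  by split=> //; exact: start_bounded.
move=> s' [[b [c I]] le]; apply: runs_skip => //; exists c.
have [[[[[r2 _ _] _] _] [st1 _] _ _] _] := I.
by move: le I; rewrite r2 st1; case: b {st1}.
Qed.

End Search.

(** * Output *)

Definition put q := Write (#r_out +' #r_v) (#q +' '1) ;; Write (#r_out +' #q) (#r_v +' '1) ;; Skip.

Definition out_prog :=
  load_first ;; load_second ;;
  55 :=' #27 |' #28 ;; IfLt r_zero 55 (put 21) Skip ;;
  55 :=' #29 |' #30 ;; IfLt r_zero 55 (put 33) Skip ;; Skip.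

Definition answer :=
  IfLt r_zero 43 Skip
    (r_v :=' '0 ;; WhileLt r_v r_n (visit out_prog) ;; r_ans :=' '1 ;; Skip) ;; Skip.

Section Output.
Variable G : instance.
Local Notation V := 'I_(nvert G).
Local Notation n := (nvert G).
Local Notation A := (sideA G).
Variables W D : nat.
Hypothesis DW : 64 * D <= W.
Hypothesis D60 : 60 <= D.
Hypothesis DB : base G (8 + n) <= D.
Let d0 : 0 < D := D_gt0 D60.
Implicit Types (c : cfg G) (a p b u v : V) (out : V -> nat) (s : state).

Ltac small_tac := rewrite /= ?nandE ?norE ?notE; repeat split;
  first [done | assumption | exact: (ord_D DW D60 DB) | exact: (bool_D D60) | exact: (deg_D DW D60 DB)
        | exact: (leq_trans _ D60)].

Section Solved.
Variables (c : cfg G) (bc : bounded c) (S : solution (pos c) (flagged c)).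
Let m := sol_mate (pos c).

(** The program tests position [nvalid] and rank 0 separately. This agrees with [lo] because the
    position of a top-choice post never exceeds [nvalid]. *)
Lemma held_first a : active a -> held (pos c) (first_post a) a = hi_first c a || lo_first c a.
Proof.
move=> ac; have [aA tf af] := active_first ac; have vf := top_valid aA tf.
have := sol_fpost S (top_fpost aA tf).
rewrite /held /hi /lo vf /hi_first /lo_first /= => le; congr (_ || _).
by apply/eqP/andP => [e|[/eqP-> /eqP->]]; [split; apply/eqP; lia | rewrite addn0].
Qed.

Lemma held_second a p : active a -> second a = Some p ->
  held (pos c) p a = hi_second c a || lo_second c a.
Proof.
move=> /active_first[aA _ _] e; have sp : sec a p by rewrite /sec e.
by rewrite /held /hi /lo (sec_valid aA sp) /hi_second /lo_second e.
Qed.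

Lemma held_cases q a : held (pos c) q a -> active a /\ (q = first_post a \/ second a = Some q).
Proof.
move=> h; have v := held_valid h; have [aA aq qa] := validP v.
have ac := active_adj aA aq; split=> //.
have [_ tf _] := active_first ac; case/andP: v => _.
case/orP => [t|/eqP]; [by left; apply: top_uniq t tf | by right].
Qed.

(** Both ends of a pair are written when its end in A is visited, so that end decides for both
    cells. *)
Definition out_upto i v : nat :=
  if mate_opt m v is Some u then if (if v \in A then v else u) < i then u.+1 else 0 else 0.

Lemma out_upto_held q a : held (pos c) q a ->
  out_upto a.+1 =1 fset (fset (out_upto a) a q.+1) q a.+1.
Proof.
move=> h; have [aA aq qa] := validP (held_valid h); have qB : q \in A = false.
  by rewrite (adj_side aq) aA.
move=> v; rewrite /out_upto /fset; case: eqP => [->|vq]; first by rewrite (sol_optB h) qB ltnSn.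
case: eqP => [->|va]; first by rewrite (sol_optA S h) aA ltnSn.
case e: (mate_opt m v) => [u|] //; rewrite ltnS leq_eqVlt; case: eqP => //= /val_inj.
case: ifP => vA eva; first by case: va.
rewrite eva in e; case: (sol_opt_spec (pos c) v) => [[q' h']|[a' h']|[_ _]]; rewrite -/m.
- by have [vA' _ _] := validP (held_valid h'); rewrite vA' in vA.
- have := sol_optB h'; rewrite -/m e => -[ea]; rewrite -ea in h'.
  by case: vq; apply: (held_post_uniq S h' h).
- by rewrite e.
Qed.

Lemma out_upto_none a : (forall q, ~~ held (pos c) q a) -> out_upto a.+1 =1 out_upto a.
Proof.
move=> nh v; rewrite /out_upto.
case e: (mate_opt m v) => [u|] //; rewrite ltnS leq_eqVlt; case: eqP => //= /val_inj.
case: ifP => vA eva; case: (sol_opt_spec (pos c) v) => [[q h]|[a' h]|[_ _]]; rewrite -/m ?e //.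
- by rewrite eva (negbTE (nh q)) in h.
- by have [a'A va' _] := validP (held_valid h); have := adj_side va'; rewrite a'A vA.
- by have [vA' _ _] := validP (held_valid h); rewrite vA' in vA.
- have := sol_optB h; rewrite -/m e eva => -[ea].
  by rewrite -ea (negbTE (nh v)) in h.
Qed.

Lemma put_ok out (a q : V) r s : r < NR -> all_regs G s -> reg s r_v = a -> reg s r = q -> rep c out (ram s) ->
  runs W (put r) s 40 (fun s' => reg s' = reg s /\ rep c (fset (fset out a q.+1) q a.+1) (ram s')).
Proof.
move=> rN ar rv rq L.
have [_ [[_ _ _ b1] _]] := rows_D DW D60 DB ar; have [_ [_ [r1 _ _]]] := ar.
rewrite /put.
apply: (runs_write DW d0); [by rewrite /= !andbT | by rewrite /= rv; small_tac | by rewrite /= rq; small_tac | ].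
rewrite /= r1 rv rq addn1; have L1 := tab_set3 L a q.+1.
apply: (runs_write DW d0); [by rewrite /= !andbT | by rewrite /= rq; small_tac | by rewrite /= rv; small_tac | ].
rewrite /= r1 rv rq addn1; have L2 := tab_set3 L1 q a.+1.
exact: runs_skip.
Qed.

Lemma rep_out out out' M : out =1 out' -> rep c out M -> rep c out' M.
Proof. by move=> e L; refine (layout_ext L _) => -[|[|[|[|[|[|k]]]]]] w //=. Qed.

Lemma out_prog_ok a s : all_regs G s -> reg s r_v = a -> active a -> rep c (out_upto a) (ram s) ->
  runs W out_prog s 1200 (fun s' => [/\ all_regs G s', reg s' r_v = a & rep c (out_upto a.+1) (ram s')]).
Proof.
move=> ar rv ac L; rewrite /out_prog.
apply: (@runs_seq_le _ 400 800) => //.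
apply: runs_conseq (load_first_ok DW D60 DB ar rv ac bc L) (leqnn _) _ => s1 [ar1 av1 ld1 rm1 _].
rewrite -rm1 in L.
apply: (@runs_seq_le _ 400 400) => //.
apply: runs_conseq (load_second_ok DW D60 DB ar1 av1 ld1 ac bc L) (leqnn _) _.
move=> s2 [[ar2 [rv2 _ _] ld2 ld3] _ rm2 _]; rewrite -rm2 in L.
have [[l21 l22 l23 l24 l25] [l26 l27 l28 l31]] := ld2; have [l29 l30 l32 l33] := ld3.
have [[[r2 _ _] _] _] := ar2.
have [aA tf _] := active_first ac.
apply: (runs_assign DW d0) => //; first by rewrite /= l27 l28; small_tac.
rewrite /= l27 l28 norE -(held_first ac).
apply: (@runs_if_le _ 60 200) => //=; rewrite r2 lt0b.
case: ifP => h1.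
  apply: (runs_conseq (put_ok (q := first_post a) (a := a) (out := out_upto a) _ _ _ _ _)) => //= s3 [rm3 L3].
  have ar3 : all_regs G s3 by rewrite /all_regs /low_regs rm3; exact: ar2.
  have rv3 : reg s3 r_v = a by rewrite rm3.
  apply: (runs_assign DW d0) => //; first by rewrite /= rm3 /= l29 l30; small_tac.
  rewrite /= rm3 /= l29 l30 norE.
  (* In a solution no vertex is held by two posts, so the second conditional write stays idle. *)
  have h2 : hi_second c a || lo_second c a = false.
    case e: (second a) => [p|]; last by rewrite /hi_second /lo_second e.
    rewrite -(held_second ac e); apply/negP => h2.
    have sp : sec a p by rewrite /sec e.
    by have [_] := secP sp; rewrite (held_post_uniq S h2 h1) (top_fpost aA tf).
  rewrite h2; apply: (@runs_if_le _ 60 20) => //=; rewrite ?rm3 ?r2.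
  apply: runs_skip => //; apply: runs_skip => //; split=> //.
  by apply: rep_out L3 => w; rewrite (out_upto_held h1).
apply: runs_skip => //.
apply: (runs_assign DW d0) => //; first by rewrite /= l29 l30; small_tac.
rewrite /= l29 l30 norE.
apply: (@runs_if_le _ 60 20) => //=; rewrite r2 lt0b.
case: ifP => h2.
  case e: (second a) => [p|]; last by rewrite /hi_second /lo_second e in h2.
  rewrite -(held_second ac e) in h2; have [l33p _ _ _ _] := l33 p e.
  apply: (runs_conseq (put_ok (q := p) (a := a) (out := out_upto a) _ _ _ _ _)) => //= s3 [rm3 L3].
  have ar3 : all_regs G s3 by rewrite /all_regs /low_regs rm3; exact: ar2.
  have rv3 : reg s3 r_v = a by rewrite rm3.
  apply: runs_skip => //; split=> //.
  by apply: rep_out L3 => w; rewrite (out_upto_held h2).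
apply: runs_skip => //; apply: runs_skip => //; split=> //.
apply: rep_out L => w; rewrite out_upto_none // => q; apply/negP => h.
have [_ [eq|eq]] := held_cases h; first by rewrite eq h1 in h.
by rewrite (held_second ac eq) h2 in h.
Qed.

Lemma out_loop_ok s : all_regs G s -> reg s r_v = 0 -> rep c (@zero1 G) (ram s) ->
  runs W (WhileLt r_v r_n (visit out_prog)) s (n * 1501).+1
   (fun s' => all_regs G s' /\ forall v, ram s' (base G 3 + v) = out_upto n v).
Proof.
move=> ar0 rv0 L0.
pose Inv i s' := [/\ all_regs G s', reg s' r_v = i & rep c (out_upto i) (ram s')].
apply: (@runs_loop W Inv (fun _ => 1500) n) => //.
- by move=> i s' _ [[[[_ h _] _] _] ->].
- split=> //; apply: rep_out L0 => w; rewrite /out_upto; by case: (mate_opt m w).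
- by rewrite sum_nat_const_nat subn0.
- by move=> s' [h1 _ h2]; split=> // v; rewrite (lay_arr h2 3).
move=> i s' lt; have [v ev] : exists v : V, i = v by exists (Ordinal lt).
subst i; move=> [ar rv L].
have [[b5 b6 b7 b8] _] := rows_D DW D60 DB ar.
have [[[r2 r4 r5] [r6 r7 r8]] _] := ar.
rewrite /visit.
apply: (runs_assign DW d0) => //.
  by rewrite /= r5 r8 rv (lay_side L) (lay_deg L) -r8; small_tac.
rewrite /= r5 r8 rv (lay_side L) (lay_deg L) nandE -active_deg.
apply: (@runs_if_le _ 1200 100) => //=.
rewrite r2 lt0b.
have fin s2 : [/\ all_regs G s2, reg s2 r_v = v & rep c (out_upto v.+1) (ram s2)] ->
    runs W (r_v :=' #r_v +' '1 ;; Skip) s2 100 (Inv v.+1).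
  move=> [ar2 rv2 L2]; apply: (runs_assign DW d0) => //=; first by rewrite rv2; small_tac.
  by rewrite rv2 addn1; apply: runs_skip.
case: ifP => ac.
  by apply: (runs_conseq (out_prog_ok _ _ ac _) (leqnn _) fin).
apply: runs_skip => //; apply: fin; split=> //=.
apply: rep_out L => w; rewrite out_upto_none // => q; apply/negP => /held_cases[].
by rewrite ac.
Qed.

Lemma answer_ok s : all_regs G s -> reg s 43 = 0 -> rep c (@zero1 G) (ram s) ->
  runs W answer s (n * 1501 + 40) (fun s' => reg s' r_ans = 1 /\ writes s' (mate_set m)).
Proof.
move=> ar r43 L; have [[[r2 _ _] _] _] := ar; rewrite /answer.
apply: (@runs_if_le _ (n * 1501 + 30) 5) => //; first by clear; lia.
rewrite r2 r43 ltnn.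
apply: (runs_assign DW d0) => //; first by rewrite /=; clear; lia.
rewrite /=.
apply: (@runs_seq_le _ (n * 1501).+1 20); first by clear; lia.
apply: (runs_conseq (out_loop_ok _ _ _) (leqnn _)) => // s2 [[_ [_ [r1 _ _]]] h].
apply: (runs_assign DW d0) => //=; apply: runs_skip => //; apply: runs_skip => //; split=> //= v.
by rewrite /= r1 h (partner_mate_set _ (sol_mate_mating S)) /out_upto; case: mate_opt => // u; rewrite ltn_ord.
Qed.

End Solved.

Lemma answer_none s : reg s r_zero < reg s 43 -> runs W answer s 10 (fun s' => s' = s).
Proof. by move=> h; apply: (@runs_if_le _ 2 3) => //; rewrite h; apply: runs_skip => //; apply: runs_skip. Qed.

End Output.

(** * Running time *)

Section Counting.
Variable G : instance.
Local Notation V := 'I_(nvert G).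
Local Notation n := (nvert G).

(** Incidences are counted twice: neighbours of [v] inject into the edges through [v], and an edge
    has at most two ends. *)
Lemma sum_deg_le : \sum_(v : V) deg v <= 2 * #|edges G|.
Proof.
have deg_edges (v : V) : deg v <= \sum_(e in edges G) (v \in e).
  rewrite /deg size_sort -cardE -(@card_in_imset _ _ (fun u => [set v; u])); last first.
    by move=> u u' _ _ /set2_inj.
  rewrite big_mkcond /= -sum1_card big_mkcond /=; apply: leq_sum => e _.
  case: imsetP => // -[u vu ->]; rewrite set21.
  suff -> : [set v; u] \in edges G by [].
  by rewrite inE; apply/existsP; exists v; apply/existsP; exists u; rewrite eqxx andbT.
apply: leq_trans (leq_sum _ (fun v _ => deg_edges v)) _.
rewrite exchange_big /= mulnC -sum_nat_const; apply: leq_sum => e.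
rewrite inE => /existsP[x /existsP[y /andP[_ /eqP->]]].
rewrite -(big_mkcond (fun v => v \in [set x; y]) (fun _ => 1)) sum1_card cards2.
by case: (x != y).
Qed.

(** Exchanging the sums, each vertex of A is valid for at most its top and its second choice. *)
Lemma sum_nvalid_le : \sum_(v : V) nvalid v <= 2 * n.
Proof.
have le1 (Q : pred V) : (forall v w, Q v -> Q w -> v = w) -> \sum_v (Q v : nat) <= 1.
  move=> uq; case: (pickP Q) => [v Qv|Q0]; last by rewrite big1 // => v _; rewrite Q0.
  rewrite (bigD1 v) //= Qv big1 // => w wv; case Qw: (Q w) => //.
  by rewrite (uq w v) // eqxx in wv.
apply: (@leq_trans (\sum_(v : V) \sum_(a : V) valid v a)).
  apply: leq_sum => v _.
  rewrite /nvalid -size_filter -(card_uniqP (filter_uniq _ (pref_list_uniq v))).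
  rewrite -sum1_card big_mkcond /=; apply: leq_sum => a _.
  by rewrite mem_filter; case: (valid v a) => //=; case: ifP.
rewrite exchange_big /= mulnC -[n in n * _]card_ord -sum_nat_const; apply: leq_sum => a _.
apply: (@leq_trans (\sum_v (top a v + sec a v))).
  by apply: leq_sum => v _; rewrite /valid; case: (a \in _); case: top; case: sec.
rewrite big_split /=; apply: (@leq_add _ _ 1 1); apply: le1.
  by move=> v w; apply: top_uniq.
by move=> v w; rewrite /sec => /eqP-> /eqP[].
Qed.

(** Positions amount to at most twice the sum of [nvalid], hence to 4n and to twice the total
    degree; flags add at most n, and at most the total degree by [bounded]. The factor 5 covers both
    bounds. *)
Lemma potential_le_min (c : cfg G) : bounded c -> potential c <= 5 * minn n (\sum_(v : V) deg v).
Proof.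
move=> [bp bf]; set S := \sum_v _.
have h1 : \sum_v pos c v <= 2 * \sum_(v : V) nvalid v.
  rewrite big_distrr /=; apply: leq_sum => v _; apply: leq_trans (bp v) _.
  by rewrite /cap; case: ifP; rewrite mul2n -addnn // leq_addr.
have h2 : \sum_(v : V) nvalid v <= S by apply: leq_sum => v _; apply: count_size.
have h3 := sum_nvalid_le.
have h4 : \sum_v (flagged c v : nat) <= n.
  by rewrite -[leqRHS]card_ord -sum1_card; apply: leq_sum => v _; apply: leq_b1.
have h5 : \sum_v (flagged c v : nat) <= S.
  apply: leq_sum => v _; case f: (flagged c v) => //.
  by have := bf v f; rewrite /deg; case: (pref_list v).
rewrite /potential big_split /=; clearbody S; clear -h1 h2 h3 h4 h5.
move: (\sum_v pos c v) (\sum_v nvalid v) (\sum_v flagged c v) h1 h2 h3 h4 h5 => x y z; lia.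
Qed.

End Counting.

(** * The whole program and its running time *)

Definition popular_prog :=
  setup_offsets ;; WhileLt r_v r_n offsets_body ;; setup_bases ;; WhileLt r_v r_n rows_body ;;
  r_v :=' '0 ;; WhileLt r_v r_n marks_body ;; r_v :=' '0 ;; WhileLt r_v r_n counts_body ;;
  43 :=' '0 ;; search ;; r_ans :=' '0 ;; answer.

(** The main term is the number of rounds times the length of a round. Both [minn n T * n] and
    [minn n T * T] are at most [n * T]; bounding the rounds by n alone would leave a term n^2. *)
Lemma time_arith n T m : T <= 2 * m ->
  200 + (n * 101 + 1 + (200 + (n * 201 + 1 +
  (10 + (301 * n + 101 * T + 1 + (10 + (301 * n + 101 * T + 1 +
  (10 + (20 + ((5 * minn n T).+1 * (100 + 2 * (2001 * n + 601 * T).+1).+1).+1 +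
  (10 + (n * 1501 + 40)))))))))))
  <= 100 * 1000 * (maxn 1 n * maxn 1 m).
Proof.
move=> le; set k := maxn 1 n; set l := maxn 1 m; set U := k * l.
have k1 : 1 <= k by apply: leq_maxl.
have l1 : 1 <= l by apply: leq_maxl.
have nk : n <= k by apply: leq_maxr.
have Tl : T <= 2 * l by apply: leq_trans le _; rewrite leq_mul2l leq_maxr.
have U1 : 1 <= U by rewrite muln_gt0 k1.
have nU : n <= U by rewrite -[n]muln1 leq_mul.
have TU : T <= 2 * U by rewrite /U mulnCA -[T]mul1n leq_mul.
have mn : minn n T * n <= 2 * U.
  rewrite mulnC /U mulnCA; apply: leq_mul => //; apply: leq_trans Tl; exact: geq_minr.
have mT : minn n T * T <= 2 * U.
  rewrite /U mulnCA; apply: leq_mul => //; apply: leq_trans nk; exact: geq_minl.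
have mU : minn n T <= U by apply: leq_trans nU; exact: geq_minl.
clearbody U; move: (minn n T) mn mT mU => z mn mT mU.
clear -U1 nU TU mn mT mU.
have -> : (5 * z).+1 * (100 + 2 * (2001 * n + 601 * T).+1).+1 =
  103 + 4002 * n + 1202 * T + 5 * (103 * z + 4002 * (z * n) + 1202 * (z * T)) by lia.
lia.
Qed.

Section Main.
Variable G : instance.
Local Notation V := 'I_(nvert G).
Local Notation n := (nvert G).
Variables W D : nat.
Hypothesis DW : 64 * D <= W.
Hypothesis D60 : 60 <= D.
Hypothesis DB : base G (8 + n) <= D.
Let d0 : 0 < D := D_gt0 D60.
Let S := \sum_(v : V) deg v.

Definition total_time := 200 + (n * 101 + 1 + (200 + (n * 201 + 1 +
  (10 + (301 * n + 101 * S + 1 + (10 + (301 * n + 101 * S + 1 +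
  (10 + (20 + ((5 * minn n S).+1 * (round_time G).+1).+1 + (10 + (n * 1501 + 40))))))))))).

Lemma sum_affine k l : \sum_(v : V) (k + l * deg v).+1 = k.+1 * n + l * S.
Proof.
under eq_bigr => v _ do rewrite -addSn.
by rewrite big_split /= sum_nat_const card_ord -big_distrr mulnC.
Qed.

Definition decided s :=
  (reg s r_ans = 1 /\ exists c : cfg G, solution (pos c) (flagged c) /\
     writes s (mate_set (sol_mate (pos c)))) \/
  (reg s r_ans = 0 /\ forall X O, ~ @solution G X O).

Lemma popular_prog_ok : runs W popular_prog (initial G) total_time decided.
Proof.
have L0 : layout 0 0 (ram (initial G)) (fun _ (_ : V) => 0) := initial_layout G.
rewrite /popular_prog /total_time.
apply: runs_seq.
apply: runs_conseq (setup_offsets_ok DW D60 DB (s := initial G) erefl (lay_n L0)) (leqnn _) _ => s1 [lr1 v1 a1 m1].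
apply: runs_seq; rewrite -m1 in L0.
have eT k : \sum_(0 <= i < n) k.+1 = n * k.+1 by rewrite sum_nat_const_nat subn0.
apply: (runs_conseq (offsets_loop_ok DW D60 DB lr1 v1 a1 L0)); first by rewrite eT addn1.
move=> s2 [lr2 v2 a2 L2]; apply: runs_seq.
apply: runs_conseq (setup_bases_ok DW D60 DB lr2 a2) (leqnn _) _ => s3 [ar3 v3 a3 m3].
rewrite -m3 in L2; apply: runs_seq.
apply: (runs_conseq (rows_loop_ok DW D60 DB ar3 v3 a3 L2)); first by rewrite eT addn1.
move=> s4 [ar4 _ L4].
have pad r (k : nat) p s T Q : r < NR -> runs W p (State (upd (reg s) r 0) (ram s)) T Q ->
    runs W (r :=' '0 ;; p) s (10 + T) Q.
  move=> rN h; apply: (runs_assign DW d0) => //=; first by rewrite rN.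
  by apply: runs_conseq h _ _ => //; clear; lia.
apply: (pad r_v 0) => //; apply: runs_seq.
apply: (runs_conseq (marks_loop_ok DW D60 DB (s := State _ _) _ _ L4)) => //.
  by rewrite sum_affine addn1.
move=> s5 [ar5 _ L5]; apply: (pad r_v 0) => //; apply: runs_seq.
apply: (runs_conseq (counts_loop_ok DW D60 DB (s := State _ _) _ _ L5)) => //.
  by rewrite sum_affine addn1.
move=> s6 [ar6 _ L6]; apply: (pad 43 0) => //; apply: runs_seq.
have L7 : rep (start G) (@zero1 G) (ram s6).
  by refine (layout_ext L6 _) => -[|[|[|[|[|[|k]]]]]] w //=; rewrite ffunE.
apply: (runs_conseq (search_ok DW D60 DB (s := State _ _) (@potential_le_min G) _ _ L7)) => //.
move=> s8 [c [[ar8 [_ r43] L8 bc] [bel sol]]]; apply: (pad r_ans 0) => //.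
case f: (fail c) r43 bel sol => r43 bel sol.
  have [[[r2 _ _] _] _] := ar8.
  apply: (runs_conseq (@answer_none W _ _)); first by rewrite /= r2 r43.
    by clear; lia.
  move=> s9 ->; right; split=> // X O so; by have [_ _] := bel X O so; rewrite f.
have so := sol isT isT.
apply: (runs_conseq (answer_ok DW D60 DB bc so (s := State _ _) _ _ L8)) => //.
by move=> s9 [r0 wr]; left; split=> //; exists c.
Qed.

Lemma total_time_le : total_time <= 100 * 1000 * (maxn 1 n * maxn 1 #|edges G|).
Proof.
rewrite /total_time /round_time sum_affine.
exact: time_arith (sum_deg_le G).
Qed.

End Main.

Local Open Scope ring_scope.

(** The memory used is quadratic in [N], and [64 * 22 <= 2 ^ 11 <= N ^ 11]; this is the origin of
    the exponent 13. *)
Lemma word_arith k T m : (T <= 2 * m)%N ->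
  (64 * (2 + 4 * k + T + k * (8 + k) + 60) <= (k + m + 2) ^ 13)%N.
Proof.
move=> le; set N := (k + m + 2)%N; have N2 : (2 <= N)%N by rewrite /N; lia.
have e1 : (2 + 4 * k + T + k * (8 + k) + 60 <= 22 * (N * N))%N by rewrite /N; nia.
apply: (@leq_trans (2 ^ 11 * N ^ 2)%N).
  rewrite -mulnn; apply: (@leq_trans (64 * (22 * (N * N)))%N); first by rewrite leq_mul2l e1 orbT.
  by rewrite mulnA leq_mul2r orbC.
by rewrite -[13%N]/(11 + 2)%N expnD leq_mul2r leq_exp2r // N2 orbT.
Qed.

Lemma word_bound (G : instance) :
  (64 * (base G (8 + nvert G) + 60) <= (nvert G + #|edges G| + 2) ^ 13)%N.
Proof. by rewrite baseE offs_n; apply: word_arith (sum_deg_le G). Qed.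

Theorem theorem9 (c : rat) (c_gt3 : 3 < c) :
  exists (P : cmd) (K d : nat), forall G : instance,
    (forall v, v \in sideA G -> weight v = c) ->
    (forall v, v \notin sideA G -> weight v = 1) ->
    let n := nvert G in
    let m := #|edges G| in
    exists (t : nat) (s : state),
      [/\ exec ((n + m + 2) ^ d)%N P (initial G) t s,
          (t <= K * (maxn 1 n * maxn 1 m))%N
        & correct_answer G s].
Proof.
(* The program is the same for every [c]: prices are never computed and occur only in the proof that
   its answer is right. *)
exists popular_prog, (100 * 1000)%N, 13%N => G wA wB n m.
have ag : agree (initial G) (initial G) by [].
have [t [s [s' [ex le [ar am] dec]]]] :=
  popular_prog_ok (word_bound G) (leq_addl _ _) (leq_addr _ _) ag.
exists t, s; split=> //; first exact: leq_trans le (total_time_le G).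
case: dec => [[r0 [x [so wr]]]|[r0 none]]; [left | right]; rewrite ar //; split=> //.
  exists (mate_set (sol_mate (pos x))); split; first exact: solution_popular so c c_gt3 wA wB.
  by move=> v; rewrite ar // am; apply: wr.
case=> M /popularP[mM pM].
exact: none (popular_solution c_gt3 wA wB (mate_mating mM) pM).
Qed.
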